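(* Let $1<m<2$, let $N\geq 1$, and let $\gamma_1,\dots,\gamma_N\in\mathbb{R}$ satisfy \[ \sum_{j\in J}\gamma_j\neq 0\qquad\text{for every nonempty } J\subset\{1,2,\dots,N\}. \] Consider the point vortex system \[ \dot X_j=\sum_{k\neq j}\gamma_k\nabla^\perp G_m(X_j-X_k),\qquad X_j(0)=x_j,\qquad j=1,\dots,N, \] with $X_j(t)\in\mathbb{R}^2$. Then there is a set $\mathcal N\subset(\mathbb{R}^2)^N$ of Lebesgue measure zero such that for every initial condition $(x_1,\dots,x_N)\in(\mathbb{R}^2)^N\setminus\mathcal N$ this initial value problem has a global (defined for all $t\geq0$) smooth solution.
   Context: $G_m$ is the Green function of the fractional Laplacian $(-\Delta)^{m/2}$ on $\mathbb{R}^2$, given by $G_m(x)=\frac{\Gamma(\frac{2-m}{2})}{2^{m/2}\pi|\Gamma(\frac m2)|}|x|^{m-2}$, and $\nabla^\perp=(-\partial_{x_2},\partial_{x_1})$. A solution is global in particular means that no two vortices collide ($X_i(t)\neq X_j(t)$ for $i\ne j$) and none escapes to infinity at any finite time. *)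

(* Defs.v *)
From Stdlib Require Import Reals.
From Coquelicot Require Import Coquelicot.
Open Scope R_scope.

Definition Gamma (s : R) : R :=
  RInt_gen (fun t => Rpower t (s - 1) * exp (- t)) (at_right 0) (Rbar_locally p_infty).

Definition norm2 (x : R * R) : R := sqrt (fst x ^ 2 + snd x ^ 2).

(* Green function of (-Delta)^(m/2) on R^2 *)
Definition G (m : R) (x : R * R) : R :=
  Gamma ((2 - m) / 2) / (Rpower 2 (m / 2) * PI * Rabs (Gamma (m / 2)))
  * Rpower (norm2 x) (m - 2).

Definition nabla_perp (f : R * R -> R) (x : R * R) : R * R :=
  (- Derive (fun y => f (fst x, y)) (snd x), Derive (fun y => f (y, snd x)) (fst x)).

Definition velocity (N : nat) (gamma : nat -> R) (m : R) (X : nat -> R * R) (j : nat)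
  : R * R :=
  (sum_f_R0 (fun k => if Nat.eq_dec k j then 0
                      else gamma k * fst (nabla_perp (G m) (fst (X j) - fst (X k), snd (X j) - snd (X k))))
            (N - 1),
   sum_f_R0 (fun k => if Nat.eq_dec k j then 0
                      else gamma k * snd (nabla_perp (G m) (fst (X j) - fst (X k), snd (X j) - snd (X k))))
            (N - 1)).

(* X : time -> index -> R^2 is a global (t >= 0) smooth solution with X(0) = x:
   no collisions for t >= 0, values finite for all t >= 0 (no escape to infinity),
   right-continuous at 0, C^oo on (0, oo) and satisfying the ODE there. *)
Definition global_smooth_solution (N : nat) (gamma : nat -> R) (m : R)
  (x : nat -> R * R) (X : R -> nat -> R * R) : Prop :=
  (forall j, (j < N)%nat -> X 0 j = x j) /\
  (forall t j k, 0 <= t -> (j < N)%nat -> (k < N)%nat -> j <> k -> X t j <> X t k) /\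
  (forall j, (j < N)%nat ->
     filterlim (fun t => fst (X t j)) (at_right 0) (locally (fst (x j))) /\
     filterlim (fun t => snd (X t j)) (at_right 0) (locally (snd (x j)))) /\
  (forall j n t, (j < N)%nat -> 0 < t ->
     ex_derive_n (fun s => fst (X s j)) n t /\ ex_derive_n (fun s => snd (X s j)) n t) /\
  (forall j t, (j < N)%nat -> 0 < t ->
     is_derive (fun s => fst (X s j)) t (fst (velocity N gamma m (X t) j)) /\
     is_derive (fun s => snd (X s j)) t (snd (velocity N gamma m (X t) j))).

Fixpoint prodR (N : nat) (f : nat -> R) : R :=
  match N with O => 1 | S n => prodR n f * f n end.

(* Lebesgue measure zero in (R^2)^N (points are x : nat -> R*R, only indices < N matter):
   for every eps > 0, S is covered by countably many closed boxes of total volume <= eps. *)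
Definition null_set (N : nat) (S : (nat -> R * R) -> Prop) : Prop :=
  forall eps, 0 < eps ->
  exists a b : nat -> nat -> R * R,
    (forall n j, fst (a n j) <= fst (b n j) /\ snd (a n j) <= snd (b n j)) /\
    (forall M, sum_f_R0 (fun n => prodR N (fun j =>
        (fst (b n j) - fst (a n j)) * (snd (b n j) - snd (a n j)))) M <= eps) /\
    (forall x, S x -> exists n, forall j, (j < N)%nat ->
        fst (a n j) <= fst (x j) <= fst (b n j) /\ snd (a n j) <= snd (x j) <= snd (b n j)).

(* Main.v *)
Require Import Defs.
From Stdlib Require Import Reals Lra Lia Psatz Classical ClassicalEpsilon FunctionalExtensionality List Bool.
From Coquelicot Require Import Coquelicot.
Open Scope R_scope.

(** Replace the kernel below distance [eps = sigma ^ 2] by a smooth one. The regularized flow is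
    global and preserves volume. Because no subset of the circulations sums to zero, vortices that
    start in a fixed box stay in a larger box up to time [T], uniformly in [sigma]: a tight cluster
    follows its center of vorticity, while a spread out one splits into groups that evolve almost
    independently.

    If two vortices come within [eps], the squared distance of this pair has dropped from
    [4 eps ^ 2] to [eps ^ 2] (unless the pair was already that close at time 0). The mutual velocity
    of the pair is orthogonal to its separation, so the drop is due to the other vortices; relative
    to [eps ^ 2], its rate is at most a constant times [r ^ (m - 3) / eps], with [r] the distance
    to a third vortex. Integrated over phase space, which by volume preservation may be done at time 0, this
    gives [eps ^ 2 / eps] times [sigma ^ (m - 3)] when the third vortex is farther than [sigma], and
    [eps ^ 2 sigma ^ 2 / eps] times [eps ^ (m - 3)] when it is nearer. Both are at most
    [sigma ^ (m - 1)], which tends to 0 since [m > 1]. By Markov's inequality, the initial data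
    with a near collision have small measure. Where some [sigma] avoids near collisions up to [T],
    the regularized trajectory solves the singular system up to [T].

    Integrals are Riemann sums over fine lattices, so that covers by boxes come for free. Volume
    preservation is obtained from the Euler scheme applied to one coordinate at a time: each such
    substitution is one-dimensional with Jacobian [1 + h d_i v_i], and the [d_i v_i] sum to 0. *)

(** * Preliminaries *)

(** The constants of the regularized field (speed, Lipschitz and Taylor bounds) blow up as [sigma]
    tends to 0. They enter only the discretization errors, and the parameters are chosen in the
    order target volume, [sigma], time step, mesh, so the blow-up is harmless. Two bounds must
    instead be uniform in [sigma]. One is the confinement radius, which fixes the volume factor in
    front of the final power of [sigma]; its proof uses only that the kernel is odd and bounded at
    distance at least 1. The other is the size of the kernel beyond distance [sigma], at most
    [q = sigma ^ (m - 3)]; closer in, the bound is of order [q ^ 2], since [eps = sigma ^ 2]. In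
    these terms the two contributions of a third vortex have the sizes [sigma ^ 2 * q] and its
    square. *)

Lemma lip_of_derive (f df : R -> R) (B a b : R) :
  (forall t, Rmin a b <= t <= Rmax a b -> is_derive f t (df t)) ->
  (forall t, Rmin a b <= t <= Rmax a b -> Rabs (df t) <= B) ->
  Rabs (f b - f a) <= B * Rabs (b - a).
Proof.
  intros Hd HB.
  destruct (MVT_gen f a b df) as [c [Hc He]].
  - intros t Ht; apply Hd; lra.
  - intros t Ht. apply derivable_continuous_pt. exists (df t).
    apply is_derive_Reals, Hd, Ht.
  - rewrite He, Rabs_mult. apply Rmult_le_compat_r; [apply Rabs_pos | auto].
Qed.

Lemma taylor_of_lip_derive (f df : R -> R) (C a b : R) :
  (forall t, is_derive f t (df t)) ->
  (forall s t, Rabs (df s - df t) <= C * Rabs (s - t)) ->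
  Rabs (f b - f a - df a * (b - a)) <= C * (b - a) ^ 2.
Proof.
  intros Hd HC.
  assert (HC0 : 0 <= C).
  { specialize (HC 1 0). rewrite Rminus_0_r, Rabs_R1 in HC.
    pose proof (Rabs_pos (df 1 - df 0)). lra. }
  set (g := fun t => f t - df a * t).
  replace (f b - f a - df a * (b - a)) with (g b - g a) by (unfold g; ring).
  replace (C * (b - a) ^ 2) with (C * Rabs (b - a) * Rabs (b - a)).
  2:{ rewrite Rmult_assoc, <- Rabs_mult. f_equal.
      rewrite Rabs_pos_eq; [ring | apply Rle_0_sqr]. }
  apply (lip_of_derive g (fun t => df t - df a)).
  - intros t _. unfold g. auto_derive; [exists (df t); apply Hd | ].
    replace (Derive (fun x => f x) t) with (df t); [ring|].
    symmetry; apply is_derive_unique, Hd.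
  - intros t Ht. eapply Rle_trans; [apply HC|].
    apply Rmult_le_compat_l; auto.
    unfold Rmin, Rmax in Ht; destruct (Rle_dec a b);
      unfold Rabs; destruct (Rcase_abs (t - a)), (Rcase_abs (b - a)); lra.
Qed.

Lemma exp_le a b : a <= b -> exp a <= exp b.
Proof. intros [H| ->]; [left; apply exp_increasing; auto | right; auto]. Qed.

(** Here [n] counts the terms, whereas [sum_f_R0] has one more; empty sums exist and inductions
    start at 0. *)
Fixpoint rsum (n : nat) (f : nat -> R) : R :=
  match n with O => 0 | S k => rsum k f + f k end.

Lemma rsum_ext n f g : (forall i, (i < n)%nat -> f i = g i) -> rsum n f = rsum n g.
Proof.
  induction n as [|n IH]; intros H; simpl; auto.
  rewrite IH, H; auto.
Qed.

Lemma rsum_le n f g : (forall i, (i < n)%nat -> f i <= g i) -> rsum n f <= rsum n g.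
Proof.
  induction n as [|n IH]; intros H; simpl; [lra|].
  apply Rplus_le_compat; auto.
Qed.

Lemma rsum_plus n f g : rsum n (fun i => f i + g i) = rsum n f + rsum n g.
Proof. induction n as [|n IH]; simpl; [ring|rewrite IH; ring]. Qed.

Lemma rsum_scal n c f : rsum n (fun i => c * f i) = c * rsum n f.
Proof. induction n as [|n IH]; simpl; [ring|rewrite IH; ring]. Qed.

Lemma rsum_minus n f g : rsum n (fun i => f i - g i) = rsum n f - rsum n g.
Proof. induction n as [|n IH]; simpl; [ring|rewrite IH; ring]. Qed.

Lemma rsum_const n c : rsum n (fun _ => c) = INR n * c.
Proof.
  induction n as [|n IH]; [simpl; ring|].
  simpl rsum. rewrite IH, S_INR; ring.
Qed.

Lemma rsum_bound n f c : (forall i, (i < n)%nat -> f i <= c) -> rsum n f <= INR n * c.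
Proof. intros H. rewrite <- rsum_const. apply rsum_le, H. Qed.

Lemma rsum_pos n f : (forall i, (i < n)%nat -> 0 <= f i) -> 0 <= rsum n f.
Proof.
  intros H. replace 0 with (INR n * 0) by ring.
  rewrite <- rsum_const. apply rsum_le, H.
Qed.

Lemma rsum_zero n f : (forall i, (i < n)%nat -> f i = 0) -> rsum n f = 0.
Proof.
  intros H. rewrite (rsum_ext n f (fun _ => 0)); auto.
  rewrite rsum_const; ring.
Qed.

Lemma rsum_abs n f : Rabs (rsum n f) <= rsum n (fun i => Rabs (f i)).
Proof.
  induction n as [|n IH]; simpl; [rewrite Rabs_R0; lra|].
  eapply Rle_trans; [apply Rabs_triang|]. lra.
Qed.

Lemma rsum_term_le n f i :
  (forall j, (j < n)%nat -> 0 <= f j) -> (i < n)%nat -> f i <= rsum n f.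
Proof.
  induction n as [|n IH]; intros H Hi; [lia|]. simpl.
  destruct (Nat.eq_dec i n) as [->|Hne].
  - pose proof (rsum_pos n f). assert (0 <= rsum n f) by (apply H0; auto). lra.
  - assert (f i <= rsum n f) by (apply IH; [auto|lia]).
    pose proof (H n). assert (0 <= f n) by auto. lra.
Qed.

Lemma rsum_swap n m (f : nat -> nat -> R) :
  rsum n (fun i => rsum m (fun j => f i j)) = rsum m (fun j => rsum n (fun i => f i j)).
Proof.
  induction n as [|n IH]; simpl.
  - symmetry; apply rsum_zero; auto.
  - rewrite IH, <- rsum_plus. reflexivity.
Qed.

Lemma rsum_telescope n f : rsum n (fun k => f (S k) - f k) = f n - f 0%nat.
Proof. induction n as [|n IH]; simpl; [ring|rewrite IH; ring]. Qed.

Lemma rsum_double n f :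
  rsum (2 * n) f = rsum n (fun j => f (2 * j)%nat + f (2 * j + 1)%nat).
Proof.
  induction n as [|n IH]; [reflexivity|].
  replace (2 * S n)%nat with (S (S (2 * n))) by lia.
  cbn [rsum]. rewrite IH. replace (S (2 * n)) with (2 * n + 1)%nat by lia. ring.
Qed.

Lemma rsum_sum_f_R0 n f : (1 <= n)%nat -> rsum n f = sum_f_R0 f (n - 1).
Proof.
  intros Hn. destruct n as [|n]; [lia|].
  replace (S n - 1)%nat with n by lia. clear Hn.
  induction n as [|n IH]; [simpl; ring|].
  change (rsum (S n) f + f (S n) = sum_f_R0 f n + f (S n)). rewrite IH. reflexivity.
Qed.

Lemma is_derive_rsum n (f : nat -> R -> R) df t :
  (forall i, (i < n)%nat -> is_derive (f i) t (df i)) ->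
  is_derive (fun s => rsum n (fun i => f i s)) t (rsum n df).
Proof.
  induction n as [|n IH]; intros H; simpl.
  - apply (is_derive_const (K := R_AbsRing) (V := R_NormedModule) 0).
  - apply (is_derive_plus (K := R_AbsRing) (V := R_NormedModule)); auto.
Qed.

Lemma continuous_rsum n (f : nat -> R -> R) t :
  (forall i, (i < n)%nat -> continuous (f i) t) ->
  continuous (fun s => rsum n (fun i => f i s)) t.
Proof.
  induction n as [|n IH]; intros H; simpl.
  - apply continuous_const.
  - apply (continuous_plus (V := R_NormedModule)); auto.
Qed.

Definition upd (x : nat -> R) (i : nat) (s : R) : nat -> R :=
  fun j => if Nat.eq_dec j i then s else x j.

Lemma upd_eq x i s : upd x i s i = s.
Proof. unfold upd; destruct (Nat.eq_dec i i); congruence. Qed.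

Lemma upd_neq x i s j : j <> i -> upd x i s j = x j.
Proof. unfold upd; destruct (Nat.eq_dec j i); congruence. Qed.

Lemma upd_comm x i j s t : i <> j -> upd (upd x i s) j t = upd (upd x j t) i s.
Proof.
  intros H; apply functional_extensionality; intros k.
  unfold upd; destruct (Nat.eq_dec k j), (Nat.eq_dec k i); congruence.
Qed.

Lemma upd_upd x i s t : upd (upd x i s) i t = upd x i t.
Proof.
  apply functional_extensionality; intros k.
  unfold upd; destruct (Nat.eq_dec k i); congruence.
Qed.

(** A function that is Lipschitz for this l1 distance ignores the coordinates from [n] on; this is
    how functions on R^n are encoded. *)
Definition dist (n : nat) (x y : nat -> R) : R := rsum n (fun i => Rabs (x i - y i)).

Lemma dist_pos n x y : 0 <= dist n x y.
Proof. apply rsum_pos; intros; apply Rabs_pos. Qed.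

Lemma dist_le n x y e :
  (forall i, (i < n)%nat -> Rabs (x i - y i) <= e) -> dist n x y <= INR n * e.
Proof. apply rsum_bound. Qed.

Lemma dist_coord n x y i : (i < n)%nat -> Rabs (x i - y i) <= dist n x y.
Proof.
  intros Hi. apply (rsum_term_le n (fun i => Rabs (x i - y i))); auto.
  intros; apply Rabs_pos.
Qed.

Lemma dist_upd n x y i e :
  0 <= e -> (forall j, j <> i -> x j = y j) -> Rabs (x i - y i) <= e -> dist n x y <= e.
Proof.
  intros He Hj Hi. unfold dist. induction n as [|n IH]; simpl; auto.
  destruct (Nat.eq_dec n i) as [->|Hne].
  - rewrite rsum_zero; [lra|]. intros k Hk. rewrite Hj by lia.
    rewrite Rminus_diag; apply Rabs_R0.
  - rewrite (Hj n Hne), Rminus_diag, Rabs_R0. lra.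
Qed.

(** * Lattice sums *)

Definition pt (L : R) (M k : nat) : R := - L + INR k * (2 * L / INR M).

Definition lsum (L : R) (M : nat) (f : R -> R) : R :=
  2 * L / INR M * rsum M (fun k => f (pt L M k)).

(* A Riemann sum of [F] over the cube [-L, L]^n; [x] only supplies the coordinates from [n] on. *)
Fixpoint lint (L : R) (M n : nat) (F : (nat -> R) -> R) (x : nat -> R) : R :=
  match n with
  | O => F x
  | S k => lsum L M (fun s => lint L M k F (upd x k s))
  end.

Section Lattice.
Variables (L : R) (M : nat).
Hypotheses (HL : 0 < L) (HM : (0 < M)%nat).

Lemma mesh_pos : 0 < 2 * L / INR M.
Proof. apply Rdiv_lt_0_compat; [lra|]. apply lt_0_INR; auto. Qed.

Lemma INR_M_neq0 : INR M <> 0.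
Proof. apply not_0_INR; lia. Qed.

Lemma pt_S k : pt L M (S k) = pt L M k + 2 * L / INR M.
Proof. unfold pt; rewrite S_INR; ring. Qed.

Lemma pt_0 : pt L M 0 = - L.
Proof. unfold pt; simpl; ring. Qed.

Lemma pt_M : pt L M M = L.
Proof. unfold pt. field. apply INR_M_neq0. Qed.

Lemma lsum_le f g : (forall s, f s <= g s) -> lsum L M f <= lsum L M g.
Proof.
  intros H. apply Rmult_le_compat_l; [pose proof mesh_pos; lra|].
  apply rsum_le; auto.
Qed.

Lemma lsum_ext f g : (forall s, f s = g s) -> lsum L M f = lsum L M g.
Proof. intros H. unfold lsum. f_equal. apply rsum_ext; auto. Qed.

Lemma lsum_plus f g : lsum L M (fun s => f s + g s) = lsum L M f + lsum L M g.
Proof. unfold lsum. rewrite rsum_plus; ring. Qed.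

Lemma lsum_scal c f : lsum L M (fun s => c * f s) = c * lsum L M f.
Proof. unfold lsum. rewrite rsum_scal; ring. Qed.

Lemma lsum_const c : lsum L M (fun _ => c) = 2 * L * c.
Proof. unfold lsum. rewrite rsum_const. field. apply INR_M_neq0. Qed.

Lemma lint_le n F G x : (forall y, F y <= G y) -> lint L M n F x <= lint L M n G x.
Proof.
  intros H; revert x; induction n as [|n IH]; intros x; simpl; auto.
  apply lsum_le; intros; apply IH.
Qed.

Lemma lint_ext n F G x : (forall y, F y = G y) -> lint L M n F x = lint L M n G x.
Proof. intros H; apply Rle_antisym; apply lint_le; intros y; rewrite H; lra. Qed.

Lemma lint_plus n F G x :
  lint L M n (fun y => F y + G y) x = lint L M n F x + lint L M n G x.
Proof.
  revert x; induction n as [|n IH]; intros x; simpl; auto.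
  rewrite <- lsum_plus. apply lsum_ext; intros; apply IH.
Qed.

Lemma lint_scal n c F x : lint L M n (fun y => c * F y) x = c * lint L M n F x.
Proof.
  revert x; induction n as [|n IH]; intros x; simpl; auto.
  rewrite <- lsum_scal. apply lsum_ext; intros; apply IH.
Qed.

Lemma lint_const n c x : lint L M n (fun _ => c) x = (2 * L) ^ n * c.
Proof.
  revert x; induction n as [|n IH]; intros x; simpl; [ring|].
  rewrite (lsum_ext _ (fun _ => (2 * L) ^ n * c)) by (intros; apply IH).
  rewrite lsum_const; ring.
Qed.

Lemma lint_rsum n k (F : nat -> (nat -> R) -> R) x :
  lint L M n (fun y => rsum k (fun i => F i y)) x = rsum k (fun i => lint L M n (F i) x).
Proof.
  induction k as [|k IH]; simpl.
  - rewrite lint_const; ring.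
  - rewrite lint_plus, IH; reflexivity.
Qed.

Lemma lint_abs n F x c :
  (forall y, Rabs (F y) <= c) -> Rabs (lint L M n F x) <= (2 * L) ^ n * c.
Proof.
  intros H. apply Rabs_le; split.
  - replace (- ((2 * L) ^ n * c)) with ((2 * L) ^ n * (- c)) by ring.
    rewrite <- (lint_const n (- c) x). apply lint_le. intros y.
    specialize (H y). apply Rabs_le_between in H. lra.
  - rewrite <- (lint_const n c x). apply lint_le. intros y.
    specialize (H y). apply Rabs_le_between in H. lra.
Qed.

Lemma lint_upd n D x j s :
  (n <= j)%nat -> lint L M n D (upd x j s) = lint L M n (fun y => D (upd y j s)) x.
Proof.
  revert x; induction n as [|n IH]; intros x Hn; simpl; auto.
  apply lsum_ext; intros t. rewrite upd_comm by lia. apply IH; lia.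
Qed.

(* A one-dimensional inequality in the i-th variable integrates to all variables:
   finite sums commute, so the i-th sum may be taken first. *)
Lemma lint_coord_le n D D' x i :
  (i < n)%nat ->
  (forall y, lsum L M (fun s => D (upd y i s)) <= lsum L M (fun s => D' (upd y i s))) ->
  lint L M n D x <= lint L M n D' x.
Proof.
  revert x; induction n as [|n IH]; intros x Hi H; [lia|]. simpl.
  destruct (Nat.eq_dec i n) as [->|Hne].
  - assert (E : forall F, lsum L M (fun s => lint L M n F (upd x n s))
                 = lint L M n (fun y => lsum L M (fun s => F (upd y n s))) x).
    { intros F. unfold lsum at 2. rewrite lint_scal, lint_rsum. unfold lsum. f_equal.
      apply rsum_ext; intros k _. apply lint_upd; lia. }
    rewrite !E. apply lint_le; auto.
  - apply lsum_le; intros s. apply IH; [lia|auto].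
Qed.

Lemma lint_coord_abs n D x i e :
  (i < n)%nat -> (forall y, Rabs (lsum L M (fun s => D (upd y i s))) <= 2 * L * e) ->
  Rabs (lint L M n D x) <= (2 * L) ^ n * e.
Proof.
  intros Hi H. apply Rabs_le; split.
  - replace (- ((2 * L) ^ n * e)) with ((2 * L) ^ n * (- e)) by ring.
    rewrite <- (lint_const n (- e) x). apply lint_coord_le with i; auto. intros y.
    rewrite lsum_const. specialize (H y). apply Rabs_le_between in H. lra.
  - rewrite <- (lint_const n e x). apply lint_coord_le with i; auto. intros y.
    rewrite lsum_const. specialize (H y). apply Rabs_le_between in H. lra.
Qed.

End Lattice.

(** * Flows of Lipschitz vector fields *)

Lemma increment_le (f g df dg : R -> R) (a b : R) :
  a <= b ->
  (forall t, a <= t <= b -> is_derive f t (df t)) ->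
  (forall t, a <= t <= b -> is_derive g t (dg t)) ->
  (forall t, a <= t <= b -> df t <= dg t) ->
  f b - f a <= g b - g a.
Proof.
  intros Hab Hf Hg H.
  destruct (MVT_gen (fun t => f t - g t) a b (fun t => df t - dg t)) as [c [Hc He]];
    rewrite ?Rmin_left, ?Rmax_right by lra.
  - intros t Ht; apply (is_derive_minus (K := R_AbsRing) (V := R_NormedModule));
      [apply Hf|apply Hg]; lra.
  - intros t Ht. apply derivable_continuous_pt. exists (df t - dg t).
    apply is_derive_Reals, (is_derive_minus (K := R_AbsRing) (V := R_NormedModule));
      [apply Hf|apply Hg]; lra.
  - rewrite Rmin_left, Rmax_right in Hc by lra. specialize (H c Hc). nra.
Qed.

Lemma is_derive_primitive (g : R -> R) (a t : R) :
  (forall s, continuous g s) -> is_derive (fun t => RInt g a t) t (g t).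
Proof.
  intros Hg. apply (is_derive_RInt (V := R_NormedModule) g (fun t => RInt g a t) a).
  - apply filter_forall; intros s. apply (RInt_correct (V := R_CompleteNormedModule)).
    apply (ex_RInt_continuous (V := R_CompleteNormedModule)); auto.
  - apply Hg.
Qed.

Lemma primitive_at_origin (g : R -> R) a : RInt g a a = 0.
Proof. apply (RInt_point (V := R_CompleteNormedModule)). Qed.

(** The weight [exp (lam * Rabs t)] gains a factor [1 / lam] on integration, over all times at once.
    With a large [lam] this makes Picard iteration contract without cutting time into short
    intervals. The primitive and its majorant are compared by their derivatives, separately on each
    side of 0. *)
Lemma RInt_exp_bound (g : R -> R) (C lam t : R) :
  0 < lam -> (forall s, continuous g s) -> (forall s, Rabs (g s) <= C * exp (lam * Rabs s)) ->
  Rabs (RInt g 0 t) <= C / lam * exp (lam * Rabs t).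
Proof.
  intros Hl Hg Hb.
  assert (HC : 0 <= C).
  { specialize (Hb 0). rewrite Rabs_R0, Rmult_0_r, exp_0 in Hb.
    pose proof (Rabs_pos (g 0)); lra. }
  assert (HCl : 0 <= C / lam) by (apply Rdiv_le_0_compat; lra).
  pose proof (primitive_at_origin g 0) as H0.
  assert (Hd : forall c s, is_derive (fun t => c * RInt g 0 t) s (c * g s)).
  { intros c s. apply (is_derive_scal (fun t => RInt g 0 t)), is_derive_primitive; auto. }
  assert (Hge : forall c s, Rabs c = 1 -> c * g s <= C * exp (lam * Rabs s)).
  { intros c s Hc. eapply Rle_trans; [apply Rle_abs|]. rewrite Rabs_mult, Hc, Rmult_1_l. auto. }
  assert (H : forall c, Rabs c = 1 -> c * RInt g 0 t <= C / lam * exp (lam * Rabs t)).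
  { intros c Hc. destruct (Rle_dec 0 t) as [Ht|Ht].
    - rewrite (Rabs_pos_eq t) by auto.
      assert (A := increment_le _ (fun s => C / lam * exp (lam * s)) _
        (fun s => C * exp (lam * s)) 0 t Ht (fun s _ => Hd c s)).
      cbv beta in A. rewrite H0, Rmult_0_r, (Rmult_0_r lam), exp_0 in A.
      assert (c * RInt g 0 t - 0 <= C / lam * exp (lam * t) - C / lam * 1); [|lra].
      apply A; intros s Hs.
      + auto_derive; [trivial|field; lra].
      + specialize (Hge c s Hc). rewrite (Rabs_pos_eq s) in Hge by lra. exact Hge.
    - assert (Ht' : t <= 0) by lra. rewrite (Rabs_left t) by lra.
      assert (A := increment_le _ (fun s => - (C / lam) * exp (lam * - s)) _
        (fun s => C * exp (lam * - s)) t 0 Ht' (fun s _ => Hd (- c) s)).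
      cbv beta in A. rewrite H0, Rmult_0_r, Ropp_0, (Rmult_0_r lam), exp_0 in A.
      assert (0 - - c * RInt g 0 t <= - (C / lam) * 1 - - (C / lam) * exp (lam * - t)); [|lra].
      apply A; intros s Hs.
      + auto_derive; [trivial|field; lra].
      + assert (Hc' : Rabs (- c) = 1) by (rewrite Rabs_Ropp; auto).
        specialize (Hge (- c) s Hc'). rewrite (Rabs_left1 s) in Hge by lra. exact Hge. }
  apply Rabs_le. split.
  - specialize (H (-1)). rewrite Rabs_left in H by lra. specialize (H ltac:(lra)). lra.
  - specialize (H 1 Rabs_R1). lra.
Qed.

Lemma continuous_of_dist n (Y : R -> nat -> R) (f : (nat -> R) -> R) (lam t : R) :
  0 <= lam -> (forall x y, Rabs (f x - f y) <= lam * dist n x y) ->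
  (forall j, (j < n)%nat -> continuous (fun s => Y s j) t) ->
  continuous (fun s => f (Y s)) t.
Proof.
  intros Hlam Hf HY.
  assert (Hc : continuous (fun s => dist n (Y s) (Y t)) t).
  { apply (continuous_rsum n (fun i s => Rabs (Y s i - Y t i))); intros i Hi.
    apply continuous_comp with (f := fun s => Y s i - Y t i) (g := Rabs).
    - apply (continuous_minus (V := R_NormedModule)); [auto|apply continuous_const].
    - apply continuous_Rabs. }
  assert (H0 : dist n (Y t) (Y t) = 0).
  { apply rsum_zero; intros; rewrite Rminus_diag; apply Rabs_R0. }
  apply filterlim_locally; intros eps.
  assert (He : 0 < eps / (lam + 1)) by (apply Rdiv_lt_0_compat; [apply eps|lra]).
  apply filterlim_locally with (eps := mkposreal _ He) in Hc.
  revert Hc; apply filter_imp; intros s Hs.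
  unfold ball in Hs |- *; simpl in Hs |- *; unfold AbsRing_ball in Hs |- *.
  unfold abs, minus, plus, opp in Hs |- *; simpl in Hs |- *.
  rewrite H0, Ropp_0, Rplus_0_r, Rabs_pos_eq in Hs by apply dist_pos.
  eapply Rle_lt_trans; [apply Hf|].
  apply (Rmult_lt_compat_l (lam + 1)) in Hs; [|lra].
  replace ((lam + 1) * (eps / (lam + 1))) with (pos eps) in Hs by (field; lra).
  pose proof (dist_pos n (Y s) (Y t)). lra.
Qed.

(** [E t * exp (- c * t)] is nonincreasing. *)
Lemma Gronwall_square (E dE : R -> R) (c T : R) :
  (forall t, 0 <= t <= T -> is_derive E t (dE t)) ->
  (forall t, 0 <= t <= T -> dE t <= c * E t) ->
  forall t, 0 <= t <= T -> E t <= E 0 * exp (c * t).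
Proof.
  intros HE Hc t Ht.
  assert (H : E t * exp (- c * t) - E 0 * exp (- c * 0) <= 0 - 0).
  { apply (increment_le (fun s => E s * exp (- c * s)) (fun _ => 0)
             (fun s => dE s * exp (- c * s) + E s * (- c * exp (- c * s))) (fun _ => 0));
      [lra| | |].
    - intros s Hs.
      apply (is_derive_mult (K := R_AbsRing) E (fun s => exp (- c * s)));
        [apply HE; lra | | apply Rmult_comm].
      auto_derive; [trivial|ring].
    - intros s Hs. apply (is_derive_const (K := R_AbsRing) (V := R_NormedModule)).
    - intros s Hs. assert (Hs' : 0 <= s <= T) by lra. specialize (Hc s Hs').
      pose proof (exp_pos (- c * s)). nra. }
  rewrite Rmult_0_r, exp_0 in H.
  assert (Hexp : exp (- c * t) * exp (c * t) = 1).
  { rewrite <- exp_plus. replace (- c * t + c * t) with 0 by ring. apply exp_0. }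
  pose proof (exp_pos (c * t)).
  assert (E t * exp (- c * t) * exp (c * t) <= E 0 * exp (c * t)) by nra.
  rewrite Rmult_assoc, Hexp in H1. lra.
Qed.

Lemma is_derive_sq_diff (f g : R -> R) (s df dg : R) :
  is_derive f s df -> is_derive g s dg ->
  is_derive (fun s => (f s - g s) ^ 2) s (2 * (f s - g s) * (df - dg)).
Proof.
  intros Hf Hg. auto_derive.
  - repeat split; eexists; eassumption.
  - replace (Derive (fun x => f x) s) with df by (symmetry; apply is_derive_unique, Hf).
    replace (Derive (fun x => g x) s) with dg by (symmetry; apply is_derive_unique, Hg).
    ring.
Qed.

(** Sum [f i * f j <= (f i ^ 2 + f j ^ 2) / 2] over all pairs of indices. *)
Lemma rsum_Cauchy_Schwarz n f : rsum n f * rsum n f <= INR n * rsum n (fun i => f i ^ 2).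
Proof.
  apply Rle_trans with (rsum n (fun i => rsum n (fun j => (f i ^ 2 + f j ^ 2) / 2))).
  - rewrite <- rsum_scal. apply rsum_le; intros i Hi.
    rewrite Rmult_comm, <- rsum_scal. apply rsum_le; intros j Hj.
    pose proof (pow2_ge_0 (f i - f j)). nra.
  - right. transitivity (rsum n (fun i => / 2 * rsum n (fun j => f j ^ 2) + (/2 * INR n) * f i ^ 2)).
    + apply rsum_ext; intros i Hi.
      rewrite (rsum_ext n _ (fun j => / 2 * f j ^ 2 + / 2 * f i ^ 2)) by (intros; field).
      rewrite rsum_plus, rsum_scal, rsum_const. ring.
    + rewrite rsum_plus, rsum_const, !rsum_scal. field.
Qed.

Lemma rsum_sq_le n f : rsum n (fun i => f i ^ 2) <= rsum n (fun i => Rabs (f i)) ^ 2.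
Proof.
  induction n as [|n IH]; cbn [rsum]; [lra|].
  assert (0 <= rsum n (fun i => Rabs (f i))) by (apply rsum_pos; intros; apply Rabs_pos).
  pose proof (Rabs_pos (f n)). rewrite <- (pow2_abs (f n)).
  pose proof (Rmult_le_pos _ _ H H0). nra.
Qed.

Section Flow.
Variables (n : nat) (v : nat -> (nat -> R) -> R) (lam : R).
Hypothesis (Hlam : 0 <= lam).
Hypothesis (Hv : forall i x y, Rabs (v i x - v i y) <= lam * dist n x y).

Definition trajectory (X : R -> nat -> R) : Prop :=
  forall i t, (i < n)%nat -> is_derive (fun s => X s i) t (v i (X t)).

Fixpoint picard (k : nat) (x : nat -> R) (t : R) : nat -> R :=
  match k with
  | O => x
  | S k => fun i => x i + RInt (fun s => v i (picard k x s)) 0 t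
  end.

Lemma picard_continuous k x i t : continuous (fun s => picard k x s i) t.
Proof.
  revert i t; induction k as [|k IH]; intros i t; simpl.
  - apply continuous_const.
  - apply (continuous_plus (V := R_NormedModule)); [apply continuous_const|].
    apply (ex_derive_continuous (K := R_AbsRing) (V := R_NormedModule)).
    eexists; apply is_derive_primitive. intros s.
    apply (continuous_of_dist n) with lam; auto.
Qed.

Lemma v_picard_continuous k x i t : continuous (fun s => v i (picard k x s)) t.
Proof.
  apply (continuous_of_dist n) with lam; auto. intros; apply picard_continuous.
Qed.

(** With this weight a Picard step at least halves the weighted distance of two iterates, as
    [n * lam / mu <= 1 / 2]; the summand 1 keeps [mu] positive. *)
Let mu := 2 * INR n * lam + 1.

Lemma mu_pos : 0 < mu.
Proof. unfold mu. pose proof (pos_INR n). nra. Qed.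

Lemma picard_step x :
  exists C, 0 <= C /\ forall k i t, (i < n)%nat ->
    Rabs (picard (S k) x t i - picard k x t i) <= C / 2 ^ k * exp (mu * Rabs t).
Proof.
  pose proof mu_pos as Hmu.
  set (V := rsum n (fun i => Rabs (v i x))).
  assert (HV : 0 <= V) by (apply rsum_pos; intros; apply Rabs_pos).
  exists (V / mu). split; [apply Rdiv_le_0_compat; auto|].
  induction k as [|k IH]; intros i t Hi.
  - assert (Hcancel : forall a b : R, a + b - a = b) by (intros; ring).
    change (Rabs (x i + RInt (fun _ => v i x) 0 t - x i) <= V / mu / 2 ^ 0 * exp (mu * Rabs t)).
    rewrite Hcancel.
    eapply Rle_trans; [apply (RInt_exp_bound _ V mu); auto|].
    + intros; apply continuous_const.
    + intros s. assert (1 <= exp (mu * Rabs s)).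
      { rewrite <- exp_0. apply exp_le. pose proof (Rabs_pos s); nra. }
      assert (Rabs (v i x) <= V)
        by (apply (rsum_term_le n (fun i => Rabs (v i x))); auto; intros; apply Rabs_pos).
      nra.
    + right; field; lra.
  - assert (Hcancel : forall a b c : R, a + b - (a + c) = b - c) by (intros; ring).
    change (Rabs (x i + RInt (fun s => v i (picard (S k) x s)) 0 t
                  - (x i + RInt (fun s => v i (picard k x s)) 0 t))
            <= V / mu / 2 ^ S k * exp (mu * Rabs t)).
    rewrite Hcancel.
    rewrite <- (RInt_minus (V := R_CompleteNormedModule)).
    2,3: apply (ex_RInt_continuous (V := R_CompleteNormedModule)); intros; apply v_picard_continuous.
    eapply Rle_trans; [apply (RInt_exp_bound _ (lam * (INR n * (V / mu / 2 ^ k))) mu); auto|].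
    + intros s; apply (continuous_minus (V := R_NormedModule)); apply v_picard_continuous.
    + intros s. eapply Rle_trans; [apply Hv|].
      rewrite Rmult_assoc. apply Rmult_le_compat_l; auto.
      rewrite Rmult_assoc. apply dist_le. intros j Hj. apply IH; auto.
    + apply Rmult_le_compat_r; [left; apply exp_pos|].
      assert (H2 : 0 < 2 ^ k) by (apply pow_lt; lra).
      replace (V / mu / 2 ^ S k) with (/ 2 * mu * (V / mu / 2 ^ k) / mu)
        by (simpl; field; split; lra).
      unfold Rdiv at 1 4. apply Rmult_le_compat_r; [left; apply Rinv_0_lt_compat; lra|].
      rewrite <- Rmult_assoc. apply Rmult_le_compat_r.
      * apply Rdiv_le_0_compat; [apply Rdiv_le_0_compat|]; lra.
      * unfold mu. lra.
Qed.

Lemma geometric_limit (u : nat -> R) (C : R) :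
  (forall k, Rabs (u (S k) - u k) <= C / 2 ^ k) ->
  exists l, forall k, Rabs (l - u k) <= 2 * C / 2 ^ k.
Proof.
  intros Hu.
  assert (HC : 0 <= C).
  { specialize (Hu 0%nat). simpl in Hu. pose proof (Rabs_pos (u 1%nat - u 0%nat)). lra. }
  assert (Hp : forall k, 0 < 2 ^ k) by (intros; apply pow_lt; lra).
  assert (Hm : forall m k, Rabs (u (k + m)%nat - u k) <= 2 * C / 2 ^ k - 2 * C / 2 ^ (k + m)).
  { induction m as [|m IH]; intros k.
    - rewrite Nat.add_0_r, Rminus_diag, Rabs_R0. lra.
    - rewrite <- plus_n_Sm.
      replace (u (S (k + m)) - u k) with
        ((u (S (k + m)) - u (k + m)%nat) + (u (k + m)%nat - u k)) by ring.
      eapply Rle_trans; [apply Rabs_triang|].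
      specialize (IH k). specialize (Hu (k + m)%nat).
      replace (2 * C / 2 ^ S (k + m)) with (2 * C / 2 ^ (k + m) - C / 2 ^ (k + m)); [lra|].
      simpl. field. pose proof (Hp (k + m)%nat); lra. }
  assert (Hm' : forall k m, (k <= m)%nat -> Rabs (u m - u k) <= 2 * C / 2 ^ k).
  { intros k m Hkm. replace m with (k + (m - k))%nat by lia.
    eapply Rle_trans; [apply Hm|].
    assert (0 <= 2 * C / 2 ^ (k + (m - k))) by (apply Rdiv_le_0_compat; [lra|auto]). lra. }
  assert (Hcau : Cauchy_crit u).
  { intros e He.
    destruct (pow_lt_1_zero (/ 2)) with (y := e / (4 * C + 1)) as [K HK].
    - rewrite Rabs_pos_eq; lra.
    - apply Rdiv_lt_0_compat; lra.
    - exists K. intros p q Hp' Hq'. unfold Rdist.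
      replace (u p - u q) with ((u p - u K) - (u q - u K)) by ring.
      eapply Rle_lt_trans; [apply Rabs_triang|]. rewrite Rabs_Ropp.
      assert (H1 := Hm' K p Hp'). assert (H2 := Hm' K q Hq').
      specialize (HK K (le_n K)). rewrite Rabs_pos_eq, pow_inv in HK
        by (apply pow_le; lra).
      assert (/ 2 ^ K * (4 * C + 1) < e).
      { apply (Rmult_lt_compat_r (4 * C + 1)) in HK; [|lra].
        replace (e / (4 * C + 1) * (4 * C + 1)) with e in HK by (field; lra). exact HK. }
      assert (0 < / 2 ^ K) by (apply Rinv_0_lt_compat, Hp).
      unfold Rdiv in *. lra. }
  destruct (Rcomplete.R_complete u Hcau) as [l Hl]. exists l. intros k.
  apply le_epsilon. intros e He. destruct (Hl e He) as [K HK].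
  specialize (HK (Nat.max K k) (Nat.le_max_l _ _)). unfold Rdist in HK.
  specialize (Hm' k (Nat.max K k) (Nat.le_max_r _ _)).
  replace (l - u k) with (- (u (Nat.max K k) - l) + (u (Nat.max K k) - u k)) by ring.
  eapply Rle_trans; [apply Rabs_triang|]. rewrite Rabs_Ropp. lra.
Qed.

(** The Picard iterates converge geometrically, uniformly on bounded time intervals. The limit is
    therefore continuous and satisfies the integral equation, which yields the derivative. *)
Lemma trajectory_exists x :
  exists X : R -> nat -> R, (forall i, X 0 i = x i) /\ trajectory X.
Proof.
  pose proof mu_pos as Hmu.
  destruct (picard_step x) as [C [HC Hstep]].
  assert (Hlim : forall ti : R * nat, exists l, (snd ti < n)%nat ->
            forall k, Rabs (l - picard k x (fst ti) (snd ti)) <= 2 * C / 2 ^ k * exp (mu * Rabs (fst ti))).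
  { intros [t i]; simpl. destruct (Compare_dec.lt_dec i n) as [Hi|Hi]; [|exists 0; lia].
    destruct (geometric_limit (fun k => picard k x t i) (C * exp (mu * Rabs t))) as [l Hl].
    - intros k. replace (C * exp (mu * Rabs t) / 2 ^ k) with (C / 2 ^ k * exp (mu * Rabs t))
        by (unfold Rdiv; ring). apply Hstep; auto.
    - exists l; intros _ k. eapply Rle_trans; [apply Hl|]. right; unfold Rdiv; ring. }
  apply choice in Hlim. destruct Hlim as [Y0 HY0].
  set (Y := fun t i => Y0 (t, i)).
  assert (HY : forall i t k, (i < n)%nat ->
            Rabs (Y t i - picard k x t i) <= 2 * C / 2 ^ k * exp (mu * Rabs t))
    by (intros i t k Hi; apply (HY0 (t, i) Hi k)).
  assert (Hsmall : forall A e, 0 <= A -> 0 < e -> exists k, A / 2 ^ k < e).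
  { intros A e HA He. destruct (pow_lt_1_zero (/ 2)) with (y := e / (A + 1)) as [K HK].
    - rewrite Rabs_pos_eq; lra.
    - apply Rdiv_lt_0_compat; lra.
    - exists K. specialize (HK K (le_n K)). rewrite Rabs_pos_eq, pow_inv in HK
        by (apply pow_le; lra).
      apply (Rmult_lt_compat_r (A + 1)) in HK; [|lra].
      replace (e / (A + 1) * (A + 1)) with e in HK by (field; lra).
      assert (0 < / 2 ^ K) by (apply Rinv_0_lt_compat, pow_lt; lra).
      unfold Rdiv. lra. }
  assert (HYc : forall i t, (i < n)%nat -> continuous (fun s => Y s i) t).
  { intros i t Hi. apply filterlim_locally; intros eps.
    destruct (Hsmall (2 * C * exp (mu * (Rabs t + 1))) (eps / 3)) as [k Hk].
    - pose proof (exp_pos (mu * (Rabs t + 1))). nra.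
    - pose proof (cond_pos eps); lra.
    - assert (Hcl : forall s, Rabs (s - t) < 1 -> Rabs (Y s i - picard k x s i) < eps / 3).
      { intros s Hs. eapply Rle_lt_trans; [apply HY; auto|]. eapply Rle_lt_trans; [|apply Hk].
        replace (2 * C * exp (mu * (Rabs t + 1)) / 2 ^ k) with
          (2 * C / 2 ^ k * exp (mu * (Rabs t + 1))) by (unfold Rdiv; ring).
        apply Rmult_le_compat_l.
        - apply Rdiv_le_0_compat; [lra|apply pow_lt; lra].
        - apply exp_le. apply Rmult_le_compat_l; [lra|].
          replace s with (t + (s - t)) by ring.
          eapply Rle_trans; [apply Rabs_triang|]. lra. }
      pose proof (picard_continuous k x i t) as Hp.
      assert (He3 : 0 < eps / 3) by (pose proof (cond_pos eps); lra).
      apply filterlim_locally with (eps := mkposreal _ He3) in Hp.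
      assert (H1 : locally t (fun s => Rabs (s - t) < 1))
        by (exists (mkposreal 1 Rlt_0_1); intros y Hy; exact Hy).
      generalize (filter_and _ _ Hp H1). apply filter_imp; intros s [Hs Hs1].
      change (Rabs (picard k x s i - picard k x t i) < eps / 3) in Hs.
      change (Rabs (Y s i - Y t i) < eps).
      pose proof (Hcl s Hs1) as A1.
      pose proof (Hcl t) as A2. rewrite Rminus_diag, Rabs_R0 in A2. specialize (A2 Rlt_0_1).
      apply Rabs_lt_between in Hs. apply Rabs_lt_between in A1. apply Rabs_lt_between in A2.
      apply Rabs_lt_between. lra. }
  assert (HvY : forall i t, continuous (fun s => v i (Y s)) t).
  { intros i t. apply (continuous_of_dist n) with lam; auto. }
  assert (Heq : forall i t, (i < n)%nat -> Y t i = x i + RInt (fun s => v i (Y s)) 0 t).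
  { intros i t Hi. apply Rminus_diag_uniq. apply cond_eq. intros e He.
    rewrite Rminus_0_r.
    set (A := 2 * C * exp (mu * Rabs t) + (lam * (INR n * (2 * C))) / mu * exp (mu * Rabs t)).
    assert (HA : 0 <= A).
    { unfold A. pose proof (exp_pos (mu * Rabs t)). pose proof (pos_INR n).
      assert (0 <= lam * (INR n * (2 * C)) / mu).
      { apply Rdiv_le_0_compat; auto. apply Rmult_le_pos; auto. nra. }
      nra. }
    destruct (Hsmall A e HA He) as [k Hk].
    eapply Rle_lt_trans; [|apply Hk].
    pose proof (HY i t (S k) Hi) as A1. cbn [picard] in A1.
    assert (A2 : Rabs (RInt (fun s => v i (picard k x s)) 0 t - RInt (fun s => v i (Y s)) 0 t)
              <= (lam * (INR n * (2 * C / 2 ^ k))) / mu * exp (mu * Rabs t)).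
    { rewrite <- (RInt_minus (V := R_CompleteNormedModule)).
      2,3: apply (ex_RInt_continuous (V := R_CompleteNormedModule)); intros;
           (apply v_picard_continuous || apply HvY).
      apply RInt_exp_bound; auto.
      - intros s; apply (continuous_minus (V := R_NormedModule));
          [apply v_picard_continuous|apply HvY].
      - intros s. eapply Rle_trans; [apply Hv|].
        rewrite Rmult_assoc. apply Rmult_le_compat_l; auto.
        rewrite Rmult_assoc. apply dist_le. intros j Hj. rewrite Rabs_minus_sym. apply HY; auto. }
    replace (Y t i - (x i + RInt (fun s => v i (Y s)) 0 t)) with
      ((Y t i - (x i + RInt (fun s => v i (picard k x s)) 0 t)) +
       (RInt (fun s => v i (picard k x s)) 0 t - RInt (fun s => v i (Y s)) 0 t)) by ring.
    eapply Rle_trans; [apply Rabs_triang|].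
    unfold A. assert (H2 : 0 < / 2 ^ k) by (apply Rinv_0_lt_compat, pow_lt; lra).
    assert (H3 : 2 * C / 2 ^ S k <= 2 * C / 2 ^ k).
    { simpl. rewrite (Rmult_comm 2 (2 ^ k)). unfold Rdiv. rewrite Rinv_mult.
      pose proof (Rmult_le_pos C (/ 2 ^ k) HC (Rlt_le _ _ H2)). nra. }
    pose proof (exp_pos (mu * Rabs t)) as H4.
    apply Rle_trans with (2 * C / 2 ^ k * exp (mu * Rabs t) +
        lam * (INR n * (2 * C / 2 ^ k)) / mu * exp (mu * Rabs t)).
    - apply Rplus_le_compat; [|apply A2]. eapply Rle_trans; [apply A1|].
      apply Rmult_le_compat_r; lra.
    - right. unfold Rdiv. ring. }
  (* The limit is controlled only for coordinates below [n]. Freezing the others at [x i] gives the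
     initial condition for every index, and the field does not see them. *)
  exists (fun t i => if Compare_dec.lt_dec i n then Y t i else x i). split.
  - intros i. destruct (Compare_dec.lt_dec i n) as [Hi|Hi]; auto.
    rewrite Heq, primitive_at_origin by auto. ring.
  - intros i t Hi. destruct (Compare_dec.lt_dec i n) as [_|]; [|lia].
    apply (is_derive_ext (fun t => x i + RInt (fun s => v i (Y s)) 0 t)).
    { intros s; symmetry; apply Heq; auto. }
    replace (v i (fun i => if Compare_dec.lt_dec i n then Y t i else x i)) with (0 + v i (Y t)).
    + apply (is_derive_plus (K := R_AbsRing) (V := R_NormedModule)).
      * apply (is_derive_const (K := R_AbsRing) (V := R_NormedModule)).
      * apply is_derive_primitive; auto.
    + rewrite Rplus_0_l. apply Rminus_diag_uniq.
      assert (H := Hv i (Y t) (fun i => if Compare_dec.lt_dec i n then Y t i else x i)).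
      unfold dist in H. rewrite rsum_zero, Rmult_0_r in H.
      * pose proof (Rabs_pos (v i (Y t) - v i (fun i => if Compare_dec.lt_dec i n then Y t i else x i))).
        destruct (Req_dec (v i (Y t) - v i (fun i => if Compare_dec.lt_dec i n then Y t i else x i)) 0); auto.
        apply Rabs_no_R0 in H1. lra.
      * intros j Hj. destruct (Compare_dec.lt_dec j n); [|lia]. rewrite Rminus_diag; apply Rabs_R0.
Qed.

(** Gronwall is applied to the sum of squares, since the l1 distance is not differentiable;
    returning to [dist] costs the factor [n]. *)
Lemma trajectory_dist X Y T :
  0 <= T ->
  (forall i t, (i < n)%nat -> 0 <= t <= T -> is_derive (fun s => X s i) t (v i (X t))) ->
  (forall i t, (i < n)%nat -> 0 <= t <= T -> is_derive (fun s => Y s i) t (v i (Y t))) ->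
  forall t, 0 <= t <= T ->
  dist n (X t) (Y t) <= INR n * exp (lam * INR n * T) * dist n (X 0) (Y 0).
Proof.
  intros HT HX HY t Ht.
  set (E := fun t => rsum n (fun i => (X t i - Y t i) ^ 2)).
  assert (HE : forall t, 0 <= t <= T -> is_derive E t
            (rsum n (fun i => 2 * (X t i - Y t i) * (v i (X t) - v i (Y t))))).
  { intros s Hs. apply (is_derive_rsum n (fun i s => (X s i - Y s i) ^ 2)). intros i Hi.
    specialize (HX i s Hi Hs). specialize (HY i s Hi Hs).
    apply (is_derive_sq_diff (fun s => X s i) (fun s => Y s i)); auto. }
  assert (HdE : forall t, 0 <= t <= T ->
    rsum n (fun i => 2 * (X t i - Y t i) * (v i (X t) - v i (Y t))) <= 2 * lam * INR n * E t).
  { intros s _. set (D := dist n (X s) (Y s)).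
    apply Rle_trans with (rsum n (fun i => (2 * lam * D) * Rabs (X s i - Y s i))).
    - apply rsum_le; intros i Hi.
      eapply Rle_trans; [apply Rle_abs|]. rewrite !Rabs_mult, (Rabs_pos_eq 2) by lra.
      specialize (Hv i (X s) (Y s)). fold D in Hv.
      pose proof (Rabs_pos (X s i - Y s i)). nra.
    - rewrite rsum_scal. fold (dist n (X s) (Y s)). fold D.
      assert (HD : D * D <= INR n * E s); [|nra].
      unfold D, dist, E.
      rewrite (rsum_ext n (fun i => (X s i - Y s i) ^ 2)
                 (fun i => (Rabs (X s i - Y s i)) ^ 2)) by (intros; rewrite pow2_abs; auto).
      apply (rsum_Cauchy_Schwarz n (fun i => Rabs (X s i - Y s i))). }
  assert (HG := Gronwall_square E _ (2 * lam * INR n) T HE HdE t Ht).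
  assert (H0 : E 0 <= (dist n (X 0) (Y 0)) ^ 2).
  { unfold E, dist. apply (rsum_sq_le n (fun i => X 0 i - Y 0 i)). }
  set (D0 := dist n (X 0) (Y 0)) in *.
  assert (HD0 : 0 <= D0) by apply dist_pos.
  assert (Ht1 : E t <= (D0 * exp (lam * INR n * T)) ^ 2).
  { eapply Rle_trans; [apply HG|].
    replace ((D0 * exp (lam * INR n * T)) ^ 2) with
      (D0 ^ 2 * (exp (lam * INR n * T) * exp (lam * INR n * T))) by ring.
    rewrite <- exp_plus.
    assert (0 <= E 0) by (apply rsum_pos; intros; apply pow2_ge_0).
    apply Rmult_le_compat; auto; [left; apply exp_pos|].
    apply exp_le. pose proof (pos_INR n). assert (0 <= lam * INR n) by nra. nra. }
  replace (INR n * exp (lam * INR n * T) * D0) with (INR n * (D0 * exp (lam * INR n * T))) by ring.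
  apply dist_le. intros i Hi.
  assert (Hi2 : (X t i - Y t i) ^ 2 <= E t).
  { apply (rsum_term_le n (fun i => (X t i - Y t i) ^ 2)); auto. intros; apply pow2_ge_0. }
  apply Rsqr_incr_0_var.
  - rewrite <- Rsqr_abs. unfold Rsqr. lra.
  - apply Rmult_le_pos; auto. left; apply exp_pos.
Qed.

Lemma trajectory_unique X Y T :
  0 <= T ->
  (forall i t, (i < n)%nat -> 0 <= t <= T -> is_derive (fun s => X s i) t (v i (X t))) ->
  (forall i t, (i < n)%nat -> 0 <= t <= T -> is_derive (fun s => Y s i) t (v i (Y t))) ->
  (forall i, (i < n)%nat -> X 0 i = Y 0 i) ->
  forall t i, 0 <= t <= T -> (i < n)%nat -> X t i = Y t i.
Proof.
  intros HT HX HY H0 t i Ht Hi.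
  assert (H := trajectory_dist X Y T HT HX HY t Ht).
  unfold dist at 2 in H. rewrite rsum_zero, Rmult_0_r in H.
  - assert (H1 := dist_coord n (X t) (Y t) i Hi).
    apply Rminus_diag_uniq. destruct (Req_dec (X t i - Y t i) 0); auto.
    apply Rabs_pos_lt in H2. lra.
  - intros j Hj. rewrite H0, Rminus_diag by auto. apply Rabs_R0.
Qed.

Lemma flow_exists :
  exists phi : R -> (nat -> R) -> nat -> R,
    (forall x i, phi 0 x i = x i) /\ (forall x, trajectory (fun t => phi t x)).
Proof.
  destruct (choice _ trajectory_exists) as [Phi HPhi].
  exists (fun t x => Phi x t). split; intros x; apply HPhi.
Qed.

Lemma flow_add phi :
  (forall x i, phi 0 x i = x i) -> (forall x, trajectory (fun t => phi t x)) ->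
  forall s t x i, 0 <= s -> (i < n)%nat -> phi (t + s) x i = phi s (phi t x) i.
Proof.
  intros H0 Hphi s t x i Hs Hi.
  apply (trajectory_unique (fun s => phi (t + s) x) (fun s => phi s (phi t x)) s); auto; [| | |lra].
  - intros j r Hj _. specialize (Hphi x j (t + r) Hj).
    assert (Hc : is_derive (fun s => t + s) r 1) by (auto_derive; auto; ring).
    assert (H := is_derive_comp (fun s => phi s x j) (fun s => t + s) r _ _ Hphi Hc).
    unfold scal in H; simpl in H; unfold mult in H; simpl in H. rewrite Rmult_1_l in H. exact H.
  - intros j r Hj _. apply Hphi; auto.
  - intros j Hj. rewrite H0, Rplus_0_r; auto.
Qed.

End Flow.

(** * Volume preservation *)

Lemma continuous_of_lip (f : R -> R) (l : R) :
  (forall s t, Rabs (f s - f t) <= l * Rabs (s - t)) -> forall t, continuous f t.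
Proof.
  intros H t.
  assert (Hl : 0 <= l).
  { specialize (H 1 0). rewrite Rminus_0_r, Rabs_R1 in H. pose proof (Rabs_pos (f 1 - f 0)). lra. }
  apply (continuous_of_dist 1 (fun s _ => s) (fun x => f (x 0%nat)) l); auto.
  - intros x y. unfold dist; simpl. rewrite Rplus_0_l. apply H.
  - intros; apply continuous_id.
Qed.

(* Riemann sums of [f (u s) * u' s] telescope along a primitive of [f]. *)
Lemma lsum_substitution (L : R) (M : nat) (f u du : R -> R) (B l c2 lu : R) :
  0 < L -> (0 < M)%nat ->
  (forall s, Rabs (f s) <= B) ->
  (forall s t, Rabs (f s - f t) <= l * Rabs (s - t)) ->
  (forall s, L - 1 <= Rabs s -> f s = 0) ->
  (forall a b, Rabs (u b - u a - du a * (b - a)) <= c2 * (b - a) ^ 2) ->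
  (forall a b, Rabs (u b - u a) <= lu * Rabs (b - a)) ->
  (forall s, Rabs (u s - s) <= 1) ->
  Rabs (lsum L M (fun s => f (u s) * du s) - RInt f (- L) L)
    <= 2 * L * ((l * lu ^ 2 + B * c2) * (2 * L / INR M)).
Proof.
  intros HL HM HB Hl Hs Hu Hlu Hid.
  pose proof (mesh_pos L M HL HM) as Hdelta. set (delta := 2 * L / INR M) in *.
  set (P := fun x => RInt f (- L) x).
  assert (HP : forall x, is_derive P x (f x)).
  { intros x; apply is_derive_primitive. apply continuous_of_lip with l; auto. }
  assert (HT := fun a b => taylor_of_lip_derive P f l a b HP Hl).
  assert (Hflat : forall a b, (forall t, Rmin a b <= t <= Rmax a b -> L - 1 <= Rabs t) ->
             P b = P a).
  { intros a b Hab. apply Rminus_diag_uniq.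
    assert (H : Rabs (P b - P a) <= 0 * Rabs (b - a)).
    { apply (lip_of_derive P f); auto. intros t Ht. rewrite Hs by auto. rewrite Rabs_R0; lra. }
    rewrite Rmult_0_l in H. destruct (Req_dec (P b - P a) 0) as [E|E]; auto.
    apply Rabs_pos_lt in E; lra. }
  (* [u] may move the endpoints, but by at most 1, and [P] is constant where [f] vanishes. *)
  assert (HPL : P (u L) = RInt f (- L) L).
  { apply (Hflat L (u L)). intros t Ht. specialize (Hid L). apply Rabs_le_between in Hid.
    eapply Rle_trans; [|apply Rle_abs].
    unfold Rmin, Rmax in Ht; destruct (Rle_dec L (u L)); lra. }
  assert (HP0 : P (u (- L)) = 0).
  { transitivity (P (- L)); [|apply primitive_at_origin].
    apply Hflat. intros t Ht. specialize (Hid (- L)). apply Rabs_le_between in Hid.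
    rewrite <- Rabs_Ropp. eapply Rle_trans; [|apply Rle_abs].
    unfold Rmin, Rmax in Ht; destruct (Rle_dec (- L) (u (- L))); lra. }

  assert (Htel : P L
     = rsum M (fun k => P (u (pt L M (S k))) - P (u (pt L M k)))).
  { rewrite (rsum_telescope M (fun k => P (u (pt L M k)))), pt_M, pt_0 by auto.
    transitivity (P (u L)); [symmetry; exact HPL|]. rewrite HP0. symmetry; apply Rminus_0_r. }
  rewrite Htel.
  unfold lsum. fold delta. rewrite <- rsum_scal, <- rsum_minus.
  eapply Rle_trans; [apply rsum_abs|].
  apply Rle_trans with (INR M * ((l * lu ^ 2 + B * c2) * delta ^ 2)).
  2:{ right. unfold delta. field. apply INR_M_neq0; auto. }
  apply rsum_bound. intros k Hk. rewrite pt_S. fold delta. set (s := pt L M k).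
  specialize (HT (u s) (u (s + delta))). specialize (Hu s (s + delta)).
  specialize (Hlu s (s + delta)).
  replace (s + delta - s) with delta in * by ring.
  rewrite (Rabs_pos_eq delta) in Hlu by lra.
  rewrite Rabs_minus_sym.
  replace (P (u (s + delta)) - P (u s) - delta * (f (u s) * du s)) with
    ((P (u (s + delta)) - P (u s) - f (u s) * (u (s + delta) - u s)) +
     f (u s) * (u (s + delta) - u s - du s * delta)) by ring.
  eapply Rle_trans; [apply Rabs_triang|].
  replace ((l * lu ^ 2 + B * c2) * delta ^ 2) with
    (l * (lu * delta) ^ 2 + B * (c2 * delta ^ 2)) by ring.
  apply Rplus_le_compat.
  - eapply Rle_trans; [apply HT|].
    assert (0 <= l). { specialize (Hl 1 0). rewrite Rminus_0_r, Rabs_R1 in Hl.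
      pose proof (Rabs_pos (f 1 - f 0)). lra. }
    apply Rmult_le_compat_l; auto. rewrite <- pow2_abs.
    apply pow_incr. split; [apply Rabs_pos|auto].
  - rewrite Rabs_mult. apply Rmult_le_compat; auto; apply Rabs_pos.
Qed.

(** The class of test functions transported by the flow: over a time [T] the support radius [r]
    grows by the speed times [T] and [l] by a Gronwall factor, while [B] is kept. *)
Definition admissible (n : nat) (F : (nat -> R) -> R) (B l r : R) : Prop :=
  (forall x, Rabs (F x) <= B) /\
  (forall x y, Rabs (F x - F y) <= l * dist n x y) /\
  (forall x i, (i < n)%nat -> r <= Rabs (x i) -> F x = 0).

Lemma lip_eq n (F : (nat -> R) -> R) l x y :
  (forall x y, Rabs (F x - F y) <= l * dist n x y) ->
  (forall i, (i < n)%nat -> x i = y i) -> F x = F y.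
Proof.
  intros H E. specialize (H x y). unfold dist in H. rewrite rsum_zero, Rmult_0_r in H.
  - apply Rminus_diag_uniq. destruct (Req_dec (F x - F y) 0) as [e|e]; auto.
    apply Rabs_pos_lt in e; lra.
  - intros i Hi. rewrite E, Rminus_diag by auto. apply Rabs_R0.
Qed.

Section Liouville.
Variables (n : nat) (v d : nat -> (nat -> R) -> R) (lam V D C2 : R).
Hypotheses (Hlam : 0 <= lam) (HC2 : 0 <= C2).
Hypothesis (Hv : forall i x y, Rabs (v i x - v i y) <= lam * dist n x y).
Hypothesis (HV : forall i x, Rabs (v i x) <= V).
Hypothesis (HD : forall i x, Rabs (d i x) <= D).
(** [d i] acts as the partial derivative of [v i] in its own variable. Only this diagonal of the
    Jacobian matrix enters, because each substitution moves a single coordinate. *)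
Hypothesis (Hd : forall i y a b, (i < n)%nat ->
  Rabs (v i (upd y i b) - v i (upd y i a) - d i (upd y i a) * (b - a)) <= C2 * (b - a) ^ 2).
Hypothesis (Hdiv : forall x, rsum n (fun i => d i x) = 0).

Lemma V_nonneg : 0 <= V.
Proof. specialize (HV 0 (fun _ => 0)). pose proof (Rabs_pos (v 0 (fun _ => 0))). lra. Qed.

Lemma D_nonneg : 0 <= D.
Proof. specialize (HD 0 (fun _ => 0)). pose proof (Rabs_pos (d 0 (fun _ => 0))). lra. Qed.

Definition tau (h : R) (i : nat) (x : nat -> R) : nat -> R := upd x i (x i + h * v i x).

(** At [i = n] this is an Euler step. All velocities are taken at the starting point, whereas
    composing the maps [tau] would use updated ones; the difference is of order [h ^ 2], see
    [partial_euler_S]. *)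
Definition partial_euler (h : R) (i : nat) (x : nat -> R) : nat -> R :=
  fun j => if Compare_dec.lt_dec j i then x j + h * v j x else x j.

Section Step.
Variables (L : R) (M : nat) (h : R).
Hypotheses (HL : 0 < L) (HM : (0 < M)%nat).
Hypotheses (Hh0 : 0 <= h) (Hh1 : h <= 1) (HhV : h * V <= 1) (Hhl : h * (INR n * lam) <= 1).

Let delta := 2 * L / INR M.

Lemma delta_pos : 0 < delta.
Proof. apply mesh_pos; auto. Qed.

Lemma hlam_le i : (i < n)%nat -> h * lam <= 1.
Proof.
  intros Hi. eapply Rle_trans; [|apply Hhl]. apply Rmult_le_compat_l; auto.
  rewrite <- (Rmult_1_l lam) at 1. apply Rmult_le_compat_r; auto.
  apply (le_INR 1). lia.
Qed.

Lemma admissible_nonneg G B l r : (0 < n)%nat -> admissible n G B l r -> 0 <= B /\ 0 <= l.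
Proof.
  intros Hn [H1 [H2 _]]. split.
  - specialize (H1 (fun _ => 0)). pose proof (Rabs_pos (G (fun _ => 0))). lra.
  - specialize (H2 (upd (fun _ => 0) 0 1) (fun _ => 0)).
    assert (Hle : dist n (upd (fun _ => 0) 0 1) (fun _ => 0) <= 1).
    { apply dist_upd with 0%nat; [lra| |].
      - intros j Hj; apply upd_neq; auto.
      - rewrite upd_eq, Rminus_0_r, Rabs_R1; lra. }
    assert (Hge := dist_coord n (upd (fun _ => 0) 0 1) (fun _ => 0) 0 Hn).
    rewrite upd_eq, Rminus_0_r, Rabs_R1 in Hge.
    pose proof (Rabs_pos (G (upd (fun _ => 0) 0 1) - G (fun _ => 0))). nra.
Qed.

(** Both lattice sums are compared with the same one-dimensional integral in the [i]-th variable: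
    along [u], of Lipschitz constant 2, and along the identity. The factor of [l] is
    [2 ^ 2 + 1 ^ 2 = 5]. *)
Lemma lint_tau_jacobian G B l i z :
  admissible n G B l (L - 1) -> (i < n)%nat ->
  Rabs (lint L M n (fun x => G (tau h i x) * (1 + h * d i x)) z - lint L M n G z)
    <= (2 * L) ^ n * ((B * C2 + 5 * l) * delta).
Proof.
  intros HG Hi. pose proof delta_pos as Hdelta.
  destruct (admissible_nonneg G B l (L - 1)) as [HB0 Hl0]; [lia|auto|].
  destruct HG as [HB [Hl Hs]]. pose proof (hlam_le i Hi) as Hhl1.
  assert (Hup : forall (F : (nat -> R) -> R) c, (forall x y, Rabs (F x - F y) <= c * dist n x y) ->
            0 <= c -> forall y a b, Rabs (F (upd y i a) - F (upd y i b)) <= c * Rabs (a - b)).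
  { intros F c HF Hc y a b. eapply Rle_trans; [apply HF|]. apply Rmult_le_compat_l; auto.
    apply dist_upd with i; [apply Rabs_pos| |].
    - intros j Hj; rewrite !upd_neq; auto.
    - rewrite !upd_eq; lra. }
  replace (lint L M n (fun x => G (tau h i x) * (1 + h * d i x)) z - lint L M n G z) with
    (lint L M n (fun x => G (tau h i x) * (1 + h * d i x) + -1 * G x) z)
    by (rewrite lint_plus, lint_scal; ring).
  apply (lint_coord_abs L M HL HM n _ z i _ Hi). intros y.
  rewrite lsum_plus, lsum_scal.
  set (f := fun s => G (upd y i s)).
  set (u := fun s => s + h * v i (upd y i s)).
  set (du := fun s => 1 + h * d i (upd y i s)).
  assert (Ebeta : lsum L M (fun s => G (tau h i (upd y i s)) * (1 + h * d i (upd y i s)))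
          = lsum L M (fun s => f (u s) * du s)).
  { apply lsum_ext; intros s. unfold f, u, du, tau. rewrite upd_upd, upd_eq. reflexivity. }
  rewrite Ebeta.
  assert (Hf : forall s t, Rabs (f s - f t) <= l * Rabs (s - t)) by (intros; apply Hup; auto).
  assert (Hfs : forall s, L - 1 <= Rabs s -> f s = 0).
  { intros s Hs'. apply (Hs _ i); auto. rewrite upd_eq; auto. }
  assert (A1 := lsum_substitution L M f u du B l C2 2 HL HM (fun s => HB _) Hf Hfs).
  assert (A2 := lsum_substitution L M f (fun s => s) (fun _ => 1) B l 0 1 HL HM (fun s => HB _) Hf Hfs).
  assert (E : lsum L M (fun s => f s * 1) = lsum L M f) by (apply lsum_ext; intros; ring).
  cbv beta in A2. rewrite E in A2. fold delta in A1, A2.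
  apply Rle_trans with (2 * L * ((l * 2 ^ 2 + B * C2) * delta) + 2 * L * ((l * 1 ^ 2 + B * 0) * delta)).
  2:{ right; ring. }
  change (lsum L M (fun s => G (upd y i s))) with (lsum L M f).
  replace (lsum L M (fun s => f (u s) * du s) + -1 * lsum L M f) with
    ((lsum L M (fun s => f (u s) * du s) - RInt f (- L) L) - (lsum L M f - RInt f (- L) L)) by ring.
  eapply Rle_trans; [apply Rabs_triang|]. rewrite Rabs_Ropp. apply Rplus_le_compat.
  - apply A1.
    + intros a b. unfold u, du.
      replace (b + h * v i (upd y i b) - (a + h * v i (upd y i a)) - (1 + h * d i (upd y i a)) * (b - a))
        with (h * (v i (upd y i b) - v i (upd y i a) - d i (upd y i a) * (b - a))) by ring.
      rewrite Rabs_mult, Rabs_pos_eq by auto.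
      specialize (Hd i y a b Hi).
      pose proof (Rabs_pos (v i (upd y i b) - v i (upd y i a) - d i (upd y i a) * (b - a))). nra.
    + intros a b. unfold u.
      replace (b + h * v i (upd y i b) - (a + h * v i (upd y i a))) with
        ((b - a) + h * (v i (upd y i b) - v i (upd y i a))) by ring.
      eapply Rle_trans; [apply Rabs_triang|]. rewrite Rabs_mult, (Rabs_pos_eq h) by auto.
      assert (H := Hup (v i) lam (Hv i) Hlam y b a). pose proof (Rabs_pos (b - a)).
      assert (h * Rabs (v i (upd y i b) - v i (upd y i a)) <= h * (lam * Rabs (b - a)))
        by (apply Rmult_le_compat_l; auto).
      nra.
    + intros s. unfold u. replace (s + h * v i (upd y i s) - s) with (h * v i (upd y i s)) by ring.
      rewrite Rabs_mult, Rabs_pos_eq by auto. specialize (HV i (upd y i s)). nra.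
  - apply A2.
    + intros a b. replace (b - a - 1 * (b - a)) with 0 by ring. rewrite Rabs_R0. lra.
    + intros; lra.
    + intros s. rewrite Rminus_diag, Rabs_R0. lra.
Qed.

Lemma lint_diff_abs F G c z :
  (forall x, Rabs (F x - G x) <= c) ->
  Rabs (lint L M n F z - lint L M n G z) <= (2 * L) ^ n * c.
Proof.
  intros H. replace (lint L M n F z - lint L M n G z) with (lint L M n (fun x => F x + -1 * G x) z)
    by (rewrite lint_plus, lint_scal; ring).
  apply lint_abs; auto. intros y. replace (F y + -1 * G y) with (F y - G y) by ring. auto.
Qed.

Lemma tau_dist i x : dist n (tau h i x) x <= h * V.
Proof.
  pose proof V_nonneg.
  apply dist_upd with i; [nra| |].
  - intros j Hj; apply upd_neq; auto.
  - unfold tau; rewrite upd_eq. replace (x i + h * v i x - x i) with (h * v i x) by ring.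
    rewrite Rabs_mult, Rabs_pos_eq by auto. apply Rmult_le_compat_l; auto.
Qed.

(** The Jacobian term is moved to the other side. Replacing [G (tau h i x) * d i x] by [G x * d i x]
    costs a displacement of [h * V], which the prefactor [h] turns into order [h ^ 2]. *)
Lemma lint_tau G B l i z :
  admissible n G B l (L - 1) -> (i < n)%nat ->
  Rabs (lint L M n (fun x => G (tau h i x)) z - lint L M n G z
        + h * lint L M n (fun x => G x * d i x) z)
    <= (2 * L) ^ n * ((B * C2 + 5 * l) * delta + l * V * D * h ^ 2).
Proof.
  intros HG Hi. pose proof V_nonneg. pose proof D_nonneg.
  destruct (admissible_nonneg G B l (L - 1)) as [HB0 Hl0]; [lia|auto|].
  assert (A1 := lint_tau_jacobian G B l i z HG Hi).
  assert (A2 : Rabs (lint L M n (fun x => G x * d i x) z - lint L M n (fun x => G (tau h i x) * d i x) z)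
            <= (2 * L) ^ n * (l * V * D * h)).
  { apply lint_diff_abs. intros x.
    replace (G x * d i x - G (tau h i x) * d i x) with (- ((G (tau h i x) - G x) * d i x)) by ring.
    rewrite Rabs_Ropp, Rabs_mult.
    replace (l * V * D * h) with ((l * (h * V)) * D) by ring.
    apply Rmult_le_compat; auto; try apply Rabs_pos.
    eapply Rle_trans; [apply HG|]. apply Rmult_le_compat_l; auto. apply tau_dist. }
  rewrite (lint_ext L M HL HM n (fun x => G (tau h i x) * (1 + h * d i x))
     (fun x => G (tau h i x) + h * (G (tau h i x) * d i x))) in A1 by (intros; ring).
  rewrite lint_plus, lint_scal in A1.
  set (I1 := lint L M n (fun x => G (tau h i x)) z) in *.
  set (I2 := lint L M n (fun x => G (tau h i x) * d i x) z) in *.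
  set (I3 := lint L M n (fun x => G x * d i x) z) in *.
  replace (I1 - lint L M n G z + h * I3) with
    ((I1 + h * I2 - lint L M n G z) + h * (I3 - I2)) by ring.
  eapply Rle_trans; [apply Rabs_triang|]. rewrite Rabs_mult, (Rabs_pos_eq h) by auto.
  replace ((2 * L) ^ n * ((B * C2 + 5 * l) * delta + l * V * D * h ^ 2)) with
    ((2 * L) ^ n * ((B * C2 + 5 * l) * delta) + h * ((2 * L) ^ n * (l * V * D * h))) by ring.
  apply Rplus_le_compat; auto. apply Rmult_le_compat_l; auto.
Qed.

Lemma partial_euler_lip i x y :
  dist n (partial_euler h i x) (partial_euler h i y) <= 2 * dist n x y.
Proof.
  apply Rle_trans with (rsum n (fun j => Rabs (x j - y j) + h * (lam * dist n x y))).
  - apply rsum_le; intros j Hj. unfold partial_euler.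
    pose proof (dist_pos n x y).
    destruct (Compare_dec.lt_dec j i).
    + replace (x j + h * v j x - (y j + h * v j y)) with ((x j - y j) + h * (v j x - v j y)) by ring.
      eapply Rle_trans; [apply Rabs_triang|]. rewrite Rabs_mult, (Rabs_pos_eq h) by auto.
      apply Rplus_le_compat_l, Rmult_le_compat_l; auto.
    + assert (0 <= h * (lam * dist n x y)) by (apply Rmult_le_pos; auto; apply Rmult_le_pos; auto).
      lra.
  - rewrite rsum_plus, rsum_const. fold (dist n x y). pose proof (dist_pos n x y). nra.
Qed.

Lemma partial_euler_dist i x : dist n (partial_euler h i x) x <= INR n * (h * V).
Proof.
  apply dist_le. intros j Hj. unfold partial_euler. pose proof V_nonneg.
  destruct (Compare_dec.lt_dec j i).
  - replace (x j + h * v j x - x j) with (h * v j x) by ring.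
    rewrite Rabs_mult, (Rabs_pos_eq h) by auto. apply Rmult_le_compat_l; auto.
  - rewrite Rminus_diag, Rabs_R0. nra.
Qed.

Lemma partial_euler_S i x :
  dist n (partial_euler h (S i) x) (partial_euler h i (tau h i x)) <= INR n * (lam * V * h ^ 2).
Proof.
  apply dist_le. intros j Hj. unfold partial_euler. pose proof V_nonneg.
  assert (0 <= lam * V * h ^ 2) by (apply Rmult_le_pos; [nra|apply pow2_ge_0]).
  destruct (Nat.eq_dec j i) as [->|Hne].
  - destruct (Compare_dec.lt_dec i (S i)), (Compare_dec.lt_dec i i); try lia.
    unfold tau; rewrite upd_eq, Rminus_diag, Rabs_R0; auto.
  - destruct (Compare_dec.lt_dec j (S i)), (Compare_dec.lt_dec j i); try lia;
      unfold tau at 1; rewrite upd_neq by auto.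
    + replace (x j + h * v j x - (x j + h * v j (tau h i x))) with
        (h * - (v j (tau h i x) - v j x)) by ring.
      rewrite Rabs_mult, Rabs_Ropp, (Rabs_pos_eq h) by auto.
      replace (lam * V * h ^ 2) with (h * (lam * (h * V))) by ring.
      apply Rmult_le_compat_l; auto. eapply Rle_trans; [apply Hv|].
      apply Rmult_le_compat_l; auto. apply tau_dist.
    + rewrite Rminus_diag, Rabs_R0; auto.
Qed.

Lemma partial_euler_admissible F B l i :
  0 <= l -> admissible n F B l (L - 2) ->
  admissible n (fun x => F (partial_euler h i x)) B (2 * l) (L - 1).
Proof.
  intros Hl0 [HB [Hl Hs]]. split; [|split]; auto.
  - intros x y. eapply Rle_trans; [apply Hl|]. rewrite (Rmult_comm 2), Rmult_assoc.
    apply Rmult_le_compat_l; auto. apply partial_euler_lip.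
  - intros x j Hj Hx. apply (Hs _ j); auto. unfold partial_euler.
    destruct (Compare_dec.lt_dec j i); [|lra].
    assert (Rabs (h * v j x) <= 1).
    { rewrite Rabs_mult, Rabs_pos_eq by auto. specialize (HV j x). nra. }
    pose proof (Rabs_triang_inv (x j) (- (h * v j x))) as Ht.
    rewrite Rabs_Ropp in Ht. unfold Rminus in Ht. rewrite Ropp_involutive in Ht. lra.
Qed.

(** The first-order terms are collected rather than estimated: each is of order [h], and only their
    total at [i = n], the divergence, vanishes. *)
Lemma lint_partial_euler F B l i z :
  admissible n F B l (L - 2) -> (i <= n)%nat ->
  Rabs (lint L M n (fun x => F (partial_euler h i x)) z - lint L M n F z
        + h * rsum i (fun j => lint L M n (fun x => F x * d j x) z))
  <= INR i * ((2 * L) ^ n * ((B * C2 + 10 * l) * delta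
       + (2 * l * V * D + l * INR n * (lam * V) + l * INR n * V * D) * h ^ 2)).
Proof.
  intros HF. pose proof V_nonneg. pose proof D_nonneg. induction i as [|i IH]; intros Hi.
  - simpl rsum. simpl INR. rewrite Rmult_0_l, Rmult_0_r, Rplus_0_r.
    rewrite (lint_ext L M HL HM n (fun x => F (partial_euler h 0 x)) F), Rminus_diag, Rabs_R0; [lra|].
    intros x. destruct HF as [_ [Hl _]]. apply (lip_eq n F l); auto.
  - destruct (admissible_nonneg F B l (L - 2)) as [HB0 Hl0]; [lia|auto|].
    assert (HE := partial_euler_admissible F B l i Hl0 HF).
    assert (A0 := IH ltac:(lia)).
    assert (A1 := lint_tau _ _ _ i z HE ltac:(lia)). cbv beta in A1.
    assert (A2 : Rabs (lint L M n (fun x => F (partial_euler h (S i) x)) z -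
                  lint L M n (fun x => F (partial_euler h i (tau h i x))) z)
                 <= (2 * L) ^ n * (l * (INR n * (lam * V * h ^ 2)))).
    { apply lint_diff_abs. intros x. destruct HF as [_ [Hl _]].
      eapply Rle_trans; [apply Hl|]. apply Rmult_le_compat_l; auto. apply partial_euler_S. }
    assert (A3 : Rabs (lint L M n (fun x => F x * d i x) z -
                       lint L M n (fun x => F (partial_euler h i x) * d i x) z)
                 <= (2 * L) ^ n * (l * (INR n * (h * V)) * D)).
    { apply lint_diff_abs. intros x. destruct HF as [_ [Hl _]].
      replace (F x * d i x - F (partial_euler h i x) * d i x) with
        (- ((F (partial_euler h i x) - F x) * d i x)) by ring.
      rewrite Rabs_Ropp, Rabs_mult.
      apply Rmult_le_compat; auto; try apply Rabs_pos.
      eapply Rle_trans; [apply Hl|]. apply Rmult_le_compat_l; auto. apply partial_euler_dist. }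
    cbn [rsum]. rewrite S_INR.
    set (I1 := lint L M n (fun x => F (partial_euler h (S i) x)) z) in *.
    set (I2 := lint L M n (fun x => F (partial_euler h i (tau h i x))) z) in *.
    set (I3 := lint L M n (fun x => F (partial_euler h i x)) z) in *.
    set (I4 := lint L M n (fun x => F (partial_euler h i x) * d i x) z) in *.
    set (I5 := lint L M n (fun x => F x * d i x) z) in *.
    set (S0 := rsum i (fun j => lint L M n (fun x => F x * d j x) z)) in *.
    set (I0 := lint L M n F z) in *.
    replace (I1 - I0 + h * (S0 + I5)) with
      ((I3 - I0 + h * S0) + ((I2 - I3 + h * I4) + (I1 - I2) + h * (I5 - I4))) by ring.
    rewrite Rmult_plus_distr_r, Rmult_1_l.
    eapply Rle_trans; [apply Rabs_triang|]. apply Rplus_le_compat; auto.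
    eapply Rle_trans; [apply Rabs_triang|].
    eapply Rle_trans; [apply Rplus_le_compat_r, Rabs_triang|].
    rewrite (Rabs_mult h), (Rabs_pos_eq h) by auto.
    apply (Rmult_le_compat_l h) in A3; auto.
    eapply Rle_trans; [apply Rplus_le_compat; [apply Rplus_le_compat|]; eassumption|].
    right; ring.
Qed.

(** The exact flow and the Euler step differ by order [h ^ 2]. Summed over about [T / h] steps, an
    error [h ^ 2 + delta] per step leaves order [h] plus a part that is made small by choosing
    [delta] after [h]. *)
Lemma lint_flow_step F B l z phi :
  (forall x i, phi 0 x i = x i) -> (forall x, trajectory n v (fun t => phi t x)) ->
  admissible n F B l (L - 2) -> (0 < n)%nat ->
  Rabs (lint L M n (fun x => F (phi h x)) z - lint L M n F z)
  <= (2 * L) ^ n * (INR n * (B * C2 + 10 * l + 2 * l * V * D + 2 * l * INR n * (lam * V)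
        + l * INR n * V * D)) * (h ^ 2 + delta).
Proof.
  intros H0 Hphi HF Hn. pose proof V_nonneg. pose proof D_nonneg. pose proof delta_pos.
  destruct (admissible_nonneg F B l (L - 2)) as [HB0 Hl0]; [lia|auto|].
  assert (A1 := lint_partial_euler F B l n z HF (le_n n)).
  rewrite <- (lint_rsum L M HM n n (fun j x => F x * d j x)) in A1.
  rewrite (lint_ext L M HL HM n (fun x => rsum n (fun j => F x * d j x)) (fun _ => 0)), lint_const in A1; auto.
  2:{ intros y. cbv beta. rewrite rsum_scal, Hdiv. ring. }
  rewrite !Rmult_0_r, Rplus_0_r in A1.
  assert (Hmove : forall x s i, 0 <= s -> (i < n)%nat -> Rabs (phi s x i - x i) <= V * s).
  { intros x s i Hs Hi. rewrite <- (H0 x i) at 1.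
    replace (V * s) with (V * Rabs (s - 0)) by (rewrite Rminus_0_r, Rabs_pos_eq; auto).
    apply (lip_of_derive (fun s => phi s x i) (fun s => v i (phi s x))); auto.
    intros t _. apply Hphi; auto. }
  assert (A2 : Rabs (lint L M n (fun x => F (phi h x)) z -
                     lint L M n (fun x => F (partial_euler h n x)) z)
          <= (2 * L) ^ n * (l * (INR n * (INR n * (lam * V) * h ^ 2)))).
  { apply lint_diff_abs. intros x. destruct HF as [_ [Hl _]].
    eapply Rle_trans; [apply Hl|]. apply Rmult_le_compat_l; auto.
    apply dist_le. intros j Hj. unfold partial_euler. destruct (Compare_dec.lt_dec j n); [|lia].
    set (g := fun s => phi s x j - s * v j x).
    replace (phi h x j - (x j + h * v j x)) with (g h - g 0) by (unfold g; rewrite H0; ring).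
    replace (INR n * (lam * V) * h ^ 2) with ((INR n * (lam * V) * h) * Rabs (h - 0))
      by (rewrite Rminus_0_r, Rabs_pos_eq by auto; ring).
    apply (lip_of_derive g (fun s => v j (phi s x) - v j x)).
    - intros t Ht. apply (is_derive_minus (K := R_AbsRing) (V := R_NormedModule)); [apply Hphi; auto|].
      auto_derive; [trivial|ring].
    - intros t Ht. rewrite Rmin_left, Rmax_right in Ht by auto.
      eapply Rle_trans; [apply Hv|].
      replace (INR n * (lam * V) * h) with (lam * (INR n * (V * h))) by ring.
      apply Rmult_le_compat_l; auto. apply dist_le. intros k Hk.
      eapply Rle_trans; [apply Hmove; [lra|auto]|]. apply Rmult_le_compat_l; lra. }
  set (I1 := lint L M n (fun x => F (phi h x)) z) in *.
  set (I2 := lint L M n (fun x => F (partial_euler h n x)) z) in *.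
  set (I0 := lint L M n F z) in *.
  replace (I1 - I0) with ((I1 - I2) + (I2 - I0)) by ring.
  eapply Rle_trans; [apply Rabs_triang|].
  eapply Rle_trans; [apply Rplus_le_compat; eassumption|].
  assert (H2L : 0 <= (2 * L) ^ n) by (apply pow_le; lra).
  pose proof (pos_INR n) as HN. pose proof (pow2_ge_0 h) as Hh2.
  match goal with |- ?a <= ?b => assert (E : b - a = (2 * L) ^ n * INR n *
    ((2 * l * V * D + 2 * l * INR n * (lam * V) + l * INR n * V * D) * delta
      + (B * C2 + 10 * l) * h ^ 2)) by ring end.
  assert (0 <= l * INR n * (lam * V)) by (repeat apply Rmult_le_pos; auto).
  assert (0 <= l * INR n * V * D) by (repeat apply Rmult_le_pos; auto).
  assert (0 <= l * V * D) by (repeat apply Rmult_le_pos; auto).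
  assert (0 <= B * C2) by (apply Rmult_le_pos; auto).
  assert (0 <= (2 * L) ^ n * INR n *
    ((2 * l * V * D + 2 * l * INR n * (lam * V) + l * INR n * V * D) * delta
      + (B * C2 + 10 * l) * h ^ 2)); [|lra].
  repeat apply Rmult_le_pos; auto.
  apply Rplus_le_le_0_compat; apply Rmult_le_pos; lra.
Qed.

End Step.

Lemma flow_speed phi x t i :
  (forall x i, phi 0 x i = x i) -> (forall x, trajectory n v (fun t => phi t x)) ->
  0 <= t -> (i < n)%nat -> Rabs (phi t x i - x i) <= V * t.
Proof.
  intros H0 Hphi Ht Hi. rewrite <- (H0 x i) at 1.
  replace (V * t) with (V * Rabs (t - 0)) by (rewrite Rminus_0_r, Rabs_pos_eq; auto).
  apply (lip_of_derive (fun s => phi s x i) (fun s => v i (phi s x))); auto.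
  intros s _. apply Hphi; auto.
Qed.

Lemma admissible_flow F B l r T phi t :
  (forall x i, phi 0 x i = x i) -> (forall x, trajectory n v (fun t => phi t x)) ->
  0 <= l -> admissible n F B l r -> 0 <= t <= T ->
  admissible n (fun x => F (phi t x)) B (l * (INR n * exp (lam * INR n * T))) (r + V * T).
Proof.
  intros H0 Hphi Hl0 [HB [Hl Hs]] Ht. split; [|split]; auto.
  - intros x y. eapply Rle_trans; [apply Hl|]. rewrite Rmult_assoc.
    apply Rmult_le_compat_l; auto.
    eapply Rle_trans; [apply (trajectory_dist n v lam Hlam Hv (fun t => phi t x) (fun t => phi t y) T);
      auto; try lra; intros; apply Hphi; auto|].
    right. f_equal. apply rsum_ext. intros; rewrite !H0; auto.
  - intros x i Hi Hx. apply (Hs _ i); auto.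
    assert (H := flow_speed phi x t i H0 Hphi ltac:(lra) Hi).
    pose proof (Rabs_triang_inv (x i) (x i - phi t x i)) as H1.
    replace (x i - (x i - phi t x i)) with (phi t x i) in H1 by ring.
    rewrite (Rabs_minus_sym (x i)) in H1. pose proof V_nonneg. nra.
Qed.

(** Step [k + 1] applies the one-step estimate to [F] composed with the flow at time [k * h], whose
    Lipschitz constant is at most the same [l'] for all times up to [T]. Of the margin 2 in
    [r + V * T + 2 <= L], one unit absorbs the partial Euler step and one the substitution. *)
Theorem lint_flow F B l r T L z phi :
  (forall x i, phi 0 x i = x i) -> (forall x, trajectory n v (fun t => phi t x)) ->
  (0 < n)%nat -> 0 <= T -> admissible n F B l r -> 0 < L -> r + V * T + 2 <= L ->
  exists C, 0 <= C /\ forall h M k,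
    0 <= h -> h <= 1 -> h * V <= 1 -> h * (INR n * lam) <= 1 -> (0 < M)%nat -> INR k * h <= T ->
    Rabs (lint L M n (fun x => F (phi (INR k * h) x)) z - lint L M n F z)
      <= C * INR k * (h ^ 2 + 2 * L / INR M).
Proof.
  intros H0 Hphi Hn HT HF HL HrL. pose proof V_nonneg. pose proof D_nonneg.
  destruct (admissible_nonneg F B l r Hn HF) as [HB0 Hl0].
  set (l' := l * (INR n * exp (lam * INR n * T))).
  assert (Hl' : 0 <= l').
  { apply Rmult_le_pos; auto. apply Rmult_le_pos; [apply pos_INR|left; apply exp_pos]. }
  set (C := (2 * L) ^ n * (INR n * (B * C2 + 10 * l' + 2 * l' * V * D + 2 * l' * INR n * (lam * V)
        + l' * INR n * V * D))).
  exists C. split.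
  { unfold C. pose proof (pos_INR n). apply Rmult_le_pos; [apply pow_le; lra|].
    apply Rmult_le_pos; auto.
    assert (0 <= l' * INR n * (lam * V)) by (repeat first [assumption | apply Rmult_le_pos]).
    assert (0 <= l' * INR n * V * D) by (repeat first [assumption | apply Rmult_le_pos]).
    assert (0 <= l' * V * D) by (repeat first [assumption | apply Rmult_le_pos]).
    assert (0 <= B * C2) by (apply Rmult_le_pos; auto). lra. }
  intros h M k Hh0 Hh1 HhV Hhl HM. induction k as [|k IH]; intros Hk.
  - simpl INR. rewrite Rmult_0_l, Rmult_0_r, Rmult_0_l.
    rewrite (lint_ext L M HL HM n (fun x => F (phi 0 x)) F), Rminus_diag, Rabs_R0; [lra|].
    intros x. apply (lip_eq n F l); [apply HF|auto].
  - rewrite S_INR in *. assert (Hk' : 0 <= INR k * h <= T).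
    { pose proof (pos_INR k). split; [nra|nra]. }
    specialize (IH (proj2 Hk')).
    assert (HFk := admissible_flow F B l r T phi (INR k * h) H0 Hphi Hl0 HF Hk').
    fold l' in HFk.
    assert (HFk' : admissible n (fun x => F (phi (INR k * h) x)) B l' (L - 2)).
    { destruct HFk as [P1 [P2 P3]]. split; [|split]; auto.
      intros x i Hi Hx. apply (P3 x i); auto. lra. }
    assert (A := lint_flow_step L M h HL HM Hh0 Hh1 HhV Hhl _ B l' z phi H0 Hphi HFk' Hn).
    cbv beta in A. fold C in A.
    rewrite (lint_ext L M HL HM n (fun x => F (phi ((INR k + 1) * h) x))
              (fun x => F (phi (INR k * h) (phi h x)))).
    2:{ intros x. apply (lip_eq n F l); [apply HF|]. intros i Hi.
        replace ((INR k + 1) * h) with (h + INR k * h) by ring.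
        apply (flow_add n v lam Hlam Hv); auto. lra. }
    set (I1 := lint L M n (fun x => F (phi (INR k * h) (phi h x))) z) in *.
    set (I2 := lint L M n (fun x => F (phi (INR k * h) x)) z) in *.
    replace (I1 - lint L M n F z) with ((I1 - I2) + (I2 - lint L M n F z)) by ring.
    eapply Rle_trans; [apply Rabs_triang|]. lra.
Qed.

End Liouville.

(** * Confinement *)

Fixpoint cnt (N : nat) (J : nat -> bool) : nat :=
  match N with O => 0%nat | S k => (cnt k J + if J k then 1 else 0)%nat end.

Lemma cnt_le_N N J : (cnt N J <= N)%nat.
Proof. induction N; simpl; [lia|]. destruct (J N); lia. Qed.

Lemma cnt_pos N J i : (i < N)%nat -> J i = true -> (1 <= cnt N J)%nat.
Proof.
  intros Hi Ji. induction N as [|N IH]; [lia|]. simpl.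
  destruct (Nat.eq_dec i N) as [->|Hne]; [rewrite Ji; lia|].
  specialize (IH ltac:(lia)). lia.
Qed.

Lemma cnt_incl N J J' :
  (forall k, (k < N)%nat -> J k = true -> J' k = true) -> (cnt N J <= cnt N J')%nat.
Proof.
  induction N as [|N IH]; intros H; simpl; [lia|].
  assert (cnt N J <= cnt N J')%nat by (apply IH; auto).
  destruct (J N) eqn:E; [|lia]. rewrite (H N) by auto. lia.
Qed.

Lemma cnt_incl_eq N J J' :
  (forall k, (k < N)%nat -> J k = true -> J' k = true) -> (cnt N J' <= cnt N J)%nat ->
  forall k, (k < N)%nat -> J' k = true -> J k = true.
Proof.
  induction N as [|N IH]; intros H Hc k Hk Jk; [lia|]. simpl in Hc.
  assert (Hi : (cnt N J <= cnt N J')%nat) by (apply cnt_incl; auto).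
  destruct (J N) eqn:E; destruct (J' N) eqn:E'; try lia.
  - destruct (Nat.eq_dec k N) as [->|Hne]; auto. apply IH; auto; lia.
  - rewrite (H N (Nat.lt_succ_diag_r N) E) in E'. discriminate.
  - destruct (Nat.eq_dec k N) as [->|Hne]; [congruence|]. apply IH; auto; lia.
Qed.

Definition leb_R (a b : R) : bool := if Rle_dec a b then true else false.

Lemma leb_R_true a b : leb_R a b = true <-> a <= b.
Proof. unfold leb_R; destruct (Rle_dec a b); split; intros; auto; congruence. Qed.

Lemma leb_R_false a b : leb_R a b = false <-> b < a.
Proof. unfold leb_R; destruct (Rle_dec a b); split; intros; auto; try congruence; lra. Qed.

Lemma nat_increasing_ge (f : nat -> nat) n :
  (forall m, (m < n)%nat -> (f m < f (S m))%nat) -> (f 0 + n <= f n)%nat.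
Proof.
  induction n as [|n IH]; intros H; [lia|].
  specialize (IH ltac:(intros; apply H; lia)). specialize (H n ltac:(lia)). lia.
Qed.

(* Pigeonhole on the thresholds [p i0 + m g]: two consecutive ones select the same points. *)
Lemma gap_exists N (J : nat -> bool) (p : nat -> R) (g : R) i0 j0 :
  0 < g -> (i0 < N)%nat -> J i0 = true -> (j0 < N)%nat -> INR N * g < p j0 - p i0 ->
  exists l, p i0 <= l /\ l < p j0 /\
    forall k, (k < N)%nat -> J k = true -> p k <= l \/ l + g < p k.
Proof.
  intros Hg Hi Ji Hj Hsp.
  set (f := fun m => cnt N (fun k => J k && leb_R (p k) (p i0 + INR m * g))).
  destruct (classic (forall m, (m < N)%nat -> (f m < f (S m))%nat)) as [H|H].
  - apply nat_increasing_ge in H.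
    assert (1 <= f 0%nat)%nat.
    { apply cnt_pos with i0; auto. rewrite Ji; simpl. apply leb_R_true. simpl; lra. }
    assert (f N <= N)%nat by apply cnt_le_N. lia.
  - apply not_all_ex_not in H. destruct H as [m H]. apply imply_to_and in H.
    destruct H as [Hm Hf]. exists (p i0 + INR m * g).
    assert (Hmono : INR m * g <= INR N * g).
    { apply Rmult_le_compat_r; [lra|]. apply le_INR; lia. }
    assert (0 <= INR m * g) by (apply Rmult_le_pos; [apply pos_INR|lra]).
    split; [lra|]. split; [lra|]. intros k Hk Jk.
    destruct (Rle_dec (p k) (p i0 + INR m * g + g)) as [Hle|Hgt]; [left|right; lra].
    assert (A := cnt_incl_eq N (fun k => J k && leb_R (p k) (p i0 + INR m * g))
                    (fun k => J k && leb_R (p k) (p i0 + INR (S m) * g))).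
    cbv beta in A. specialize (fun H1 H2 => A H1 H2 k Hk). rewrite Jk, !andb_true_l in A.
    apply leb_R_true, A.
    + intros q Hq. rewrite !andb_true_iff, !leb_R_true, S_INR. intros [? ?]; split; auto. lra.
    + fold (f m). fold (f (S m)). lia.
    + apply leb_R_true. rewrite S_INR. lra.
Qed.

(** [J] ranges over an infinite type, but only finitely many sums occur; this turns the nonvanishing
    of each into a common positive lower bound. *)
Lemma subset_sums_finite N (gamma : nat -> R) :
  exists l : list R, forall J : nat -> bool, In (rsum N (fun k => if J k then gamma k else 0)) l.
Proof.
  induction N as [|N [l IH]].
  - exists (0 :: nil). intros; simpl; auto.
  - exists (map (fun s => s + gamma N) l ++ map (fun s => s + 0) l). intros J. simpl rsum.
    apply in_or_app. destruct (J N); [left|right];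
      [apply (in_map (fun s => s + gamma N))|apply (in_map (fun s => s + 0))]; apply IH.
Qed.

Lemma list_nonzero_gap (l : list R) :
  exists g0, 0 < g0 /\ forall s, In s l -> s <> 0 -> g0 <= Rabs s.
Proof.
  induction l as [|a l [g0 [Hg IH]]].
  - exists 1. split; [lra|]. intros s [].
  - destruct (Req_dec a 0) as [->|Ha].
    + exists g0. split; auto. intros s [<-|Hs] H; auto. congruence.
    + exists (Rmin g0 (Rabs a)). apply Rabs_pos_lt in Ha. split; [apply Rmin_glb_lt; auto|].
      intros s [<-|Hs] H; [apply Rmin_r|]. eapply Rle_trans; [apply Rmin_l|auto].
Qed.

Lemma subset_sums_gap N (gamma : nat -> R) :
  (forall J : nat -> bool, (exists j, (j < N)%nat /\ J j = true) ->
     rsum N (fun k => if J k then gamma k else 0) <> 0) ->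
  exists g0, 0 < g0 /\ forall J : nat -> bool, (exists j, (j < N)%nat /\ J j = true) ->
     g0 <= Rabs (rsum N (fun k => if J k then gamma k else 0)).
Proof.
  intros H. destruct (subset_sums_finite N gamma) as [l Hl].
  destruct (list_nonzero_gap l) as [g0 [Hg Hg0]]. exists g0. split; auto.
Qed.

(** A bootstrap: as long as [h >= 1] has held, the bound improves to 2, so by continuity the
    interval of good times can be prolonged. *)
Lemma continuity_induction (h : R -> R) (a b : R) :
  (forall t, a <= t <= b -> continuous h t) -> 1 <= h a ->
  (forall t, a <= t <= b -> (forall s, a <= s <= t -> 1 <= h s) -> 2 <= h t) ->
  forall t, a <= t <= b -> 1 <= h t.
Proof.
  intros Hc Ha Hstep t0 Ht0.
  set (E := fun t => a <= t <= b /\ forall s, a <= s <= t -> 1 <= h s).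
  assert (HEa : E a).
  { split; [lra|]. intros s Hs. replace s with a by lra. auto. }
  destruct (completeness E) as [m [Hub Hlub]].
  { exists b. intros t [Ht _]. lra. }
  { exists a; auto. }
  assert (Ham : a <= m) by (apply Hub; auto).
  assert (Hmb : m <= b) by (apply Hlub; intros t [Ht _]; lra).
  assert (Hlt : forall s, a <= s < m -> 1 <= h s).
  { intros s Hs. apply NNPP; intros Hn.
    assert (Hu : is_upper_bound E s).
    { intros t [Ht HEt]. apply Rnot_lt_le; intros Hst. apply Hn, HEt. lra. }
    apply Hlub in Hu. lra. }
  assert (Hcm : continuous h m) by (apply Hc; lra).
  assert (Hm : 1 <= h m).
  { apply Rnot_lt_le; intros Hlt1.
    assert (He : 0 < 1 - h m) by lra.
    apply filterlim_locally with (eps := mkposreal _ He) in Hcm.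
    destruct Hcm as [d Hd]. pose proof (cond_pos d).
    destruct (Rle_lt_or_eq_dec a m Ham) as [Hlam|He1]; [|rewrite <- He1 in *; lra].
    set (s := Rmax a (m - d / 2)).
    assert (Hs : a <= s < m) by (split; [apply Rmax_l|apply Rmax_lub_lt; lra]).
    assert (Hs2 : m - d / 2 <= s) by apply Rmax_r.
    specialize (Hlt s Hs). specialize (Hd s).
    assert (Hb : ball m d s).
    { change (Rabs (s - m) < d). rewrite Rabs_left; lra. }
    apply Hd in Hb. change (Rabs (h s - h m) < 1 - h m) in Hb.
    apply Rabs_lt_between in Hb. lra. }
  assert (HEm : E m).
  { split; [lra|]. intros s Hs. destruct (Rle_lt_or_eq_dec s m) as [?| ->]; try lra; auto.
    apply Hlt; lra. }
  assert (H2 : 2 <= h m) by (apply Hstep; [lra|apply HEm]).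
  destruct (Rle_lt_or_eq_dec m b Hmb) as [Hlt'| ->]; [|apply HEm; auto].
  exfalso. apply filterlim_locally with (eps := mkposreal 1 Rlt_0_1) in Hcm.
  destruct Hcm as [d Hd]. pose proof (cond_pos d).
  set (s1 := Rmin b (m + d / 2)).
  assert (Hs1 : m < s1 <= b) by (split; [apply Rmin_glb_lt; lra|apply Rmin_l]).
  assert (Hs2 : s1 <= m + d / 2) by apply Rmin_r.
  assert (E s1); [|apply Hub in H0; lra].
  split; [lra|]. intros s Hs. destruct (Rle_dec s m); [apply HEm; lra|].
  assert (Hb : ball m d s).
  { change (Rabs (s - m) < d). rewrite Rabs_pos_eq; lra. }
  apply Hd in Hb. change (Rabs (h s - h m) < 1) in Hb. apply Rabs_lt_between in Hb. lra.
Qed.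

Fixpoint rmin (n : nat) (g : R) (f : nat -> R) : R :=
  match n with O => g | S k => Rmin (rmin k g f) (f k) end.

Lemma rmin_glb n g f c : c <= g -> (forall i, (i < n)%nat -> c <= f i) -> c <= rmin n g f.
Proof. intros Hg; induction n; intros H; simpl; auto. apply Rmin_glb; auto. Qed.

Lemma rmin_le n g f i : (i < n)%nat -> rmin n g f <= f i.
Proof.
  intros Hi; induction n as [|n IH]; [lia|]. simpl.
  destruct (Nat.eq_dec i n) as [->|Hne]; [apply Rmin_r|].
  eapply Rle_trans; [apply Rmin_l|]. apply IH; lia.
Qed.

Lemma continuous_Rmin (f g : R -> R) t :
  continuous f t -> continuous g t -> continuous (fun s => Rmin (f s) (g s)) t.
Proof.
  intros Hf Hg.
  apply (continuous_ext (fun s => / 2 * ((f s + g s) - Rabs (f s - g s)))).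
  - intros s. unfold Rmin, Rabs. destruct (Rle_dec (f s) (g s)), (Rcase_abs (f s - g s)); lra.
  - apply (continuous_scal_r (V := R_NormedModule)).
    apply (continuous_minus (V := R_NormedModule)); [apply (continuous_plus (V := R_NormedModule)); auto|].
    apply continuous_comp with (f := fun s => f s - g s) (g := Rabs); [|apply continuous_Rabs].
    apply (continuous_minus (V := R_NormedModule)); auto.
Qed.

Lemma continuous_rmin n g (f : nat -> R -> R) t :
  (forall i, (i < n)%nat -> continuous (f i) t) ->
  continuous (fun s => rmin n g (fun i => f i s)) t.
Proof.
  intros H; induction n as [|n IH]; simpl; [apply continuous_const|].
  apply continuous_Rmin; auto.
Qed.

Section Confinement.
Variables (N : nat) (gamma : nat -> R) (kap T g0 : R).
Hypotheses (Hkap : 0 <= kap) (HT : 0 <= T) (Hg0 : 0 < g0).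
Hypothesis (Hgam : forall J : nat -> bool, (exists j, (j < N)%nat /\ J j = true) ->
     g0 <= Rabs (rsum N (fun k => if J k then gamma k else 0))).

Let Gam := rsum N (fun k => Rabs (gamma k)).

Lemma Gam_pos : 0 <= Gam.
Proof. apply rsum_pos; intros; apply Rabs_pos. Qed.

(** The [bool] selects the velocity component, [false] the first and [true] the second; the same
    flag indexes the coordinates of positions. *)
Definition pair_kernel := bool -> R -> R -> R.

Implicit Types (K : pair_kernel) (J : nat -> bool) (x dx : bool -> nat -> R -> R).

(** All that confinement uses of the kernel. Both properties hold with one [kap] for every
    regularization, and they survive a change of sign, hence time reversal. *)
Definition odd_far_bounded (K : pair_kernel) : Prop :=
  (forall c u w, K c (- u) (- w) = - K c u w) /\
  (forall c u w, 1 <= Rabs u \/ 1 <= Rabs w -> Rabs (K c u w) <= kap).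

Definition interaction (K : pair_kernel) (J : nat -> bool) (x : bool -> nat -> R -> R)
  (c : bool) (j : nat) (t : R) : R :=
  rsum N (fun k => if J k && negb (Nat.eqb k j)
                   then gamma k * K c (x false j t - x false k t) (x true j t - x true k t)
                   else 0).

(* The error [A] stands for the influence of the vortices outside [J]. *)
Definition subsystem (K : pair_kernel) (A a b : R) (J : nat -> bool)
  (x dx : bool -> nat -> R -> R) : Prop :=
  forall c j t, (j < N)%nat -> J j = true -> a <= t <= b ->
    is_derive (x c j) t (dx c j t) /\ Rabs (dx c j t - interaction K J x c j t) <= A.

Definition spread_le (J : nat -> bool) (x : bool -> nat -> R -> R) (D t : R) : Prop :=
  forall c i j, (i < N)%nat -> (j < N)%nat -> J i = true -> J j = true ->
    x c j t - x c i t <= D.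

(** By oddness the pair [(j, k)] cancels the pair [(k, j)]: the interaction inside [J] leaves its
    center of vorticity fixed. *)
Lemma interaction_sum_zero K J x c t :
  odd_far_bounded K ->
  rsum N (fun j => if J j then gamma j * interaction K J x c j t else 0) = 0.
Proof.
  intros [Hodd _].
  set (a := fun j k => if J j && J k && negb (Nat.eqb k j)
     then gamma j * gamma k * K c (x false j t - x false k t) (x true j t - x true k t) else 0).
  assert (E : rsum N (fun j => if J j then gamma j * interaction K J x c j t else 0)
          = rsum N (fun j => rsum N (fun k => a j k))).
  { apply rsum_ext; intros j Hj. unfold interaction, a. destruct (J j); simpl.
    - rewrite <- rsum_scal. apply rsum_ext; intros k Hk.
      destruct (J k && negb (Nat.eqb k j)); ring.
    - symmetry; apply rsum_zero; auto. }
  rewrite E.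
  assert (Hanti : rsum N (fun j => rsum N (fun k => a j k)) = - rsum N (fun j => rsum N (fun k => a j k))).
  { rewrite rsum_swap at 1.
    replace (- rsum N (fun j => rsum N (fun k => a j k))) with
      (-1 * rsum N (fun j => rsum N (fun k => a j k))) by ring.
    rewrite <- rsum_scal. apply rsum_ext; intros k Hk. rewrite <- rsum_scal.
    apply rsum_ext; intros j Hj. unfold a.
    rewrite (andb_comm (J j)), (Nat.eqb_sym k j).
    destruct (J k && J j && negb (Nat.eqb j k)); [|ring].
    replace (x false j t - x false k t) with (- (x false k t - x false j t)) by ring.
    replace (x true j t - x true k t) with (- (x true k t - x true j t)) by ring.
    rewrite Hodd. ring. }
  lra.
Qed.

Lemma weighted_abs_le (J : nat -> bool) (f : nat -> R) (A : R) :
  0 <= A -> (forall j, (j < N)%nat -> J j = true -> Rabs (f j) <= A) ->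
  Rabs (rsum N (fun j => if J j then gamma j * f j else 0)) <= A * Gam.
Proof.
  intros HA H. eapply Rle_trans; [apply rsum_abs|].
  unfold Gam. rewrite <- rsum_scal. apply rsum_le; intros j Hj.
  destruct (J j) eqn:E.
  - rewrite Rabs_mult, Rmult_comm. apply Rmult_le_compat_r; [apply Rabs_pos|auto].
  - rewrite Rabs_R0. apply Rmult_le_pos; auto. apply Rabs_pos.
Qed.

(* The center of vorticity of [J] moves only under the perturbation; the spread
   controls the distance of each vortex to it. *)
Lemma displacement_small_spread K A a b J x dx D :
  odd_far_bounded K -> 0 <= A -> a <= b -> b - a <= T -> 0 <= D ->
  subsystem K A a b J x dx -> spread_le J x D a -> spread_le J x D b ->
  forall c i, (i < N)%nat -> J i = true ->
  Rabs (x c i b - x c i a) <= (A * Gam * T + 2 * (D * Gam)) / g0.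
Proof.
  intros HK HA Hab HbT HD Hsub Hsa Hsb c i Hi Ji.
  pose proof Gam_pos as HG.
  set (Mc := fun t => rsum N (fun j => if J j then gamma j * x c j t else 0)).
  set (G := rsum N (fun k => if J k then gamma k else 0)).
  assert (HGJ : g0 <= Rabs G) by (apply Hgam; exists i; auto).
  assert (HM : Rabs (Mc b - Mc a) <= A * Gam * Rabs (b - a)).
  { apply (lip_of_derive Mc (fun t => rsum N (fun j => if J j then gamma j * dx c j t else 0))).
    - intros t Ht. rewrite Rmin_left, Rmax_right in Ht by auto.
      apply (is_derive_rsum N (fun j t => if J j then gamma j * x c j t else 0)). intros j Hj.
      destruct (J j) eqn:E; [|apply (is_derive_const (K := R_AbsRing) (V := R_NormedModule))].
      apply (is_derive_scal (x c j)). apply Hsub; auto.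
    - intros t Ht. rewrite Rmin_left, Rmax_right in Ht by auto.
      assert (Ez := interaction_sum_zero K J x c t HK).
      replace (rsum N (fun j => if J j then gamma j * dx c j t else 0)) with
        (rsum N (fun j => if J j then gamma j * (dx c j t - interaction K J x c j t) else 0)).
      2:{ transitivity (rsum N (fun j => if J j then gamma j * dx c j t else 0)
            - rsum N (fun j => if J j then gamma j * interaction K J x c j t else 0)).
          - rewrite <- rsum_minus. apply rsum_ext; intros j Hj. destruct (J j); ring.
          - rewrite Ez. ring. }
      apply weighted_abs_le; auto. intros j Hj Jj. apply Hsub; auto. }
  (* The difference is the sum of [gamma j * (x c i t - x c j t)], so the spread controls it;
     [g0 <= Rabs G] then recovers the displacement itself. *)
  assert (Hx : forall t, spread_le J x D t -> Rabs (G * x c i t - Mc t) <= D * Gam).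
  { intros t Hs. unfold G, Mc. rewrite Rmult_comm, <- rsum_scal, <- rsum_minus.
    rewrite (rsum_ext N _ (fun j => if J j then gamma j * (x c i t - x c j t) else 0)).
    2:{ intros j Hj. cbv beta. destruct (J j); ring. }
    apply weighted_abs_le; auto. intros j Hj Jj. apply Rabs_le; split.
    - specialize (Hs c i j Hi Hj Ji Jj). lra.
    - apply (Hs c j i); auto. }
  apply (Rmult_le_reg_l g0); auto.
  replace (g0 * ((A * Gam * T + 2 * (D * Gam)) / g0)) with (A * Gam * T + 2 * (D * Gam))
    by (field; lra).
  apply Rle_trans with (Rabs (G * (x c i b - x c i a))).
  { rewrite Rabs_mult. apply Rmult_le_compat_r; [apply Rabs_pos|auto]. }
  replace (G * (x c i b - x c i a)) with
    ((Mc b - Mc a) + ((G * x c i b - Mc b) - (G * x c i a - Mc a))) by ring.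
  eapply Rle_trans; [apply Rabs_triang|].
  eapply Rle_trans; [apply Rplus_le_compat_l, Rabs_triang|]. rewrite Rabs_Ropp.
  specialize (Hx a Hsa) as Hxa. specialize (Hx b Hsb) as Hxb.
  rewrite (Rabs_pos_eq (b - a)) in HM by lra.
  assert (A * Gam * (b - a) <= A * Gam * T).
  { apply Rmult_le_compat_l; auto. apply Rmult_le_pos; auto. }
  lra.
Qed.

(** Uniform over kernels, subsets and time windows, because the induction passes to smaller [J] with
    a larger error on shorter windows, and to the reversed kernel. *)
Definition displacement_bound (n : nat) (A C : R) : Prop :=
  forall K J a b x dx, odd_far_bounded K -> (cnt N J <= n)%nat -> a <= b -> b - a <= T ->
    subsystem K A a b J x dx ->
    forall c j, (j < N)%nat -> J j = true -> Rabs (x c j b - x c j a) <= C.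

(** A vortex of [J] outside [J'] stays at distance at least 1 in the coordinate [c0], so its
    influence on [J'] is at most [kap] times its strength and goes into the error. *)
Lemma subsystem_separated K A a b J J' x dx c0 :
  odd_far_bounded K -> subsystem K A a b J x dx ->
  (forall k, (k < N)%nat -> J' k = true -> J k = true) ->
  (forall j k t, (j < N)%nat -> (k < N)%nat -> J' j = true -> J k = true -> J' k = false ->
     a <= t <= b -> 1 <= Rabs (x c0 j t - x c0 k t)) ->
  subsystem K (A + kap * Gam) a b J' x dx.
Proof.
  intros [_ Hfar] Hsub Hincl Hsep c j t Hj Jj Ht.
  destruct (Hsub c j t Hj (Hincl j Hj Jj) Ht) as [H1 H2]. split; auto.
  replace (dx c j t - interaction K J' x c j t) with
    ((dx c j t - interaction K J x c j t) + (interaction K J x c j t - interaction K J' x c j t)) by ring.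
  eapply Rle_trans; [apply Rabs_triang|]. apply Rplus_le_compat; auto.
  unfold interaction. rewrite <- rsum_minus. eapply Rle_trans; [apply rsum_abs|].
  unfold Gam. rewrite <- rsum_scal. apply rsum_le; intros k Hk.
  assert (Hpos : 0 <= kap * Rabs (gamma k)) by (apply Rmult_le_pos; auto; apply Rabs_pos).
  destruct (J' k) eqn:E.
  - rewrite (Hincl k Hk E), Rminus_diag, Rabs_R0; auto.
  - simpl. destruct (J k) eqn:E2; simpl.
    + destruct (negb (Nat.eqb k j)); rewrite Rminus_0_r; [|rewrite Rabs_R0; auto].
      rewrite Rabs_mult, Rmult_comm. apply Rmult_le_compat_r; [apply Rabs_pos|].
      apply Hfar. specialize (Hsep j k t Hj Hk Jj E2 E Ht).
      destruct c0; auto.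
    + rewrite Rminus_diag, Rabs_R0; auto.
Qed.

Lemma subsystem_shorter K A a b b' J x dx :
  b' <= b -> subsystem K A a b J x dx -> subsystem K A a b' J x dx.
Proof. intros Hb Hs c j t Hj Jj Ht. apply Hs; auto; lra. Qed.

(* A cluster of large initial spread splits into two groups, which stay apart by continuity
   because each moves little by the induction hypothesis. *)
Lemma displacement_large_spread n A C' K a b J x dx :
  odd_far_bounded K -> 0 <= C' -> displacement_bound n (A + kap * Gam) C' ->
  (cnt N J <= S n)%nat -> a <= b -> b - a <= T -> subsystem K A a b J x dx ->
  ~ spread_le J x (INR N * (2 * C' + 2)) a ->
  forall c j, (j < N)%nat -> J j = true -> Rabs (x c j b - x c j a) <= C'.
Proof.
  intros HK HC' IH Hcnt Hab HbT Hsub Hns.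
  (* Two groups that start further apart than [g] and move by at most [C'] each remain 2 apart, as
     the bootstrap requires. *)
  set (g := 2 * C' + 2) in *. assert (Hg : 0 < g) by (unfold g; lra).
  unfold spread_le in Hns.
  apply not_all_ex_not in Hns; destruct Hns as [c0 Hns].
  apply not_all_ex_not in Hns; destruct Hns as [i0 Hns].
  apply not_all_ex_not in Hns; destruct Hns as [j0 Hns].
  apply imply_to_and in Hns; destruct Hns as [Hi0 Hns].
  apply imply_to_and in Hns; destruct Hns as [Hj0 Hns].
  apply imply_to_and in Hns; destruct Hns as [Ji0 Hns].
  apply imply_to_and in Hns; destruct Hns as [Jj0 Hns].
  apply Rnot_le_lt in Hns.
  destruct (gap_exists N J (fun k => x c0 k a) g i0 j0) as [l [Hl1 [Hl2 Hl]]]; auto.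
  set (J1 := fun k => J k && leb_R (x c0 k a) l).
  set (J2 := fun k => J k && negb (leb_R (x c0 k a) l)).
  assert (HJ1 : forall k, (k < N)%nat -> J1 k = true -> J k = true /\ x c0 k a <= l).
  { intros k Hk. unfold J1. rewrite andb_true_iff, leb_R_true. auto. }
  assert (HJ2 : forall k, (k < N)%nat -> J2 k = true -> J k = true /\ l + g < x c0 k a).
  { intros k Hk. unfold J2. rewrite andb_true_iff, negb_true_iff, leb_R_false. intros [Jk Hlk].
    split; auto. destruct (Hl k Hk Jk); auto. lra. }
  assert (HJ12 : forall k, J k = true -> J1 k = true \/ J2 k = true).
  { intros k Jk. unfold J1, J2. rewrite Jk. destruct (leb_R (x c0 k a) l); auto. }
  assert (HJno : forall k, J1 k = true -> J2 k = true -> False).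
  { intros k. unfold J1, J2. destruct (J k), (leb_R (x c0 k a) l); simpl; congruence. }
  (* Both groups are proper subsets, since [j0] is not in [J1] and [i0] is not in [J2]; the
     induction hypothesis applies to them. *)
  assert (Hc1 : (cnt N J1 <= n)%nat).
  { destruct (Nat.le_gt_cases (cnt N J1) n) as [|Hgt]; auto. exfalso.
    assert (A1 := cnt_incl_eq N J1 J (fun k Hk H => proj1 (HJ1 k Hk H)) ltac:(lia) j0 Hj0 Jj0).
    apply HJ1 in A1; auto. lra. }
  assert (Hc2 : (cnt N J2 <= n)%nat).
  { destruct (Nat.le_gt_cases (cnt N J2) n) as [|Hgt]; auto. exfalso.
    assert (A1 := cnt_incl_eq N J2 J (fun k Hk H => proj1 (HJ2 k Hk H)) ltac:(lia) i0 Hi0 Ji0).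
    apply HJ2 in A1; auto. lra. }
  (* The least gap between the two groups, capped by [g]; the cap also fills the index pairs that do
     not compare the groups. *)
  set (h := fun t => rmin N g (fun i => rmin N g (fun j =>
     if J1 i && J2 j then x c0 j t - x c0 i t else g))).
  assert (Hhc : forall t, a <= t <= b -> continuous h t).
  { intros t Ht. apply (continuous_rmin N g (fun i t => rmin N g (fun j =>
      if J1 i && J2 j then x c0 j t - x c0 i t else g))). intros i Hi.
    apply (continuous_rmin N g (fun j t => if J1 i && J2 j then x c0 j t - x c0 i t else g)).
    intros j Hj. destruct (J1 i) eqn:E1; [|apply continuous_const].
    destruct (J2 j) eqn:E2; [|apply continuous_const]. simpl.
    apply (continuous_minus (V := R_NormedModule)).
    - apply (ex_derive_continuous (K := R_AbsRing) (V := R_NormedModule)).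
      exists (dx c0 j t). apply Hsub; auto. apply HJ2; auto.
    - apply (ex_derive_continuous (K := R_AbsRing) (V := R_NormedModule)).
      exists (dx c0 i t). apply Hsub; auto. apply HJ1; auto. }
  assert (Hhle : forall t i j, (i < N)%nat -> (j < N)%nat -> J1 i = true -> J2 j = true ->
            h t <= x c0 j t - x c0 i t).
  { intros t i j Hi Hj Ji Jj.
    eapply Rle_trans; [apply (rmin_le N g _ i Hi)|]. cbv beta.
    eapply Rle_trans; [apply (rmin_le N g _ j Hj)|]. cbv beta. rewrite Ji, Jj. simpl. lra. }
  assert (Hmove : forall t, a <= t <= b -> (forall s, a <= s <= t -> 1 <= h s) ->
            forall c j, (j < N)%nat -> J j = true -> Rabs (x c j t - x c j a) <= C').
  { intros t Ht Hh c j Hj Jj.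
    assert (Hsub' := subsystem_shorter K A a b t J x dx (proj2 Ht) Hsub).
    destruct (HJ12 j Jj) as [Jj'|Jj'].
    - apply (IH K J1 a t x dx); auto; try lra.
      apply (subsystem_separated K A a t J J1 x dx c0); auto.
      + intros k Hk Hk1; apply HJ1; auto.
      + intros i k s Hi Hk Ji Jk Jk1 Hs. destruct (HJ12 k Jk) as [|Jk2]; [congruence|].
        rewrite Rabs_minus_sym. eapply Rle_trans; [|apply Rle_abs].
        eapply Rle_trans; [apply (Hh s Hs)|apply Hhle; auto].
    - apply (IH K J2 a t x dx); auto; try lra.
      apply (subsystem_separated K A a t J J2 x dx c0); auto.
      + intros k Hk Hk1; apply HJ2; auto.
      + intros i k s Hi Hk Ji Jk Jk1 Hs. destruct (HJ12 k Jk) as [Jk2|]; [|congruence].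
        eapply Rle_trans; [|apply Rle_abs].
        eapply Rle_trans; [apply (Hh s Hs)|apply Hhle; auto]. }
  apply Hmove; [lra|]. intros s Hs. apply (continuity_induction h a b); auto.
  - apply rmin_glb; [unfold g; lra|]. intros i Hi. apply rmin_glb; [unfold g; lra|]. intros j Hj.
    destruct (J1 i) eqn:E1; [|unfold g; simpl; lra].
    destruct (J2 j) eqn:E2; [|unfold g; simpl; lra]. simpl.
    apply HJ1 in E1; auto. apply HJ2 in E2; auto. unfold g in E2. lra.
  - intros t Ht Hh. specialize (Hmove t Ht Hh c0).
    apply rmin_glb; [unfold g; lra|]. intros i Hi. apply rmin_glb; [unfold g; lra|]. intros j Hj.
    destruct (J1 i) eqn:E1; [|unfold g; simpl; lra].
    destruct (J2 j) eqn:E2; [|unfold g; simpl; lra]. simpl.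
    apply HJ1 in E1; auto. apply HJ2 in E2; auto. unfold g in E2.
    assert (M1 := Hmove i Hi (proj1 E1)). assert (M2 := Hmove j Hj (proj1 E2)).
    apply Rabs_le_between in M1. apply Rabs_le_between in M2. lra.
Qed.

(** Running time backwards changes the sign of the kernel. A cluster that is spread out at the end
    but not at the start can thus be split as well. *)
Lemma subsystem_reverse K A a b J x dx :
  subsystem K A a b J x dx ->
  subsystem (fun c u w => - K c u w) A (- b) (- a) J (fun c j t => x c j (- t))
    (fun c j t => - dx c j (- t)).
Proof.
  intros Hs c j t Hj Jj Ht. destruct (Hs c j (- t) Hj Jj) as [H1 H2]; [lra|]. split.
  - assert (Hc : is_derive (fun s => - s) t (-1)) by (auto_derive; auto; ring).
    assert (H := is_derive_comp (x c j) (fun s => - s) t _ _ H1 Hc).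
    unfold scal in H; simpl in H; unfold mult in H; simpl in H.
    replace (- dx c j (- t)) with (-1 * dx c j (- t)) by ring. exact H.
  - replace (- dx c j (- t) - _) with (- (dx c j (- t) - interaction K J x c j (- t))).
    + rewrite Rabs_Ropp; auto.
    + unfold interaction.
      rewrite (rsum_ext N (fun k => if J k && negb (Nat.eqb k j) then gamma k * - _ else 0)
         (fun k => -1 * (if J k && negb (Nat.eqb k j) then
           gamma k * K c (x false j (- t) - x false k (- t)) (x true j (- t) - x true k (- t)) else 0))).
      * rewrite rsum_scal. ring.
      * intros k Hk. destruct (J k && negb (Nat.eqb k j)); ring.
Qed.

(** Only the spread at the two ends of the window matters. If it is small at both, the center of
    vorticity gives the bound; if it is large at the start, the cluster is split; if it is large at
    the end, it is split in reversed time. *)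
Lemma displacement_bound_exists n :
  forall A, 0 <= A -> exists C, 0 <= C /\ displacement_bound n A C.
Proof.
  pose proof Gam_pos as HG.
  induction n as [|n IH]; intros A HA.
  - exists 0. split; [lra|]. intros K J a b x dx HK Hc Hab HbT Hs c j Hj Jj.
    pose proof (cnt_pos N J j Hj Jj). lia.
  - assert (HkG : 0 <= kap * Gam) by (apply Rmult_le_pos; auto).
    destruct (IH (A + kap * Gam)) as [C' [HC' HB]]; [lra|].
    set (D := INR N * (2 * C' + 2)).
    assert (HD : 0 <= D) by (apply Rmult_le_pos; [apply pos_INR|lra]).
    set (C1 := (A * Gam * T + 2 * (D * Gam)) / g0).
    assert (HC1 : 0 <= C1).
    { apply Rdiv_le_0_compat; auto.
      assert (0 <= A * Gam * T) by (apply Rmult_le_pos; auto; apply Rmult_le_pos; auto).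
      assert (0 <= D * Gam) by (apply Rmult_le_pos; auto). lra. }
    exists (C' + C1). split; [lra|]. intros K J a b x dx HK Hc Hab HbT Hs c j Hj Jj.
    destruct (classic (spread_le J x D a)) as [Ha|Ha].
    + destruct (classic (spread_le J x D b)) as [Hb|Hb].
      * apply Rle_trans with C1; [|lra].
        apply (displacement_small_spread K A a b J x dx D); auto.
      * apply Rle_trans with C'; [|lra]. rewrite Rabs_minus_sym.
        assert (Hrev := displacement_large_spread n A C' (fun c u w => - K c u w) (- b) (- a) J
                 (fun c j t => x c j (- t)) (fun c j t => - dx c j (- t))).
        cbv beta in Hrev. rewrite !Ropp_involutive in Hrev.
        apply Hrev; auto; try lra.
        -- destruct HK as [H1 H2]. split; intros; [rewrite H1; ring|rewrite Rabs_Ropp; auto].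
        -- apply subsystem_reverse; auto.
        -- intros H. apply Hb. intros c1 i1 j1 Hi1 Hj1 Ji1 Jj1.
           specialize (H c1 i1 j1 Hi1 Hj1 Ji1 Jj1). cbv beta in H.
           rewrite Ropp_involutive in H. exact H.
    + apply Rle_trans with C'; [|lra].
      apply (displacement_large_spread n A C' K a b J x dx); auto.
Qed.

End Confinement.

(** * The regularized kernel *)

Lemma is_derive_of_quadratic (f : R -> R) (x l C : R) :
  (forall y, Rabs (f y - f x - l * (y - x)) <= C * (y - x) ^ 2) -> is_derive f x l.
Proof.
  intros H. apply is_derive_Reals. intros e He.
  assert (HC : 0 <= C).
  { specialize (H (x + 1)). replace (x + 1 - x) with 1 in H by ring.
    pose proof (Rabs_pos (f (x + 1) - f x - l * 1)). lra. }
  assert (Hd : 0 < e / (C + 1)) by (apply Rdiv_lt_0_compat; lra).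
  exists (mkposreal _ Hd). intros h Hh0 Hh. simpl in Hh.
  specialize (H (x + h)). replace (x + h - x) with h in H by ring.
  replace ((f (x + h) - f x) / h - l) with ((f (x + h) - f x - l * h) / h) by (field; auto).
  unfold Rdiv. rewrite Rabs_mult, Rabs_inv.
  apply Rabs_pos_lt in Hh0 as Hh0'.
  apply (Rmult_lt_reg_r (Rabs h)); auto.
  rewrite Rmult_assoc, Rinv_l, Rmult_1_r by lra.
  eapply Rle_lt_trans; [apply H|]. rewrite <- pow2_abs.
  apply (Rmult_lt_compat_r (C + 1)) in Hh; [|lra].
  replace (e / (C + 1) * (C + 1)) with e in Hh by (field; lra). nra.
Qed.

Lemma is_derive_pos_part_sq r : is_derive (fun r => Rmax 0 r ^ 2) r (2 * Rmax 0 r).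
Proof.
  apply is_derive_of_quadratic with 1. intros y. apply Rabs_le.
  pose proof (pow2_ge_0 (y - r)). pose proof (pow2_ge_0 y). pose proof (pow2_ge_0 r).
  unfold Rmax; destruct (Rle_dec 0 y) as [Hy|Hy], (Rle_dec 0 r) as [Hr|Hr].
  - split; nra.
  - pose proof (Rmult_le_pos y (- r)). split; nra.
  - pose proof (Rmult_le_pos (- y) r). split; nra.
  - split; nra.
Qed.

Section Kernel.
Variables (a s : R).
Hypotheses (Ha : 0 < a) (Hs : / 2 < s).

(* A twice differentiable modification of the identity below [a], bounded below by [a / 3]. *)
Definition rho (r : R) : R := r + (a - r) * Rmax 0 (a - r) ^ 2 / (3 * a ^ 2).
Definition rho1 (r : R) : R := 1 - Rmax 0 (a - r) ^ 2 / a ^ 2.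
Definition rho2 (r : R) : R := 2 * Rmax 0 (a - r) / a ^ 2.

Lemma is_derive_pos_part_sq_rev r :
  is_derive (fun r => Rmax 0 (a - r) ^ 2) r (- (2 * Rmax 0 (a - r))).
Proof.
  replace (- (2 * Rmax 0 (a - r))) with (-1 * (2 * Rmax 0 (a - r))) by ring.
  apply (is_derive_comp (fun r => Rmax 0 r ^ 2) (fun r => a - r)).
  - apply is_derive_pos_part_sq.
  - auto_derive; [trivial|ring].
Qed.

Lemma is_derive_rho r : is_derive rho r (rho1 r).
Proof.
  unfold rho, rho1. pose proof (is_derive_pos_part_sq_rev r) as H.
  assert (H3 : is_derive (fun r => (a - r) * Rmax 0 (a - r) ^ 2) r
            (-1 * Rmax 0 (a - r) ^ 2 + (a - r) * - (2 * Rmax 0 (a - r)))).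
  { apply (is_derive_mult (K := R_AbsRing) (fun r => a - r) (fun r => Rmax 0 (a - r) ^ 2));
      [auto_derive; [trivial|ring]|auto|apply Rmult_comm]. }
  assert (E : (a - r) * Rmax 0 (a - r) = Rmax 0 (a - r) ^ 2).
  { unfold Rmax; destruct (Rle_dec 0 (a - r)); ring. }
  replace (1 - Rmax 0 (a - r) ^ 2 / a ^ 2) with
    (1 + / (3 * a ^ 2) * (-1 * Rmax 0 (a - r) ^ 2 + (a - r) * - (2 * Rmax 0 (a - r)))).
  2:{ replace ((a - r) * - (2 * Rmax 0 (a - r))) with (-2 * ((a - r) * Rmax 0 (a - r))) by ring.
      rewrite E. field. lra. }
  apply (is_derive_plus (K := R_AbsRing) (V := R_NormedModule) (fun r => r)).
  - apply (is_derive_id (K := R_AbsRing)).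
  - apply (is_derive_ext (fun r => / (3 * a ^ 2) * ((a - r) * Rmax 0 (a - r) ^ 2))).
    { intros t. match goal with |- @eq _ ?x ?y => change (@eq R x y) end. unfold Rdiv. ring. }
    apply (is_derive_scal (fun r => (a - r) * Rmax 0 (a - r) ^ 2)). exact H3.
Qed.

Lemma is_derive_rho1 r : is_derive rho1 r (rho2 r).
Proof.
  unfold rho1, rho2. pose proof (is_derive_pos_part_sq_rev r) as H.
  replace (2 * Rmax 0 (a - r) / a ^ 2) with (0 + -1 * / a ^ 2 * (- (2 * Rmax 0 (a - r))))
    by (field; lra).
  apply (is_derive_ext (fun r => 1 + -1 * / a ^ 2 * (Rmax 0 (a - r) ^ 2))).
  { intros t. unfold Rdiv. change (1 + -1 * / a ^ 2 * Rmax 0 (a - t) ^ 2 = 1 - Rmax 0 (a - t) ^ 2 * / a ^ 2). ring. }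
  apply (is_derive_plus (K := R_AbsRing) (V := R_NormedModule) (fun _ => 1)).
  - apply (is_derive_const (K := R_AbsRing) (V := R_NormedModule)).
  - apply (is_derive_scal (fun r => Rmax 0 (a - r) ^ 2)). exact H.
Qed.

Lemma rho_eq r : a <= r -> rho r = r.
Proof. intros H. unfold rho. rewrite Rmax_left by lra. field. lra. Qed.

(** In this form [a / 3] is visible as a lower bound: the second summand of the numerator is
    nonnegative for [r < a]. *)
Lemma rho_below r : r < a -> rho r = (a ^ 3 + r ^ 2 * (3 * a - r)) / (3 * a ^ 2).
Proof. intros H. unfold rho. rewrite Rmax_right by lra. field. lra. Qed.

Lemma rho_ge_id r : r <= rho r.
Proof.
  destruct (Rle_dec a r) as [H|H]; [rewrite rho_eq; lra|].
  unfold rho. rewrite Rmax_right by lra.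
  assert (0 <= (a - r) * (a - r) ^ 2 / (3 * a ^ 2)); [|lra].
  apply Rdiv_le_0_compat; [|nra]. apply Rmult_le_pos; [lra|apply pow2_ge_0].
Qed.

Lemma rho_ge r : a / 3 <= rho r.
Proof.
  destruct (Rle_dec a r) as [H|H]; [rewrite rho_eq; lra|]. rewrite rho_below by lra.
  replace (a / 3) with (a ^ 3 / (3 * a ^ 2)) by (field; lra).
  unfold Rdiv. apply Rmult_le_compat_r; [left; apply Rinv_0_lt_compat; nra|].
  assert (0 <= r ^ 2 * (3 * a - r)) by (apply Rmult_le_pos; [apply pow2_ge_0|lra]). lra.
Qed.

Lemma rho_pos r : 0 < rho r.
Proof. pose proof (rho_ge r). lra. Qed.

Lemma rho1_bound r : 0 <= r -> 0 <= rho1 r <= 1.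
Proof.
  intros Hr. unfold rho1.
  assert (H : 0 <= Rmax 0 (a - r) <= a) by (split; [apply Rmax_l|apply Rmax_lub; lra]).
  assert (0 <= Rmax 0 (a - r) ^ 2 / a ^ 2 <= 1); [|lra].
  split; [apply Rdiv_le_0_compat; nra|].
  apply (Rmult_le_reg_r (a ^ 2)); [nra|]. unfold Rdiv.
  rewrite Rmult_assoc, Rinv_l by nra. nra.
Qed.

Lemma rho2_bound r : 0 <= r -> 0 <= rho2 r * rho r <= 3.
Proof.
  intros Hr. pose proof (rho_pos r) as Hp. unfold rho2.
  destruct (Rle_dec a r) as [H|H].
  - rewrite Rmax_left by lra. unfold Rdiv. rewrite Rmult_0_r, !Rmult_0_l. lra.
  - assert (E1 : Rmax 0 (a - r) <= a) by (apply Rmax_lub; lra).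
    assert (E0 : 0 <= Rmax 0 (a - r)) by apply Rmax_l.
    assert (E2 : rho r <= 3 / 2 * a).
    { rewrite rho_below by lra. apply (Rmult_le_reg_r (3 * a ^ 2)); [nra|].
      unfold Rdiv at 1. rewrite Rmult_assoc, Rinv_l by nra.
      assert (r ^ 2 * (3 * a - r) <= 3 * a ^ 3); [|nra].
      assert (r ^ 2 <= a ^ 2) by nra. nra. }
    assert (0 <= Rmax 0 (a - r) * rho r <= a * (3 / 2 * a)).
    { split; [nra|]. apply Rmult_le_compat; lra. }
    replace (2 * Rmax 0 (a - r) / a ^ 2 * rho r) with (2 * (Rmax 0 (a - r) * rho r) / a ^ 2)
      by (field; lra).
    split; [apply Rdiv_le_0_compat; nra|].
    apply (Rmult_le_reg_r (a ^ 2)); [nra|]. unfold Rdiv at 1.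
    rewrite Rmult_assoc, Rinv_l by nra. nra.
Qed.

Definition theta (r : R) : R := Rpower (rho r) (- s).
Definition theta1 (r : R) : R := - s * theta r * (rho1 r / rho r).
Definition theta2 (r : R) : R :=
  - s * (theta1 r * (rho1 r / rho r) + theta r * ((rho2 r * rho r - rho1 r ^ 2) / rho r ^ 2)).

Lemma is_derive_theta r : is_derive theta r (theta1 r).
Proof.
  unfold theta1, theta. pose proof (rho_pos r) as Hp.
  replace (- s * Rpower (rho r) (- s) * (rho1 r / rho r)) with
    (rho1 r * (- s * Rpower (rho r) (- s) / rho r)) by (unfold Rdiv; ring).
  apply (is_derive_comp (fun y => Rpower y (- s)) rho); [|apply is_derive_rho].
  unfold Rpower. auto_derive; [auto|]. field. lra.
Qed.

Lemma is_derive_theta1 r : is_derive theta1 r (theta2 r).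
Proof.
  unfold theta2. pose proof (rho_pos r) as Hp.
  assert (Hq : is_derive (fun r => rho1 r / rho r) r ((rho2 r * rho r - rho1 r ^ 2) / rho r ^ 2)).
  { replace (rho2 r * rho r - rho1 r ^ 2) with (rho2 r * rho r - rho1 r * rho1 r) by ring.
    apply (is_derive_div rho1 rho); [apply is_derive_rho1|apply is_derive_rho|lra]. }
  apply (is_derive_ext (fun r => - s * (theta r * (rho1 r / rho r)))).
  { intros t. unfold theta1. match goal with |- @eq _ ?x ?y => change (@eq R x y) end. ring. }
  apply (is_derive_scal (fun r => theta r * (rho1 r / rho r))).
  apply (is_derive_mult (K := R_AbsRing) theta (fun r => rho1 r / rho r));
    [apply is_derive_theta|auto|apply Rmult_comm].
Qed.

Let c0 := Rpower (a / 3) (- s).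

Lemma Rpower_antitone x y p : 0 < x -> x <= y -> p <= 0 -> Rpower y p <= Rpower x p.
Proof.
  intros Hx Hxy Hp. unfold Rpower. apply exp_le.
  assert (ln x <= ln y) by (apply ln_le; auto). nra.
Qed.

Lemma theta_pos r : 0 < theta r.
Proof. apply exp_pos. Qed.

Lemma theta_le r : theta r <= c0.
Proof. apply Rpower_antitone; [lra|apply rho_ge|lra]. Qed.

Lemma c0_pos : 0 < c0.
Proof. apply exp_pos. Qed.

(** Each derivative of [theta] costs a factor [1 / rho]. The product with [rho] is bounded, and
    [r <= rho r] then absorbs the polynomial factors in the derivatives of [kern]. *)
Lemma theta1_le r : 0 <= r -> Rabs (theta1 r) * rho r <= s * c0.
Proof.
  intros Hr. pose proof (rho_pos r) as Hp. pose proof (theta_pos r). pose proof (theta_le r).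
  pose proof (rho1_bound r Hr). unfold theta1.
  replace (- s * theta r * (rho1 r / rho r)) with (- (s * theta r * (rho1 r / rho r))) by ring.
  assert (0 <= rho1 r / rho r) by (apply Rdiv_le_0_compat; lra).
  rewrite Rabs_Ropp, Rabs_pos_eq by (apply Rmult_le_pos; nra).
  replace (s * theta r * (rho1 r / rho r) * rho r) with (s * (theta r * rho1 r)) by (field; lra).
  apply Rmult_le_compat_l; [lra|]. nra.
Qed.

Lemma theta2_le r : 0 <= r -> Rabs (theta2 r) * rho r ^ 2 <= s * (s + 4) * c0.
Proof.
  intros Hr. pose proof (rho_pos r) as Hp. pose proof (theta_pos r) as H0. pose proof (theta_le r) as H1.
  pose proof (rho1_bound r Hr) as H2. pose proof (rho2_bound r Hr) as H3. pose proof (theta1_le r Hr) as H4.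
  rewrite <- (Rabs_pos_eq (rho r ^ 2)) by nra. rewrite <- Rabs_mult. unfold theta2.
  replace (- s * (theta1 r * (rho1 r / rho r) + theta r * ((rho2 r * rho r - rho1 r ^ 2) / rho r ^ 2))
            * rho r ^ 2) with
    (- s * ((theta1 r * rho r) * rho1 r + theta r * (rho2 r * rho r - rho1 r ^ 2)))
    by (field; lra).
  rewrite Rabs_mult, Rabs_Ropp, (Rabs_pos_eq s) by lra.
  rewrite (Rmult_assoc s (s + 4)). apply Rmult_le_compat_l; [lra|].
  eapply Rle_trans; [apply Rabs_triang|]. rewrite !Rabs_mult.
  rewrite (Rabs_pos_eq (rho r)), (Rabs_pos_eq (rho1 r)), (Rabs_pos_eq (theta r)) by lra.
  assert (Rabs (rho2 r * rho r - rho1 r ^ 2) <= 4) by (apply Rabs_le; split; nra).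
  pose proof (Rabs_pos (rho2 r * rho r - rho1 r ^ 2)).
  assert (theta r * Rabs (rho2 r * rho r - rho1 r ^ 2) <= c0 * 4) by (apply Rmult_le_compat; lra).
  pose proof (Rmult_le_pos _ _ (Rabs_pos (theta1 r)) (Rlt_le _ _ Hp)). nra.
Qed.

(** For [s = (4 - m) / 2] and [u ^ 2 + w ^ 2 >= a] this is the [w]-derivative of
    [|(u, w)| ^ (m - 2)] divided by [m - 2]. The first argument [u] is the coordinate that the
    velocity component drives, so [dkern] is the derivative that enters the divergence. *)
Definition kern (u w : R) : R := w * theta (u ^ 2 + w ^ 2).
Definition dkern (u w : R) : R := 2 * u * w * theta1 (u ^ 2 + w ^ 2).

Lemma is_derive_kern_l u w : is_derive (fun u => kern u w) u (dkern u w).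
Proof.
  unfold kern, dkern.
  assert (H := is_derive_comp theta (fun u => u ^ 2 + w ^ 2) u _ (2 * u)
     (is_derive_theta (u ^ 2 + w ^ 2)) ltac:(auto_derive; [trivial|ring])).
  unfold scal in H; simpl in H; unfold mult in H; simpl in H.
  replace (2 * u * w * theta1 (u ^ 2 + w ^ 2)) with (w * (2 * u * theta1 (u ^ 2 + w ^ 2))) by ring.
  apply (is_derive_scal (fun u => theta (u ^ 2 + w ^ 2))). exact H.
Qed.

Lemma is_derive_kern_r u w :
  is_derive (fun w => kern u w) w (theta (u ^ 2 + w ^ 2) + 2 * w ^ 2 * theta1 (u ^ 2 + w ^ 2)).
Proof.
  unfold kern.
  assert (H := is_derive_comp theta (fun w => u ^ 2 + w ^ 2) w _ (2 * w)
     (is_derive_theta (u ^ 2 + w ^ 2)) ltac:(auto_derive; [trivial|ring])).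
  unfold scal in H; simpl in H; unfold mult in H; simpl in H.
  replace (theta (u ^ 2 + w ^ 2) + 2 * w ^ 2 * theta1 (u ^ 2 + w ^ 2)) with
    (1 * theta (u ^ 2 + w ^ 2) + w * (2 * w * theta1 (u ^ 2 + w ^ 2))) by ring.
  apply (is_derive_mult (K := R_AbsRing) (fun w => w) (fun w => theta (u ^ 2 + w ^ 2)));
    [apply (is_derive_id (K := R_AbsRing))|exact H|apply Rmult_comm].
Qed.

Lemma is_derive_dkern_l u w :
  is_derive (fun u => dkern u w) u
    (2 * w * theta1 (u ^ 2 + w ^ 2) + 4 * u ^ 2 * w * theta2 (u ^ 2 + w ^ 2)).
Proof.
  unfold dkern.
  assert (H := is_derive_comp theta1 (fun u => u ^ 2 + w ^ 2) u _ (2 * u)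
     (is_derive_theta1 (u ^ 2 + w ^ 2)) ltac:(auto_derive; [trivial|ring])).
  unfold scal in H; simpl in H; unfold mult in H; simpl in H.
  replace (2 * w * theta1 (u ^ 2 + w ^ 2) + 4 * u ^ 2 * w * theta2 (u ^ 2 + w ^ 2)) with
    (2 * w * theta1 (u ^ 2 + w ^ 2) + 2 * u * w * (2 * u * theta2 (u ^ 2 + w ^ 2))) by ring.
  apply (is_derive_mult (K := R_AbsRing) (fun u => 2 * u * w) (fun u => theta1 (u ^ 2 + w ^ 2)));
    [auto_derive; [trivial|ring]|exact H|apply Rmult_comm].
Qed.

Lemma dkern_bound u w : Rabs (dkern u w) <= s * c0.
Proof.
  unfold dkern. set (r := u ^ 2 + w ^ 2). assert (Hr : 0 <= r) by (unfold r; nra).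
  pose proof (theta1_le r Hr). pose proof (rho_ge_id r). pose proof (Rabs_pos (theta1 r)).
  rewrite Rabs_mult.
  assert (Rabs (2 * u * w) <= r).
  { pose proof (pow2_ge_0 (u - w)). pose proof (pow2_ge_0 (u + w)).
    apply Rabs_le; unfold r; split; lra. }
  apply Rle_trans with (rho r * Rabs (theta1 r)); [|lra].
  apply Rmult_le_compat_r; lra.
Qed.

Lemma lip_of_bounded_derive (f df : R -> R) C :
  (forall t, is_derive f t (df t)) -> (forall t, Rabs (df t) <= C) ->
  forall p q, Rabs (f p - f q) <= C * Rabs (p - q).
Proof. intros Hf HC p q. apply (lip_of_derive f df C q p); auto. Qed.

Lemma kern_lip :
  exists Lam, 0 <= Lam /\
    forall u w u' w', Rabs (kern u w - kern u' w') <= Lam * (Rabs (u - u') + Rabs (w - w')).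
Proof.
  pose proof c0_pos. exists ((1 + 2 * s) * c0). split; [nra|]. intros u w u' w'.
  replace (kern u w - kern u' w') with ((kern u w - kern u' w) + (kern u' w - kern u' w')) by ring.
  eapply Rle_trans; [apply Rabs_triang|]. rewrite Rmult_plus_distr_l. apply Rplus_le_compat.
  - apply (lip_of_bounded_derive (fun u => kern u w) (fun u => dkern u w));
      [intros; apply is_derive_kern_l|].
    intros t. pose proof (dkern_bound t w). nra.
  - apply (lip_of_bounded_derive (fun w => kern u' w) (fun w =>
       theta (u' ^ 2 + w ^ 2) + 2 * w ^ 2 * theta1 (u' ^ 2 + w ^ 2)));
      [intros; apply is_derive_kern_r|].
    intros t. set (r := u' ^ 2 + t ^ 2). assert (Hr : 0 <= r) by (unfold r; nra).
    pose proof (theta1_le r Hr). pose proof (rho_ge_id r). pose proof (Rabs_pos (theta1 r)).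
    pose proof (theta_le r). pose proof (theta_pos r).
    eapply Rle_trans; [apply Rabs_triang|]. rewrite (Rabs_pos_eq (theta r)) by lra.
    rewrite Rabs_mult, (Rabs_pos_eq (2 * t ^ 2)) by nra.
    assert (t ^ 2 <= rho r) by (unfold r in *; nra).
    assert (t ^ 2 * Rabs (theta1 r) <= rho r * Rabs (theta1 r)) by (apply Rmult_le_compat_r; auto).
    lra.
Qed.

Lemma kern_taylor :
  exists C2, 0 <= C2 /\ forall w p q,
    Rabs (kern q w - kern p w - dkern p w * (q - p)) <= C2 * (q - p) ^ 2.
Proof.
  pose proof c0_pos as Hc0.
  set (C2 := (2 * (s * c0) + 4 * (s * (s + 4) * c0)) * (3 / a + 1)).
  assert (Ha3 : 0 < 3 / a) by (apply Rdiv_lt_0_compat; lra).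
  assert (Hc : 0 < s * c0) by nra. assert (Hc' : 0 < s * (s + 4) * c0) by (apply Rmult_lt_0_compat; nra).
  exists C2. split; [unfold C2; nra|]. intros w p q.
  apply (taylor_of_lip_derive (fun u => kern u w) (fun u => dkern u w)).
  - intros; apply is_derive_kern_l.
  - apply (lip_of_bounded_derive (fun u => dkern u w) _ C2 (fun u => is_derive_dkern_l u w)).
    intros t. set (r := t ^ 2 + w ^ 2). assert (Hr : 0 <= r) by (unfold r; nra).
    pose proof (rho_pos r) as Hp.
    pose proof (theta1_le r Hr) as H1. pose proof (theta2_le r Hr) as H2.
    pose proof (rho_ge_id r) as H3. pose proof (rho_ge r) as H4.
    pose proof (Rabs_pos (theta1 r)) as P1. pose proof (Rabs_pos (theta2 r)) as P2.
    (* A crude bound of a linear quantity by a quadratic one; its constant depends on [a], which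
       only affects [C2]. *)
    assert (Hw : Rabs w <= (3 / a + 1) * rho r).
    { assert (Hw1 : Rabs w <= 1 + r).
      { pose proof (pow2_ge_0 t). pose proof (pow2_ge_0 (w - 1)). pose proof (pow2_ge_0 (w + 1)).
        pose proof (pow2_ge_0 w). apply Rabs_le; unfold r; split; lra. }
      assert (1 <= 3 / a * rho r).
      { apply (Rmult_le_reg_l (a / 3)); [lra|]. replace (a / 3 * (3 / a * rho r)) with (rho r) by (field; lra).
        lra. }
      lra. }
    eapply Rle_trans; [apply Rabs_triang|]. rewrite !Rabs_mult.
    rewrite (Rabs_pos_eq 2), (Rabs_pos_eq 4), (Rabs_pos_eq (t ^ 2)) by (try lra; apply pow2_ge_0).
    assert (Ht : t ^ 2 <= rho r) by (unfold r in *; nra).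
    pose proof (Rabs_pos w) as P3. pose proof (pow2_ge_0 t) as P4.
    assert (Q1 : Rabs w * Rabs (theta1 r) <= (3 / a + 1) * (s * c0)).
    { apply Rle_trans with ((3 / a + 1) * rho r * Rabs (theta1 r)); [apply Rmult_le_compat_r; auto|].
      rewrite Rmult_assoc. apply Rmult_le_compat_l; lra. }
    assert (Q2 : t ^ 2 * Rabs w * Rabs (theta2 r) <= (3 / a + 1) * (s * (s + 4) * c0)).
    { apply Rle_trans with (rho r * ((3 / a + 1) * rho r) * Rabs (theta2 r)).
      - apply Rmult_le_compat_r; auto. apply Rmult_le_compat; auto.
      - replace (rho r * ((3 / a + 1) * rho r) * Rabs (theta2 r)) with
          ((3 / a + 1) * (Rabs (theta2 r) * rho r ^ 2)) by ring.
        apply Rmult_le_compat_l; lra. }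
    unfold C2. lra.
Qed.

Lemma kern_odd u w : kern (- u) (- w) = - kern u w.
Proof.
  unfold kern. replace ((- u) ^ 2 + (- w) ^ 2) with (u ^ 2 + w ^ 2) by ring. ring.
Qed.

Lemma kern_exact u w : a <= u ^ 2 + w ^ 2 -> kern u w = w * Rpower (u ^ 2 + w ^ 2) (- s).
Proof. intros H. unfold kern, theta. rewrite rho_eq; auto. Qed.

(** [Rabs w] is at most the square root of [rho]. The remaining exponent [/ 2 - s] is negative, so
    lower bounds of [rho] become upper bounds of the kernel. *)
Lemma kern_bound_rho u w : Rabs (kern u w) <= Rpower (rho (u ^ 2 + w ^ 2)) (/ 2 - s).
Proof.
  unfold kern. set (r := u ^ 2 + w ^ 2). pose proof (rho_pos r) as Hp.
  rewrite Rabs_mult, (Rabs_pos_eq (theta r)) by (left; apply theta_pos).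
  unfold Rminus. rewrite Rpower_plus. apply Rmult_le_compat_r; [left; apply theta_pos|].
  rewrite Rpower_sqrt by auto. rewrite <- sqrt_Rsqr_abs. apply sqrt_le_1_alt.
  pose proof (rho_ge_id r). unfold Rsqr. unfold r in *. nra.
Qed.

(** The bound does not involve [a]: this makes the confinement and the outer scale uniform in the
    regularization. *)
Lemma kern_bound_far b u w :
  0 < b -> b <= u ^ 2 + w ^ 2 -> Rabs (kern u w) <= Rpower b (/ 2 - s).
Proof.
  intros Hb H. eapply Rle_trans; [apply kern_bound_rho|].
  apply Rpower_antitone; auto; [|lra]. pose proof (rho_ge_id (u ^ 2 + w ^ 2)). lra.
Qed.

Lemma kern_bound u w : Rabs (kern u w) <= Rpower (a / 3) (/ 2 - s).
Proof.
  eapply Rle_trans; [apply kern_bound_rho|].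
  apply Rpower_antitone; [lra|apply rho_ge|lra].
Qed.

End Kernel.

(** * The regularized vortex field *)

Lemma even_odd_cases (i N : nat) :
  (i < 2 * N)%nat -> exists j, (j < N)%nat /\ (i = 2 * j \/ i = 2 * j + 1)%nat.
Proof.
  intros Hi. exists (Nat.div2 i). pose proof (Nat.div2_odd i) as H.
  destruct (Nat.odd i); simpl Nat.b2n in H; lia.
Qed.

Lemma div2_even j : Nat.div2 (2 * j) = j.
Proof. apply Nat.div2_double. Qed.

Lemma div2_odd j : Nat.div2 (2 * j + 1) = j.
Proof. replace (2 * j + 1)%nat with (S (2 * j)) by lia. apply Nat.div2_succ_double. Qed.

Lemma odd_even j : Nat.odd (2 * j) = false.
Proof. rewrite Nat.odd_mul; reflexivity. Qed.

Lemma odd_odd j : Nat.odd (2 * j + 1) = true.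
Proof. rewrite Nat.odd_add, Nat.odd_mul; reflexivity. Qed.

Section Vortices.
Variables (N : nat) (gamma : nat -> R) (s cc : R).
Hypothesis (Hs : / 2 < s).

Definition total_strength : R := rsum N (fun k => Rabs (gamma k)).

Lemma total_strength_pos : 0 <= total_strength.
Proof. apply rsum_pos; intros; apply Rabs_pos. Qed.

Definition others (j : nat) (f : nat -> R) : R :=
  rsum N (fun k => if Nat.eqb k j then 0 else gamma k * f k).

Lemma others_bound j f B : 0 <= B ->
  (forall k, (k < N)%nat -> k <> j -> Rabs (f k) <= B) ->
  Rabs (others j f) <= total_strength * B.
Proof.
  intros HB H. unfold others. eapply Rle_trans; [apply rsum_abs|].
  unfold total_strength. rewrite Rmult_comm, <- rsum_scal. apply rsum_le; intros k Hk.
  destruct (Nat.eqb_spec k j).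
  - rewrite Rabs_R0. apply Rmult_le_pos; auto. apply Rabs_pos.
  - rewrite Rabs_mult, Rmult_comm. apply Rmult_le_compat_r; [apply Rabs_pos|auto].
Qed.

Lemma others_minus j f g : others j f - others j g = others j (fun k => f k - g k).
Proof.
  unfold others. rewrite <- rsum_minus. apply rsum_ext; intros k Hk.
  destruct (Nat.eqb k j); ring.
Qed.

Lemma others_scal j c f : c * others j f = others j (fun k => c * f k).
Proof.
  unfold others. rewrite <- rsum_scal. apply rsum_ext; intros k Hk.
  destruct (Nat.eqb k j); ring.
Qed.

Lemma others_ext j f g : (forall k, (k < N)%nat -> k <> j -> f k = g k) -> others j f = others j g.
Proof.
  intros H. apply rsum_ext; intros k Hk.
  destruct (Nat.eqb_spec k j); auto. rewrite H; auto.
Qed.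

(** The components of the rotated gradient of the regularized Green function; [cc] will be
    [green_const m * (m - 2)]. *)
Definition vkern (a : R) (c : bool) (u w : R) : R :=
  if c then cc * kern a s w u else - cc * kern a s u w.

Definition dvkern (a : R) (c : bool) (u w : R) : R :=
  if c then cc * dkern a s w u else - cc * dkern a s u w.

(* Vortex [j] sits at [(x (2 * j), x (2 * j + 1))]. *)
Definition dx1 (x : nat -> R) (j k : nat) : R := x (2 * j)%nat - x (2 * k)%nat.
Definition dx2 (x : nat -> R) (j k : nat) : R := x (2 * j + 1)%nat - x (2 * k + 1)%nat.

(** The value 0 from [2 * N] on lets the bounds below hold for every index [i]. *)
Definition field (a : R) (i : nat) (x : nat -> R) : R :=
  if Compare_dec.lt_dec i (2 * N) then
    others (Nat.div2 i) (fun k => vkern a (Nat.odd i) (dx1 x (Nat.div2 i) k) (dx2 x (Nat.div2 i) k))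
  else 0.

Definition dfield (a : R) (i : nat) (x : nat -> R) : R :=
  if Compare_dec.lt_dec i (2 * N) then
    others (Nat.div2 i) (fun k => dvkern a (Nat.odd i) (dx1 x (Nat.div2 i) k) (dx2 x (Nat.div2 i) k))
  else 0.

Lemma field_index a c j x : (j < N)%nat ->
  field a (2 * j + (if c : bool then 1 else 0)) x = others j (fun k => vkern a c (dx1 x j k) (dx2 x j k)).
Proof.
  intros Hj. unfold field.
  destruct (Compare_dec.lt_dec (2 * j + (if c then 1 else 0)) (2 * N)) as [_|H]; [|destruct c; lia].
  destruct c.
  - rewrite div2_odd, odd_odd. reflexivity.
  - rewrite Nat.add_0_r, div2_even, odd_even. reflexivity.
Qed.

Lemma dfield_index a c j x : (j < N)%nat ->
  dfield a (2 * j + (if c : bool then 1 else 0)) x = others j (fun k => dvkern a c (dx1 x j k) (dx2 x j k)).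
Proof.
  intros Hj. unfold dfield.
  destruct (Compare_dec.lt_dec (2 * j + (if c then 1 else 0)) (2 * N)) as [_|H]; [|destruct c; lia].
  destruct c.
  - rewrite div2_odd, odd_odd. reflexivity.
  - rewrite Nat.add_0_r, div2_even, odd_even. reflexivity.
Qed.

Lemma index_cases i : (i < 2 * N)%nat ->
  exists j (c : bool), (j < N)%nat /\ i = (2 * j + (if c then 1 else 0))%nat.
Proof.
  intros Hi. destruct (even_odd_cases i N Hi) as [j [Hj [->| ->]]].
  - exists j; exists false. split; [auto|lia].
  - exists j; exists true. split; [auto|lia].
Qed.

Lemma vkern_abs a c u w B : (forall u w, Rabs (kern a s u w) <= B) ->
  Rabs (vkern a c u w) <= Rabs cc * B.
Proof.
  intros H. unfold vkern. destruct c; rewrite Rabs_mult, ?Rabs_Ropp;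
    apply Rmult_le_compat_l; auto; apply Rabs_pos.
Qed.

Section Regularized.
Variable (a : R).
Hypothesis (Ha : 0 < a).

Definition field_sup : R := total_strength * (Rabs cc * Rpower (a / 3) (/ 2 - s)).

Lemma field_bound i x : Rabs (field a i x) <= field_sup.
Proof.
  assert (HB : 0 <= Rabs cc * Rpower (a / 3) (/ 2 - s)).
  { apply Rmult_le_pos; [apply Rabs_pos|left; apply exp_pos]. }
  unfold field. destruct (Compare_dec.lt_dec i (2 * N)).
  - apply others_bound; auto. intros k Hk Hkj. apply vkern_abs. intros; apply kern_bound; auto.
  - rewrite Rabs_R0. apply Rmult_le_pos; auto. apply total_strength_pos.
Qed.

Lemma dfield_bound : exists D, forall i x, Rabs (dfield a i x) <= D.
Proof.
  set (B := Rabs cc * (s * Rpower (a / 3) (- s))).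
  assert (HB : 0 <= B).
  { apply Rmult_le_pos; [apply Rabs_pos|]. apply Rmult_le_pos; [lra|left; apply exp_pos]. }
  exists (total_strength * B). intros i x. unfold dfield.
  destruct (Compare_dec.lt_dec i (2 * N)).
  - apply others_bound; auto. intros k Hk Hkj. unfold dvkern.
    destruct (Nat.odd i); rewrite Rabs_mult, ?Rabs_Ropp; apply Rmult_le_compat_l;
      try apply Rabs_pos; apply dkern_bound; auto.
  - rewrite Rabs_R0. apply Rmult_le_pos; auto. apply total_strength_pos.
Qed.

Lemma dx1_lip x y j k : (j < N)%nat -> (k < N)%nat ->
  Rabs (dx1 x j k - dx1 y j k) <= 2 * dist (2 * N) x y.
Proof.
  intros Hj Hk. unfold dx1.
  replace (x (2 * j)%nat - x (2 * k)%nat - (y (2 * j)%nat - y (2 * k)%nat)) with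
    ((x (2 * j)%nat - y (2 * j)%nat) - (x (2 * k)%nat - y (2 * k)%nat)) by ring.
  eapply Rle_trans; [apply Rabs_triang|]. rewrite Rabs_Ropp.
  pose proof (dist_coord (2 * N) x y (2 * j) ltac:(lia)).
  pose proof (dist_coord (2 * N) x y (2 * k) ltac:(lia)). lra.
Qed.

Lemma dx2_lip x y j k : (j < N)%nat -> (k < N)%nat ->
  Rabs (dx2 x j k - dx2 y j k) <= 2 * dist (2 * N) x y.
Proof.
  intros Hj Hk. unfold dx2.
  replace (x (2 * j + 1)%nat - x (2 * k + 1)%nat - (y (2 * j + 1)%nat - y (2 * k + 1)%nat)) with
    ((x (2 * j + 1)%nat - y (2 * j + 1)%nat) - (x (2 * k + 1)%nat - y (2 * k + 1)%nat)) by ring.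
  eapply Rle_trans; [apply Rabs_triang|]. rewrite Rabs_Ropp.
  pose proof (dist_coord (2 * N) x y (2 * j + 1) ltac:(lia)).
  pose proof (dist_coord (2 * N) x y (2 * k + 1) ltac:(lia)). lra.
Qed.

Lemma field_lip : exists Lam, 0 <= Lam /\
  forall i x y, Rabs (field a i x - field a i y) <= Lam * dist (2 * N) x y.
Proof.
  destruct (kern_lip a s Ha Hs) as [L0 [HL0 HL]].
  pose proof (Rabs_pos cc) as Hcc. pose proof total_strength_pos as HG.
  exists (total_strength * (Rabs cc * (L0 * 4))). split.
  { apply Rmult_le_pos; auto. apply Rmult_le_pos; auto. lra. }
  intros i x y. pose proof (dist_pos (2 * N) x y) as Hd. unfold field.
  destruct (Compare_dec.lt_dec i (2 * N)) as [Hi|Hi].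
  - rewrite others_minus.
    replace (total_strength * (Rabs cc * (L0 * 4)) * dist (2 * N) x y) with
      (total_strength * (Rabs cc * (L0 * (4 * dist (2 * N) x y)))) by ring.
    destruct (even_odd_cases i N Hi) as [j [Hj Hij]].
    assert (Ej : Nat.div2 i = j) by (destruct Hij as [->| ->]; [apply div2_even|apply div2_odd]).
    rewrite Ej.
    apply others_bound.
    { repeat (apply Rmult_le_pos; auto); lra. }
    intros k Hk Hkj.
    pose proof (dx1_lip x y j k Hj Hk). pose proof (dx2_lip x y j k Hj Hk).
    unfold vkern. destruct (Nat.odd i); rewrite <- Rmult_minus_distr_l, Rabs_mult, ?Rabs_Ropp;
      (apply Rmult_le_compat_l; auto; eapply Rle_trans; [apply HL|apply Rmult_le_compat_l; auto; lra]).
  - rewrite Rminus_diag, Rabs_R0. repeat (apply Rmult_le_pos; auto); lra.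
Qed.

Lemma dx1_upd_even y j k t : k <> j -> dx1 (upd y (2 * j) t) j k = t - y (2 * k)%nat.
Proof. intros H. unfold dx1. rewrite upd_eq, upd_neq by lia. reflexivity. Qed.

Lemma dx2_upd_even y j k t : dx2 (upd y (2 * j) t) j k = dx2 y j k.
Proof. unfold dx2. rewrite !upd_neq by lia. reflexivity. Qed.

Lemma dx1_upd_odd y j k t : dx1 (upd y (2 * j + 1) t) j k = dx1 y j k.
Proof. unfold dx1. rewrite !upd_neq by lia. reflexivity. Qed.

Lemma dx2_upd_odd y j k t : k <> j -> dx2 (upd y (2 * j + 1) t) j k = t - y (2 * k + 1)%nat.
Proof. intros H. unfold dx2. rewrite upd_eq, upd_neq by lia. reflexivity. Qed.

Lemma field_taylor : exists C2, 0 <= C2 /\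
  forall i y p q, (i < 2 * N)%nat ->
    Rabs (field a i (upd y i q) - field a i (upd y i p) - dfield a i (upd y i p) * (q - p))
      <= C2 * (q - p) ^ 2.
Proof.
  destruct (kern_taylor a s Ha Hs) as [C [HC HCt]].
  pose proof (Rabs_pos cc) as Hcc. pose proof total_strength_pos as HG.
  exists (total_strength * (Rabs cc * C)). split.
  { repeat (apply Rmult_le_pos; auto). }
  intros i y p q Hi. destruct (index_cases i Hi) as [j [c [Hj ->]]].
  rewrite !field_index, dfield_index by auto.
  rewrite others_minus, Rmult_comm, others_scal, others_minus.
  replace (total_strength * (Rabs cc * C) * (q - p) ^ 2) with
    (total_strength * (Rabs cc * (C * (q - p) ^ 2))) by ring.
  assert (0 <= C * (q - p) ^ 2) by (apply Rmult_le_pos; auto; apply pow2_ge_0).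
  apply others_bound; [apply Rmult_le_pos; auto|]. intros k Hk Hkj.
  destruct c; unfold vkern, dvkern.
  - rewrite !dx1_upd_odd, !dx2_upd_odd by auto.
    specialize (HCt (dx1 y j k) (p - y (2 * k + 1)%nat) (q - y (2 * k + 1)%nat)).
    replace (q - y (2 * k + 1)%nat - (p - y (2 * k + 1)%nat)) with (q - p) in HCt by ring.
    match type of HCt with Rabs ?z <= _ =>
      match goal with |- Rabs ?g <= _ => replace g with (cc * z) by ring end end.
    rewrite Rabs_mult. apply Rmult_le_compat_l; auto.
  - rewrite !Nat.add_0_r. rewrite !dx1_upd_even, !dx2_upd_even by auto.
    specialize (HCt (dx2 y j k) (p - y (2 * k)%nat) (q - y (2 * k)%nat)).
    replace (q - y (2 * k)%nat - (p - y (2 * k)%nat)) with (q - p) in HCt by ring.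
    match type of HCt with Rabs ?z <= _ =>
      match goal with |- Rabs ?g <= _ => replace g with (- cc * z) by ring end end.
    rewrite Rabs_mult, Rabs_Ropp. apply Rmult_le_compat_l; auto.
Qed.

(** [dkern] is a mixed second derivative of a radial stream function. Its symmetry makes the two
    coordinates of each vortex cancel in the divergence. *)
Lemma dkern_sym u w : dkern a s u w = dkern a s w u.
Proof. unfold dkern. rewrite (Rplus_comm (w ^ 2)). ring. Qed.

Lemma dfield_div x : rsum (2 * N) (fun i => dfield a i x) = 0.
Proof.
  rewrite rsum_double. apply rsum_zero. intros j Hj.
  assert (E0 := dfield_index a false j x Hj). assert (E1 := dfield_index a true j x Hj).
  cbv iota in E0, E1. rewrite Nat.add_0_r in E0. rewrite E0, E1.
  replace (others j (fun k => dvkern a false (dx1 x j k) (dx2 x j k))) with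
    (-1 * others j (fun k => dvkern a true (dx1 x j k) (dx2 x j k))); [ring|].
  rewrite others_scal. apply others_ext. intros k Hk Hkj. unfold dvkern.
  rewrite (dkern_sym (dx2 x j k)). ring.
Qed.

End Regularized.

Section Confined.
Variables (g0 T : R).
Hypotheses (HT : 0 <= T) (Hg0 : 0 < g0).
Hypothesis (Hgam : forall J : nat -> bool, (exists j, (j < N)%nat /\ J j = true) ->
     g0 <= Rabs (rsum N (fun k => if J k then gamma k else 0))).

(** [C] is chosen before [a]. All vortices together form a subsystem with error 0, and the far bound
    at squared distance 1 is [1 ^ (/ 2 - s) = 1], so [kap = Rabs cc] serves every [a]. *)
Lemma flow_confined :
  exists C, 0 <= C /\ forall a X, 0 < a ->
    trajectory (2 * N) (field a) X ->
    forall i t, (i < 2 * N)%nat -> 0 <= t <= T -> Rabs (X t i - X 0 i) <= C.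
Proof.
  pose proof (Rabs_pos cc) as Hcc.
  destruct (displacement_bound_exists N gamma (Rabs cc) T g0 Hcc HT Hg0 Hgam N 0 (Rle_refl 0))
    as [C [HC Hdisp]].
  exists C. split; auto. intros a X Ha HX i t Hi Ht.
  destruct (index_cases i Hi) as [j [c [Hj ->]]].
  apply (Hdisp (vkern a) (fun _ => true) 0 t
    (fun c j t => X t (2 * j + (if c : bool then 1 else 0))%nat)
    (fun c j t => field a (2 * j + (if c : bool then 1 else 0)) (X t))); auto; try lra.
  - split.
    + intros c' u w. unfold vkern. destruct c'; rewrite kern_odd; ring.
    + intros c' u w Huw. unfold vkern.
      assert (Hr : 1 <= u ^ 2 + w ^ 2).
      { rewrite <- (pow2_abs u), <- (pow2_abs w).
        pose proof (Rabs_pos u). pose proof (Rabs_pos w). destruct Huw; nra. }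
      assert (Hone : Rpower 1 (/ 2 - s) = 1) by (unfold Rpower; rewrite ln_1, Rmult_0_r; apply exp_0).
      destruct c'; rewrite Rabs_mult, ?Rabs_Ropp; rewrite <- (Rmult_1_r (Rabs cc)) at 2;
        (apply Rmult_le_compat_l; [auto|rewrite <- Hone; apply kern_bound_far; auto; lra]).
  - apply cnt_le_N.
  - intros c' k r Hk _ Hr. split.
    + apply HX. destruct c'; lia.
    + rewrite field_index by auto. unfold interaction, others.
      rewrite Rabs_minus_sym.
      rewrite (rsum_ext N _ (fun l => if Nat.eqb l k then 0
         else gamma l * vkern a c' (dx1 (X r) k l) (dx2 (X r) k l))).
      * rewrite Rminus_diag, Rabs_R0. lra.
      * intros l Hl. simpl andb. destruct (Nat.eqb l k); simpl negb; cbv iota; auto.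
        unfold dx1, dx2. rewrite !Nat.add_0_r. reflexivity.
Qed.

End Confined.

End Vortices.

(** * Counting lattice points with close pairs *)

Lemma Rmax0_lip p q : Rabs (Rmax 0 p - Rmax 0 q) <= Rabs (p - q).
Proof. unfold Rmax, Rabs; destruct (Rle_dec 0 p), (Rle_dec 0 q); repeat destruct (Rcase_abs _); lra. Qed.

Lemma Rmin1_lip p q : Rabs (Rmin 1 p - Rmin 1 q) <= Rabs (p - q).
Proof. unfold Rmin, Rabs; destruct (Rle_dec 1 p), (Rle_dec 1 q); repeat destruct (Rcase_abs _); lra. Qed.

(** A plateau up to [b] with a ramp down to 0 at [2 * b]. The ramp makes it Lipschitz, as test
    functions for the flow must be; [ind] serves the count on the lattice. *)
Definition bump (b u : R) : R := Rmax 0 (Rmin 1 (2 - Rabs u / b)).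

Lemma bump_range b u : 0 <= bump b u <= 1.
Proof. unfold bump. split; [apply Rmax_l|apply Rmax_lub; [lra|apply Rmin_l]]. Qed.

Lemma bump_one b u : 0 < b -> Rabs u <= b -> bump b u = 1.
Proof.
  intros Hb Hu. unfold bump.
  assert (Rabs u / b <= 1).
  { apply (Rmult_le_reg_r b); auto. unfold Rdiv. rewrite Rmult_assoc, Rinv_l by lra. lra. }
  rewrite Rmin_left, Rmax_right; lra.
Qed.

Definition ind (r u : R) : R := if Rle_dec (Rabs u) r then 1 else 0.

Lemma ind_range r u : 0 <= ind r u <= 1.
Proof. unfold ind; destruct (Rle_dec (Rabs u) r); lra. Qed.

Lemma bump_le_ind b u : 0 < b -> bump b u <= ind (2 * b) u.
Proof.
  intros Hb. unfold ind. destruct (Rle_dec (Rabs u) (2 * b)) as [H|H]; [apply bump_range|].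
  unfold bump. assert (2 < Rabs u / b).
  { apply (Rmult_lt_reg_r b); auto. unfold Rdiv. rewrite Rmult_assoc, Rinv_l by lra. lra. }
  rewrite Rmin_right, Rmax_left; lra.
Qed.

Lemma bump_lip b u u' : 0 < b -> Rabs (bump b u - bump b u') <= / b * Rabs (u - u').
Proof.
  intros Hb. unfold bump. eapply Rle_trans; [apply Rmax0_lip|].
  eapply Rle_trans; [apply Rmin1_lip|].
  replace (2 - Rabs u / b - (2 - Rabs u' / b)) with (/ b * (Rabs u' - Rabs u)) by (field; lra).
  rewrite Rabs_mult, (Rabs_pos_eq (/ b)) by (left; apply Rinv_0_lt_compat; auto).
  apply Rmult_le_compat_l; [left; apply Rinv_0_lt_compat; auto|].
  rewrite (Rabs_minus_sym u). apply Rabs_triang_inv2.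
Qed.

(** The constants stay existential: they depend on [sigma] and enter only the discretization
    errors. *)
Definition bounded_lip (n : nat) (F : (nat -> R) -> R) : Prop :=
  exists B l, 0 <= B /\ 0 <= l /\ (forall x, Rabs (F x) <= B) /\
    (forall x y, Rabs (F x - F y) <= l * dist n x y).

Lemma bounded_lip_const n c : bounded_lip n (fun _ => c).
Proof.
  exists (Rabs c), 0. pose proof (Rabs_pos c). repeat split; auto; try lra.
  - intros; lra.
  - intros. rewrite Rminus_diag, Rabs_R0. lra.
Qed.

Lemma bounded_lip_plus n F G :
  bounded_lip n F -> bounded_lip n G -> bounded_lip n (fun x => F x + G x).
Proof.
  intros [B [l [HB [Hl [H1 H2]]]]] [B' [l' [HB' [Hl' [H1' H2']]]]].
  exists (B + B'), (l + l'). repeat split; try lra.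
  - intros x. eapply Rle_trans; [apply Rabs_triang|]. specialize (H1 x); specialize (H1' x); lra.
  - intros x y. replace (F x + G x - (F y + G y)) with ((F x - F y) + (G x - G y)) by ring.
    eapply Rle_trans; [apply Rabs_triang|]. specialize (H2 x y); specialize (H2' x y); lra.
Qed.

Lemma bounded_lip_mult n F G :
  bounded_lip n F -> bounded_lip n G -> bounded_lip n (fun x => F x * G x).
Proof.
  intros [B [l [HB [Hl [H1 H2]]]]] [B' [l' [HB' [Hl' [H1' H2']]]]].
  exists (B * B'), (l * B' + B * l').
  repeat split; try (apply Rmult_le_pos; auto).
  - apply Rplus_le_le_0_compat; apply Rmult_le_pos; auto.
  - intros x. rewrite Rabs_mult. apply Rmult_le_compat; auto; apply Rabs_pos.
  - intros x y. replace (F x * G x - F y * G y) with ((F x - F y) * G x + F y * (G x - G y)) by ring.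
    eapply Rle_trans; [apply Rabs_triang|]. rewrite !Rabs_mult.
    pose proof (dist_pos n x y).
    replace ((l * B' + B * l') * dist n x y) with ((l * dist n x y) * B' + B * (l' * dist n x y)) by ring.
    apply Rplus_le_compat; apply Rmult_le_compat; auto; apply Rabs_pos.
Qed.

Lemma bounded_lip_rsum n k (F : nat -> (nat -> R) -> R) :
  (forall i, (i < k)%nat -> bounded_lip n (F i)) ->
  bounded_lip n (fun x => rsum k (fun i => F i x)).
Proof.
  intros H; induction k as [|k IH]; simpl; [apply bounded_lip_const|].
  apply bounded_lip_plus; auto.
Qed.

(** Gives the densities compact support. It will equal 1 along the confined trajectories, so nothing
    is lost there. *)
Definition cutoff (n : nat) (L0 : R) (x : nat -> R) : R :=
  Rmax 0 (1 - rsum n (fun i => Rmax 0 (Rabs (x i) - (L0 - 1)))).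

Lemma cutoff_range n L0 x : 0 <= cutoff n L0 x <= 1.
Proof.
  unfold cutoff. split; [apply Rmax_l|]. apply Rmax_lub; [lra|].
  assert (0 <= rsum n (fun i => Rmax 0 (Rabs (x i) - (L0 - 1)))); [|lra].
  apply rsum_pos; intros; apply Rmax_l.
Qed.

Lemma cutoff_one n L0 x : (forall i, (i < n)%nat -> Rabs (x i) <= L0 - 1) -> cutoff n L0 x = 1.
Proof.
  intros H. unfold cutoff. rewrite rsum_zero.
  - rewrite Rminus_0_r. apply Rmax_right; lra.
  - intros i Hi. apply Rmax_left. specialize (H i Hi). lra.
Qed.

Lemma cutoff_zero n L0 x i : (i < n)%nat -> L0 <= Rabs (x i) -> cutoff n L0 x = 0.
Proof.
  intros Hi H. unfold cutoff. apply Rmax_left.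
  assert (1 <= rsum n (fun i => Rmax 0 (Rabs (x i) - (L0 - 1)))); [|lra].
  eapply Rle_trans; [|apply (rsum_term_le n (fun i => Rmax 0 (Rabs (x i) - (L0 - 1))) i); auto].
  - eapply Rle_trans; [|apply Rmax_r]. lra.
  - intros; apply Rmax_l.
Qed.

Lemma cutoff_bounded_lip n L0 : bounded_lip n (cutoff n L0).
Proof.
  exists 1, 1. repeat split; try lra.
  - intros x. pose proof (cutoff_range n L0 x). rewrite Rabs_pos_eq; lra.
  - intros x y. rewrite Rmult_1_l. unfold cutoff. eapply Rle_trans; [apply Rmax0_lip|].
    match goal with |- Rabs (1 - ?p - (1 - ?q)) <= _ => replace (1 - p - (1 - q)) with (q - p) by ring end.
    rewrite <- rsum_minus. eapply Rle_trans; [apply rsum_abs|].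
    apply rsum_le; intros i Hi. eapply Rle_trans; [apply Rmax0_lip|].
    replace (Rabs (y i) - (L0 - 1) - (Rabs (x i) - (L0 - 1))) with (Rabs (y i) - Rabs (x i)) by ring.
    rewrite (Rabs_minus_sym (x i)). apply Rabs_triang_inv2.
Qed.

Lemma bounded_lip_admissible n L0 F :
  bounded_lip n F -> exists B l, 0 <= l /\ admissible n (fun x => cutoff n L0 x * F x) B l L0.
Proof.
  intros HF. destruct (bounded_lip_mult n _ _ (cutoff_bounded_lip n L0) HF) as [B [l [HB [Hl [H1 H2]]]]].
  exists B, l. split; auto. split; [|split]; auto.
  intros x i Hi Hx. rewrite (cutoff_zero n L0 x i Hi Hx). ring.
Qed.

(** [E] lists the coordinates released from the box. The product does not depend on them, so a
    one-dimensional bound in such a coordinate can be factored out. *)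
Definition box_except (n : nat) (L0 : R) (E : list nat) (x : nat -> R) : R :=
  prodR n (fun i => if in_dec Nat.eq_dec i E then 1 else ind L0 (x i)).

Lemma prodR_ext n f g : (forall i, (i < n)%nat -> f i = g i) -> prodR n f = prodR n g.
Proof. induction n as [|n IH]; intros H; simpl; auto. rewrite IH, H; auto. Qed.

Lemma prodR_range n f : (forall i, (i < n)%nat -> 0 <= f i <= 1) -> 0 <= prodR n f <= 1.
Proof.
  induction n as [|n IH]; intros H; simpl; [lra|].
  assert (0 <= prodR n f <= 1) by (apply IH; auto). assert (0 <= f n <= 1) by auto. nra.
Qed.

Lemma box_except_range n L0 E x : 0 <= box_except n L0 E x <= 1.
Proof.
  apply prodR_range. intros i _. destruct (in_dec Nat.eq_dec i E); [lra|apply ind_range].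
Qed.

Lemma box_except_indep n L0 E x i t : In i E -> box_except n L0 E (upd x i t) = box_except n L0 E x.
Proof.
  intros Hi. apply prodR_ext. intros j Hj. destruct (in_dec Nat.eq_dec j E) as [|Hn]; auto.
  rewrite upd_neq; auto. intros ->; auto.
Qed.

Lemma box_except_pull n L0 E x i :
  (i < n)%nat -> ~ In i E ->
  box_except n L0 E x = ind L0 (x i) * box_except n L0 (i :: E) x.
Proof.
  unfold box_except. intros Hi HE. induction n as [|n IH]; [lia|]. cbn [prodR].
  destruct (Nat.eq_dec i n) as [->|Hne].
  - destruct (in_dec Nat.eq_dec n E); [contradiction|].
    destruct (in_dec Nat.eq_dec n (n :: E)) as [_|H]; [|exfalso; apply H; left; auto].
    rewrite (prodR_ext n (fun i => if in_dec Nat.eq_dec i E then 1 else ind L0 (x i))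
      (fun i => if in_dec Nat.eq_dec i (n :: E) then 1 else ind L0 (x i))); [ring|].
    intros j Hj. destruct (in_dec Nat.eq_dec j E), (in_dec Nat.eq_dec j (n :: E)) as [i1|i1]; auto.
    + exfalso; apply i1; right; auto.
    + destruct i1; [lia|contradiction].
  - rewrite IH by lia. rewrite Rmult_assoc. f_equal. f_equal.
    destruct (in_dec Nat.eq_dec n E), (in_dec Nat.eq_dec n (i :: E)) as [i1|i1]; auto.
    + exfalso; apply i1; right; auto.
    + destruct i1; [lia|contradiction].
Qed.

Lemma cutoff_le_box n L0 x : cutoff n L0 x <= box_except n L0 nil x.
Proof.
  destruct (classic (exists i, (i < n)%nat /\ L0 <= Rabs (x i))) as [[i [Hi H]]|H].
  - rewrite (cutoff_zero n L0 x i) by auto. apply box_except_range.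
  - eapply Rle_trans; [apply cutoff_range|]. right.
    unfold box_except. clear - H. induction n as [|n IH]; cbn [prodR]; auto.
    rewrite <- IH.
    + destruct (in_dec Nat.eq_dec n nil) as [[]|_]. unfold ind. destruct (Rle_dec (Rabs (x n)) L0) as [|Hn]; [ring|].
      exfalso; apply H; exists n; split; [lia|lra].
    + intros [i [Hi Hx]]; apply H; exists i; split; [lia|auto].
Qed.

Section Counting.
Variables (L : R) (M n : nat) (L0 : R).
Hypotheses (HL : 0 < L) (HM : (0 < M)%nat) (HL0 : 1 <= L0) (HL0L : L0 <= L).
Let delta := 2 * L / INR M.
Hypothesis (Hdelta1 : delta <= 1).

Lemma cell_pos : 0 < delta.
Proof. apply mesh_pos; auto. Qed.

(** The clamp [cl] to the interval from [c - r] to [c + r + delta] grows by a full [delta] over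
    every cell whose left end is within [r] of [c], and it telescopes to at most the length of that
    interval. *)
Lemma lsum_near c r : 0 <= r -> lsum L M (fun t => ind r (t - c)) <= 2 * r + delta.
Proof.
  intros Hr. pose proof cell_pos as Hd. unfold lsum. fold delta. rewrite <- rsum_scal.
  set (cl := fun t => Rmin (Rmax t (c - r)) (c + r + delta)).
  apply Rle_trans with (rsum M (fun k => cl (pt L M (S k)) - cl (pt L M k))).
  - apply rsum_le; intros k Hk. rewrite pt_S. fold delta. set (p := pt L M k).
    unfold ind, cl, Rmin, Rmax.
    destruct (Rle_dec (Rabs (p - c)) r) as [H|H].
    + apply Rabs_le_between in H.
      destruct (Rle_dec (p + delta) (c - r)), (Rle_dec p (c - r));
        repeat destruct (Rle_dec _ (c + r + delta)); lra.
    + destruct (Rle_dec (p + delta) (c - r)), (Rle_dec p (c - r));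
        repeat destruct (Rle_dec _ (c + r + delta)); lra.
  - rewrite (rsum_telescope M (fun k => cl (pt L M k))).
    unfold cl, Rmin, Rmax. repeat destruct (Rle_dec _ _); lra.
Qed.

(** The clamp to the interval from [- L0 + delta] to [L0] grows only over cells counted by [ind];
    its total [2 * L0 - delta] is at least [L0], as [delta <= 1 <= L0]. *)
Lemma lsum_box : L0 <= lsum L M (fun t => ind L0 t).
Proof.
  pose proof cell_pos as Hd. unfold lsum. fold delta. rewrite <- rsum_scal.
  set (cl := fun t => Rmin (Rmax t (- L0 + delta)) L0).
  apply Rle_trans with (rsum M (fun k => cl (pt L M (S k)) - cl (pt L M k))).
  - rewrite (rsum_telescope M (fun k => cl (pt L M k))), pt_M, pt_0 by auto.
    unfold cl, Rmin, Rmax. repeat destruct (Rle_dec _ _); lra.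
  - apply rsum_le; intros k Hk. rewrite pt_S. fold delta. set (p := pt L M k).
    unfold ind, cl, Rmin, Rmax.
    destruct (Rle_dec (Rabs p) L0) as [H|H].
    + apply Rabs_le_between in H.
      destruct (Rle_dec (p + delta) (- L0 + delta)), (Rle_dec p (- L0 + delta));
        repeat destruct (Rle_dec _ L0); lra.
    + assert (p < - L0 \/ L0 < p).
      { apply Rnot_le_lt in H. unfold Rabs in H. destruct (Rcase_abs p); lra. }
      destruct (Rle_dec (p + delta) (- L0 + delta)), (Rle_dec p (- L0 + delta));
        repeat destruct (Rle_dec _ L0); lra.
Qed.

Lemma lint_factor i f g rest e z :
  (i < n)%nat -> (forall x, 0 <= rest x) -> (forall x t, rest (upd x i t) = rest x) ->
  (forall y, lsum L M (fun t => f (upd y i t)) <= e * lsum L M (fun t => g (upd y i t))) ->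
  lint L M n (fun x => f x * rest x) z <= e * lint L M n (fun x => g x * rest x) z.
Proof.
  intros Hi H0 Hrest H. rewrite <- lint_scal.
  apply lint_coord_le with i; auto. intros y.
  rewrite (lsum_ext L M _ (fun t => rest y * f (upd y i t))) by (intros; rewrite Hrest; ring).
  rewrite (lsum_ext L M (fun t => e * (g (upd y i t) * rest (upd y i t)))
             (fun t => rest y * (e * g (upd y i t)))) by (intros; rewrite Hrest; ring).
  rewrite !lsum_scal. apply Rmult_le_compat_l; auto.
Qed.

(** In the [i]-th variable the nodes near [c] have total weight at most [2 * r + delta], while
    [ind L0] sums to at least 1. The first factor is traded for the second, which puts the
    coordinate [i] back into the box. *)
Lemma lint_near i (c : (nat -> R) -> R) rest E r z :
  (i < n)%nat -> In i E -> 0 <= r ->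
  (forall x t, c (upd x i t) = c x) ->
  (forall x, 0 <= rest x) -> (forall x t, rest (upd x i t) = rest x) ->
  (forall j, In j E -> (j < n)%nat) -> NoDup E ->
  forall E', E = i :: E' ->
  lint L M n (fun x => ind r (x i - c x) * (rest x * box_except n L0 E x)) z
   <= (2 * r + delta) * lint L M n (fun x => rest x * box_except n L0 E' x) z.
Proof.
  intros Hi HiE Hr Hc Hrest0 Hrest HE Hnd E' ->.
  pose proof cell_pos as Hd.
  eapply Rle_trans.
  - apply (lint_factor i (fun x => ind r (x i - c x)) (fun x => ind L0 (x i))
       (fun x => rest x * box_except n L0 (i :: E') x) (2 * r + delta)); auto.
    + intros x. apply Rmult_le_pos; auto. apply box_except_range.
    + intros x t. rewrite Hrest, box_except_indep; auto.
    + intros y. rewrite (lsum_ext L M _ (fun t => ind r (t - c y)))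
        by (intros; rewrite upd_eq, Hc; reflexivity).
      rewrite (lsum_ext L M (fun t => ind L0 (upd y i t i)) (fun t => ind L0 t))
        by (intros; rewrite upd_eq; reflexivity).
      pose proof (lsum_near (c y) r Hr). pose proof lsum_box. nra.
  - apply Rmult_le_compat_l; [lra|]. right. apply lint_ext; auto. intros y.
    rewrite (box_except_pull n L0 E' y i); auto.
    + ring.
    + inversion Hnd; auto.
Qed.

(** Coordinates leave the box one at a time, each for a factor [e]; what remains is the whole
    lattice cube, whose volume [(2 * L) ^ n] cancels the denominators of [e ^ n]. *)
Lemma lint_box_le z : lint L M n (box_except n L0 nil) z <= (2 * L0 + 1) ^ n.
Proof.
  pose proof cell_pos as Hd.
  set (down := fix down k := match k with O => nil | S k => k :: down k end).
  assert (Hin : forall k j, In j (down k) -> (j < k)%nat).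
  { induction k as [|k IH]; simpl; intros j; [tauto|]. intros [<-|H]; [lia|]. apply IH in H. lia. }
  set (e := (2 * L0 + delta) / (2 * L)).
  assert (He : 0 <= e) by (apply Rdiv_le_0_compat; lra).
  assert (H : forall k, (k <= n)%nat ->
     lint L M n (box_except n L0 nil) z <= e ^ k * lint L M n (box_except n L0 (down k)) z).
  { induction k as [|k IH]; intros Hk; [simpl; lra|].
    eapply Rle_trans; [apply IH; lia|]. rewrite <- tech_pow_Rmult, (Rmult_comm e), Rmult_assoc.
    apply Rmult_le_compat_l; [apply pow_le; auto|].
    rewrite (lint_ext L M HL HM n (box_except n L0 (down k))
      (fun x => ind L0 (x k) * box_except n L0 (down (S k)) x)).
    2:{ intros y. apply box_except_pull; [lia|]. intros Hk'. apply Hin in Hk'. lia. }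
    rewrite (lint_ext L M HL HM n (box_except n L0 (down (S k)))
      (fun x => 1 * box_except n L0 (down (S k)) x)) by (intros; ring).
    apply (lint_factor k (fun x => ind L0 (x k)) (fun _ => 1)); [lia| | |].
    - intros x; apply box_except_range.
    - intros x t. apply box_except_indep. simpl; auto.
    - intros y. rewrite (lsum_ext L M _ (fun t => ind L0 (t - 0)))
        by (intros; rewrite upd_eq, Rminus_0_r; reflexivity).
      rewrite lsum_const by auto.
      replace (e * (2 * L * 1)) with (2 * L0 + delta) by (unfold e; field; lra).
      apply lsum_near; lra. }
  eapply Rle_trans; [apply (H n (le_n n))|].
  apply Rle_trans with (e ^ n * (2 * L) ^ n).
  - apply Rmult_le_compat_l; [apply pow_le; auto|].
    rewrite <- (Rmult_1_r ((2 * L) ^ n)), <- (lint_const L M HM n 1 z).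
    apply lint_le; auto. intros; apply box_except_range.
  - rewrite <- Rpow_mult_distr. apply pow_incr.
    replace (e * (2 * L)) with (2 * L0 + delta) by (unfold e; field; lra). lra.
Qed.

End Counting.

Definition near_pair (b : R) (x : nat -> R) (j k : nat) : R :=
  bump b (dx1 x j k) * bump b (dx2 x j k).

Lemma near_pair_range b x j k : 0 <= near_pair b x j k <= 1.
Proof.
  unfold near_pair. pose proof (bump_range b (dx1 x j k)). pose proof (bump_range b (dx2 x j k)). nra.
Qed.

Lemma near_pair_sym b x j k : near_pair b x j k = near_pair b x k j.
Proof.
  unfold near_pair, bump, dx1, dx2.
  rewrite (Rabs_minus_sym (x (2 * j)%nat)), (Rabs_minus_sym (x (2 * j + 1)%nat)). reflexivity.
Qed.

Lemma near_pair_indep b x j k i t :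
  i <> (2 * j)%nat -> i <> (2 * j + 1)%nat -> i <> (2 * k)%nat -> i <> (2 * k + 1)%nat ->
  near_pair b (upd x i t) j k = near_pair b x j k.
Proof. intros. unfold near_pair, dx1, dx2. rewrite !upd_neq by auto. reflexivity. Qed.

Lemma near_pair_bounded_lip N b j k : 0 < b -> (j < N)%nat -> (k < N)%nat ->
  bounded_lip (2 * N) (fun x => near_pair b x j k).
Proof.
  intros Hb Hj Hk. assert (Hib : 0 < / b) by (apply Rinv_0_lt_compat; auto).
  assert (H : forall f : (nat -> R) -> R,
    (forall x y, Rabs (f x - f y) <= 2 * dist (2 * N) x y) ->
    bounded_lip (2 * N) (fun x => bump b (f x))).
  { intros f Hf. exists 1, (/ b * 2). repeat split; try lra.
    - intros x. pose proof (bump_range b (f x)). rewrite Rabs_pos_eq; lra.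
    - intros x y. eapply Rle_trans; [apply bump_lip; auto|]. rewrite Rmult_assoc.
      apply Rmult_le_compat_l; [lra|auto]. }
  apply bounded_lip_mult; apply H; intros x y; [apply dx1_lip|apply dx2_lip]; auto.
Qed.

Section Lattice.
Variables (N : nat) (L : R) (M : nat) (L0 : R).
Hypotheses (HL : 0 < L) (HM : (0 < M)%nat) (HL0 : 1 <= L0) (HL0L : L0 <= L).
Let n := (2 * N)%nat.
Let delta := 2 * L / INR M.
Hypothesis (Hdelta1 : delta <= 1).

(** Vortex [j] is summed with vortex [k] held fixed. As [bump b] vanishes beyond [2 * b], each
    coordinate contributes [2 * (2 * b) + delta]. *)
Lemma lint_near_pair b j k rest E z :
  0 < b -> (j < N)%nat -> (k < N)%nat -> j <> k ->
  (forall x, 0 <= rest x) ->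
  (forall x t, rest (upd x (2 * j) t) = rest x) ->
  (forall x t, rest (upd x (2 * j + 1) t) = rest x) ->
  (forall i, In i E -> (i < n)%nat) ->
  NoDup (2 * j :: (2 * j + 1) :: E)%nat ->
  lint L M n (fun x => near_pair b x j k * (rest x * box_except n L0 (2 * j :: (2 * j + 1) :: E)%nat x)) z
  <= (4 * b + delta) ^ 2 * lint L M n (fun x => rest x * box_except n L0 E x) z.
Proof.
  intros Hb Hj Hk Hjk Hr0 Hr1 Hr2 HE Hnd.
  pose proof (cell_pos L M HL HM) as Hd. fold delta in Hd.
  assert (Hn1 : (2 * j < n)%nat) by (unfold n; lia).
  assert (Hn2 : (2 * j + 1 < n)%nat) by (unfold n; lia).
  inversion Hnd as [|? ? Hni Hnd']; subst.
  apply Rle_trans with (lint L M n (fun x => ind (2 * b) (x (2 * j)%nat - x (2 * k)%nat) *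
     ((ind (2 * b) (x (2 * j + 1)%nat - x (2 * k + 1)%nat) * rest x) *
      box_except n L0 (2 * j :: (2 * j + 1) :: E)%nat x)) z).
  { apply lint_le; auto. intros y.
    assert (Hp : 0 <= rest y * box_except n L0 (2 * j :: (2 * j + 1) :: E)%nat y).
    { apply Rmult_le_pos; auto. apply box_except_range. }
    apply Rle_trans with (ind (2 * b) (y (2 * j)%nat - y (2 * k)%nat) *
       ind (2 * b) (y (2 * j + 1)%nat - y (2 * k + 1)%nat) *
       (rest y * box_except n L0 (2 * j :: (2 * j + 1) :: E)%nat y)); [|right; ring].
    apply Rmult_le_compat_r; auto. unfold near_pair, dx1, dx2.
    apply Rmult_le_compat; try apply bump_range; apply bump_le_ind; auto. }
  eapply Rle_trans.
  { apply (lint_near L M n L0 HL HM HL0 HL0L Hdelta1 (2 * j)%nat (fun x => x (2 * k)%nat)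
      (fun x => ind (2 * b) (x (2 * j + 1)%nat - x (2 * k + 1)%nat) * rest x)
      (2 * j :: (2 * j + 1) :: E)%nat (2 * b) z) with (E' := ((2 * j + 1) :: E)%nat); auto.
    - left; auto.
    - lra.
    - intros x t. apply upd_neq. lia.
    - intros x. apply Rmult_le_pos; auto. apply ind_range.
    - intros x t. rewrite !upd_neq, Hr1 by lia. reflexivity.
    - intros i [<-|[<-|Hi]]; auto. }
  fold delta. replace ((4 * b + delta) ^ 2) with ((2 * (2 * b) + delta) * (2 * (2 * b) + delta)) by ring.
  rewrite Rmult_assoc. apply Rmult_le_compat_l; [lra|].
  rewrite (lint_ext L M HL HM n _ (fun x => ind (2 * b) (x (2 * j + 1)%nat - x (2 * k + 1)%nat) *
      (rest x * box_except n L0 ((2 * j + 1) :: E)%nat x))) by (intros; ring).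
  apply (lint_near L M n L0 HL HM HL0 HL0L Hdelta1 (2 * j + 1)%nat (fun x => x (2 * k + 1)%nat)
      rest ((2 * j + 1) :: E)%nat (2 * b) z) with (E' := E); auto.
  - left; auto.
  - lra.
  - intros x t. apply upd_neq. lia.
  - intros i [<-|Hi]; auto.
Qed.

Lemma box_except_mono E x i : (i < n)%nat -> ~ In i E ->
  box_except n L0 E x <= box_except n L0 (i :: E) x.
Proof.
  intros Hi HE. rewrite (box_except_pull n L0 E x i) by auto.
  pose proof (ind_range L0 (x i)). pose proof (box_except_range n L0 (i :: E) x). nra.
Qed.

Lemma lint_pair b j k z :
  0 < b -> (j < N)%nat -> (k < N)%nat -> j <> k ->
  lint L M n (fun x => cutoff n L0 x * near_pair b x j k) z
   <= (4 * b + delta) ^ 2 * (2 * L0 + 1) ^ n.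
Proof.
  intros Hb Hj Hk Hjk.
  apply Rle_trans with (lint L M n (fun x => near_pair b x j k *
     (1 * box_except n L0 (2 * j :: (2 * j + 1) :: nil)%nat x)) z).
  - apply lint_le; auto. intros y. rewrite Rmult_1_l, Rmult_comm.
    apply Rmult_le_compat_l; [apply near_pair_range|].
    eapply Rle_trans; [apply cutoff_le_box|].
    eapply Rle_trans; [apply (box_except_mono _ y (2 * j + 1)%nat); [unfold n; lia|auto]|].
    apply box_except_mono; [unfold n; lia|]. intros [H|[]]. lia.
  - eapply Rle_trans; [apply (lint_near_pair b j k (fun _ => 1) nil z); auto|].
    + intros; lra.
    + intros i [].
    + constructor; [|constructor; [auto|constructor]]. intros [H|[]]. lia.
    + apply Rmult_le_compat_l; [apply pow2_ge_0|].
      rewrite (lint_ext L M HL HM n _ (box_except n L0 nil)) by (intros; ring).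
      apply lint_box_le; auto.
Qed.

(** The third vortex [l] is summed first around [j], because the closeness of [j] and [k] does not
    involve it; then [j] is summed around [k]. *)
Lemma lint_triple b b' j k l z :
  0 < b -> 0 < b' -> (j < N)%nat -> (k < N)%nat -> (l < N)%nat -> j <> k -> l <> j -> l <> k ->
  lint L M n (fun x => cutoff n L0 x * (near_pair b x j k * near_pair b' x j l)) z
   <= (4 * b' + delta) ^ 2 * ((4 * b + delta) ^ 2 * (2 * L0 + 1) ^ n).
Proof.
  intros Hb Hb' Hj Hk Hl Hjk Hlj Hlk.
  apply Rle_trans with (lint L M n (fun x => near_pair b' x l j *
     (near_pair b x j k * box_except n L0 (2 * l :: (2 * l + 1) :: (2 * j :: (2 * j + 1) :: nil))%nat x)) z).
  - apply lint_le; auto. intros y. rewrite (near_pair_sym b' y l j).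
    rewrite Rmult_comm, (Rmult_comm (near_pair b y j k)), Rmult_assoc.
    apply Rmult_le_compat_l; [apply near_pair_range|].
    apply Rmult_le_compat_l; [apply near_pair_range|].
    eapply Rle_trans; [apply cutoff_le_box|].
    eapply Rle_trans; [apply (box_except_mono _ y (2 * j + 1)%nat); [unfold n; lia|auto]|].
    eapply Rle_trans; [apply (box_except_mono _ y (2 * j)%nat); [unfold n; lia|intros [H|[]]; lia]|].
    eapply Rle_trans; [apply (box_except_mono _ y (2 * l + 1)%nat);
      [unfold n; lia|intros [H|[H|[]]]; lia]|].
    apply box_except_mono; [unfold n; lia|]. intros [H|[H|[H|[]]]]; lia.
  - eapply Rle_trans; [apply (lint_near_pair b' l j (fun x => near_pair b x j k)
        (2 * j :: (2 * j + 1) :: nil)%nat z); auto|].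
    + intros; apply near_pair_range.
    + intros; apply near_pair_indep; lia.
    + intros; apply near_pair_indep; lia.
    + intros i [<-|[<-|[]]]; unfold n; lia.
    + repeat constructor; simpl; intros H; repeat destruct H as [H|H]; lia.
    + apply Rmult_le_compat_l; [apply pow2_ge_0|].
      rewrite (lint_ext L M HL HM n _ (fun x => near_pair b x j k *
         (1 * box_except n L0 (2 * j :: (2 * j + 1) :: nil)%nat x))) by (intros; ring).
      eapply Rle_trans; [apply (lint_near_pair b j k (fun _ => 1) nil z); auto|].
      * intros; lra.
      * intros i [].
      * constructor; [|constructor; [auto|constructor]]. intros [H|[]]. lia.
      * apply Rmult_le_compat_l; [apply pow2_ge_0|].
        rewrite (lint_ext L M HL HM n _ (box_except n L0 nil)) by (intros; ring).
        apply lint_box_le; auto.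
Qed.

Lemma lint_rsum_le k (F : nat -> (nat -> R) -> R) c z :
  (forall i, (i < k)%nat -> lint L M n (F i) z <= c i) ->
  lint L M n (fun x => rsum k (fun i => F i x)) z <= rsum k c.
Proof. intros H. rewrite lint_rsum by auto. apply rsum_le; auto. Qed.

End Lattice.

(** * Densities for close pairs and for their rate of approach *)

Section Densities.
Variables (N : nat) (gamma : nat -> R) (cc sigma q : R).

(** The bracket adds the two-scale kernel bounds of [kern_two_scale] for the influence of [l] on [j]
    and on [k]. The width [2 * sigma ^ 2] is the distance beyond which [closeness] vanishes. *)
Definition rate_term (x : nat -> R) (j k l : nat) : R :=
  Rabs (gamma l) * (near_pair (2 * sigma ^ 2) x j k *
    (2 * q + 3 * q ^ 2 * (near_pair sigma x j l + near_pair sigma x k l))).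

(* Dominates the rate at which a close pair [j], [k] can approach: the mutual term drops out,
   and a third vortex [l] contributes its regularized velocity. *)
Definition approach_rate (x : nat -> R) : R :=
  64 * Rabs cc / sigma ^ 2 *
  rsum N (fun j => rsum N (fun k => if Nat.eqb k j then 0 else
    rsum N (fun l => if Nat.eqb l j || Nat.eqb l k then 0 else rate_term x j k l))).

(** 16 is the largest value of [closeness]. *)
Definition initial_closeness (x : nat -> R) : R :=
  rsum N (fun j => rsum N (fun k => if Nat.eqb k j then 0 else 16 * near_pair (2 * sigma ^ 2) x j k)).

Hypotheses (Hsigma : 0 < sigma) (Hq : 1 <= q).

Lemma sigma2_pos : 0 < sigma ^ 2.
Proof. nra. Qed.

Lemma approach_rate_bounded_lip : bounded_lip (2 * N) approach_rate.
Proof.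
  pose proof sigma2_pos.
  apply (bounded_lip_mult (2 * N) (fun _ => 64 * Rabs cc / sigma ^ 2)); [apply bounded_lip_const|].
  apply bounded_lip_rsum; intros j Hj. apply bounded_lip_rsum; intros k Hk.
  destruct (Nat.eqb k j); [apply bounded_lip_const|].
  apply bounded_lip_rsum; intros l Hl.
  destruct (Nat.eqb l j || Nat.eqb l k); [apply bounded_lip_const|].
  unfold rate_term. apply bounded_lip_mult; [apply bounded_lip_const|].
  apply bounded_lip_mult; [apply near_pair_bounded_lip; auto; lra|].
  apply bounded_lip_plus; [apply bounded_lip_const|].
  apply bounded_lip_mult; [apply bounded_lip_const|].
  apply bounded_lip_plus; apply near_pair_bounded_lip; auto.
Qed.

Lemma initial_closeness_bounded_lip : bounded_lip (2 * N) initial_closeness.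
Proof.
  pose proof sigma2_pos.
  apply bounded_lip_rsum; intros j Hj. apply bounded_lip_rsum; intros k Hk.
  destruct (Nat.eqb k j); [apply bounded_lip_const|].
  apply bounded_lip_mult; [apply bounded_lip_const|].
  apply near_pair_bounded_lip; auto; lra.
Qed.

Lemma rate_term_pos x j k l : 0 <= rate_term x j k l.
Proof.
  unfold rate_term.
  apply Rmult_le_pos; [apply Rabs_pos|]. apply Rmult_le_pos; [apply near_pair_range|].
  pose proof (near_pair_range sigma x j l). pose proof (near_pair_range sigma x k l).
  pose proof (pow2_ge_0 q). nra.
Qed.

Lemma approach_rate_pos x : 0 <= approach_rate x.
Proof.
  unfold approach_rate. apply Rmult_le_pos.
  - apply Rdiv_le_0_compat; [|apply sigma2_pos]. pose proof (Rabs_pos cc); lra.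
  - apply rsum_pos; intros j _. apply rsum_pos; intros k _.
    destruct (Nat.eqb k j); [lra|]. apply rsum_pos; intros l _.
    destruct (Nat.eqb l j || Nat.eqb l k); [lra|]. apply rate_term_pos.
Qed.

Lemma approach_rate_ge x j k : (j < N)%nat -> (k < N)%nat -> j <> k ->
  64 * Rabs cc / sigma ^ 2 * rsum N (fun l => if Nat.eqb l j || Nat.eqb l k then 0 else rate_term x j k l)
  <= approach_rate x.
Proof.
  intros Hj Hk Hjk. unfold approach_rate. apply Rmult_le_compat_l.
  - apply Rdiv_le_0_compat; [|apply sigma2_pos]. pose proof (Rabs_pos cc); lra.
  - set (f := fun j k => if Nat.eqb k j then 0 else
       rsum N (fun l => if Nat.eqb l j || Nat.eqb l k then 0 else rate_term x j k l)).
    assert (Hf : forall j k, 0 <= f j k).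
    { intros j' k'. unfold f. destruct (Nat.eqb k' j'); [lra|]. apply rsum_pos; intros l _.
      destruct (Nat.eqb l j' || Nat.eqb l k'); [lra|]. apply rate_term_pos. }
    apply Rle_trans with (f j k).
    + right. unfold f. destruct (Nat.eqb_spec k j); [congruence|reflexivity].
    + eapply Rle_trans; [apply (rsum_term_le N (f j) k); auto|].
      apply (rsum_term_le N (fun j => rsum N (f j)) j); auto.
      intros; apply rsum_pos; auto.
Qed.

Lemma initial_closeness_ge x j k : (j < N)%nat -> (k < N)%nat -> j <> k ->
  16 * near_pair (2 * sigma ^ 2) x j k <= initial_closeness x.
Proof.
  intros Hj Hk Hjk. unfold initial_closeness.
  set (f := fun j k => if Nat.eqb k j then 0 else 16 * near_pair (2 * sigma ^ 2) x j k).
  assert (Hf : forall j k, 0 <= f j k).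
  { intros j' k'. unfold f. destruct (Nat.eqb k' j'); [lra|].
    pose proof (near_pair_range (2 * sigma ^ 2) x j' k'). lra. }
  apply Rle_trans with (f j k).
  - right. unfold f. destruct (Nat.eqb_spec k j); [congruence|reflexivity].
  - eapply Rle_trans; [apply (rsum_term_le N (f j) k); auto|].
    apply (rsum_term_le N (fun j => rsum N (f j)) j); auto.
    intros; apply rsum_pos; auto.
Qed.

Lemma initial_closeness_pos x : 0 <= initial_closeness x.
Proof.
  apply rsum_pos; intros j _. apply rsum_pos; intros k _.
  destruct (Nat.eqb k j); [lra|]. pose proof (near_pair_range (2 * sigma ^ 2) x j k). lra.
Qed.

Section Integrals.
Variables (L : R) (M : nat) (L0 : R).
Hypotheses (HL : 0 < L) (HM : (0 < M)%nat) (HL0 : 1 <= L0) (HL0L : L0 <= L).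
Hypotheses (Hsigma1 : sigma <= 1) (Hdelta : 2 * L / INR M <= sigma ^ 2).
Hypothesis (Hy : sigma ^ 2 * q <= 1).

Let delta := 2 * L / INR M.
Let vol := (2 * L0 + 1) ^ (2 * N).

Lemma vol_pos : 0 <= vol.
Proof. apply pow_le. lra. Qed.

Lemma delta_le_1 : delta <= 1.
Proof. unfold delta. nra. Qed.

Lemma pair_volume : (4 * (2 * sigma ^ 2) + delta) ^ 2 <= 81 * sigma ^ 4.
Proof.
  pose proof (cell_pos L M HL HM). fold delta in H. fold delta in Hdelta.
  replace (81 * sigma ^ 4) with ((9 * sigma ^ 2) ^ 2) by ring. apply pow_incr. lra.
Qed.

Lemma third_volume : (4 * sigma + delta) ^ 2 <= 25 * sigma ^ 2.
Proof.
  pose proof (cell_pos L M HL HM). fold delta in H. fold delta in Hdelta.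
  replace (25 * sigma ^ 2) with ((5 * sigma) ^ 2) by ring. apply pow_incr. nra.
Qed.

(** 1296 is 16 times [9 ^ 2], from [4 * (2 * sigma ^ 2) + delta <= 9 * sigma ^ 2]. The resulting
    [sigma ^ 4] is weakened to [sigma ^ 2 * q], the size of the other contribution. *)
Lemma lint_initial_closeness z :
  lint L M (2 * N) (fun x => cutoff (2 * N) L0 x * initial_closeness x) z
   <= INR N * (INR N * (1296 * vol)) * (sigma ^ 2 * q).
Proof.
  pose proof vol_pos as Hvol. pose proof pair_volume as Hpv. pose proof delta_le_1 as Hd1.
  rewrite (lint_ext L M HL HM (2 * N) _ (fun x => rsum N (fun j => rsum N (fun k =>
     cutoff (2 * N) L0 x * (if Nat.eqb k j then 0 else 16 * near_pair (2 * sigma ^ 2) x j k))))).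
  2:{ intros x. unfold initial_closeness. rewrite <- rsum_scal. apply rsum_ext; intros j _.
      rewrite <- rsum_scal. reflexivity. }
  apply Rle_trans with (INR N * (INR N * (1296 * sigma ^ 4 * vol))).
  - rewrite <- !rsum_const. apply lint_rsum_le; auto. intros j Hj.
    apply lint_rsum_le; auto. intros k Hk. destruct (Nat.eqb_spec k j) as [->|Hkj].
    + rewrite (lint_ext L M HL HM (2 * N) _ (fun _ => 0)) by (intros; ring).
      rewrite lint_const, Rmult_0_r by auto.
      apply Rmult_le_pos; auto. nra.
    + rewrite (lint_ext L M HL HM (2 * N) _ (fun x => 16 *
        (cutoff (2 * N) L0 x * near_pair (2 * sigma ^ 2) x j k))) by (intros; ring).
      rewrite lint_scal.
      apply Rle_trans with (16 * ((4 * (2 * sigma ^ 2) + delta) ^ 2 * vol)).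
      * apply Rmult_le_compat_l; [lra|]. apply lint_pair; auto. nra.
      * assert ((4 * (2 * sigma ^ 2) + delta) ^ 2 * vol <= 81 * sigma ^ 4 * vol)
          by (apply Rmult_le_compat_r; auto). lra.
  - replace (INR N * (INR N * (1296 * vol)) * (sigma ^ 2 * q)) with
      (INR N * (INR N * (1296 * (sigma ^ 2 * q) * vol))) by ring.
    pose proof (pos_INR N). repeat apply Rmult_le_compat_l; auto.
    apply Rmult_le_compat_r; auto.
    assert (sigma ^ 4 <= sigma ^ 2 * q); [|lra].
    replace (sigma ^ 4) with (sigma ^ 2 * sigma ^ 2) by ring.
    apply Rmult_le_compat_l; nra.
Qed.

(** With [y = sigma ^ 2 * q], the far part is [2 * 81] times [sigma ^ 2 * y] and the near part
    [3 * 2 * 25 * 81] times [sigma ^ 2 * y ^ 2], both times [vol]; [y <= 1] merges them. The spare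
    [sigma ^ 2] pays for the division in [approach_rate]. *)
Lemma lint_rate_term j k l z :
  (j < N)%nat -> (k < N)%nat -> (l < N)%nat -> j <> k -> l <> j -> l <> k ->
  lint L M (2 * N) (fun x => cutoff (2 * N) L0 x * (near_pair (2 * sigma ^ 2) x j k *
        (2 * q + 3 * q ^ 2 * (near_pair sigma x j l + near_pair sigma x k l)))) z
  <= 12312 * vol * (sigma ^ 2 * (sigma ^ 2 * q)).
Proof.
  intros Hj Hk Hl Hjk Hlj Hlk. pose proof vol_pos as Hvol.
  pose proof pair_volume as Hpv. pose proof third_volume as Htv. pose proof delta_le_1 as Hd1.
  pose proof (pow2_ge_0 q) as Hq2. pose proof sigma2_pos as Hs2.
  rewrite (lint_ext L M HL HM (2 * N) _ (fun x =>
     2 * q * (cutoff (2 * N) L0 x * near_pair (2 * sigma ^ 2) x j k) +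
     3 * q ^ 2 * (cutoff (2 * N) L0 x * (near_pair (2 * sigma ^ 2) x j k * near_pair sigma x j l) +
      cutoff (2 * N) L0 x * (near_pair (2 * sigma ^ 2) x k j * near_pair sigma x k l)))).
  2:{ intros x. rewrite (near_pair_sym (2 * sigma ^ 2) x k j). ring. }
  rewrite lint_plus, !lint_scal, lint_plus.
  assert (A1 := lint_pair N L M L0 HL HM HL0 HL0L Hd1 (2 * sigma ^ 2) j k z ltac:(lra) Hj Hk Hjk).
  assert (A2 := lint_triple N L M L0 HL HM HL0 HL0L Hd1 (2 * sigma ^ 2) sigma j k l z
                  ltac:(lra) Hsigma Hj Hk Hl Hjk Hlj Hlk).
  assert (A3 := lint_triple N L M L0 HL HM HL0 HL0L Hd1 (2 * sigma ^ 2) sigma k j l z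
                  ltac:(lra) Hsigma Hk Hj Hl (not_eq_sym Hjk) Hlk Hlj).
  fold delta in A1, A2, A3. fold vol in A1, A2, A3.
  set (D := (4 * (2 * sigma ^ 2) + delta) ^ 2) in *. set (D' := (4 * sigma + delta) ^ 2) in *.
  assert (B1 : D * vol <= 81 * sigma ^ 4 * vol) by (apply Rmult_le_compat_r; auto).
  assert (HD' : 0 <= D') by apply pow2_ge_0.
  assert (HDv : 0 <= D * vol) by (apply Rmult_le_pos; auto; apply pow2_ge_0).
  assert (B2 : D' * (D * vol) <= 25 * sigma ^ 2 * (81 * sigma ^ 4 * vol)) by (apply Rmult_le_compat; auto).
  apply Rle_trans with (2 * q * (81 * sigma ^ 4 * vol) +
    3 * q ^ 2 * (25 * sigma ^ 2 * (81 * sigma ^ 4 * vol) + 25 * sigma ^ 2 * (81 * sigma ^ 4 * vol))).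
  - apply Rplus_le_compat; apply Rmult_le_compat_l; lra.
  - set (y := sigma ^ 2 * q) in *.
    replace (2 * q * (81 * sigma ^ 4 * vol)) with (162 * vol * (sigma ^ 2 * y)) by (unfold y; ring).
    replace (3 * q ^ 2 * (25 * sigma ^ 2 * (81 * sigma ^ 4 * vol) + 25 * sigma ^ 2 * (81 * sigma ^ 4 * vol)))
      with (12150 * vol * (sigma ^ 2 * y) * y) by (unfold y; ring).
    assert (Hy0 : 0 <= y) by (unfold y; apply Rmult_le_pos; lra).
    assert (0 <= vol * (sigma ^ 2 * y)) by (apply Rmult_le_pos; auto; apply Rmult_le_pos; lra).
    nra.
Qed.

Lemma lint_approach_rate z :
  lint L M (2 * N) (fun x => cutoff (2 * N) L0 x * approach_rate x) z
   <= 64 * Rabs cc * (INR N * (INR N * (total_strength N gamma * (12312 * vol)))) * (sigma ^ 2 * q).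
Proof.
  pose proof vol_pos as Hvol. pose proof sigma2_pos as Hs2. pose proof (Rabs_pos cc) as Hcc.
  pose proof (total_strength_pos N gamma) as HG.
  rewrite (lint_ext L M HL HM (2 * N) _ (fun x => 64 * Rabs cc / sigma ^ 2 *
    rsum N (fun j => rsum N (fun k => rsum N (fun l =>
      if Nat.eqb k j || (Nat.eqb l j || Nat.eqb l k) then 0 else Rabs (gamma l) *
        (cutoff (2 * N) L0 x * (near_pair (2 * sigma ^ 2) x j k *
        (2 * q + 3 * q ^ 2 * (near_pair sigma x j l + near_pair sigma x k l))))))))).
  2:{ intros x. unfold approach_rate. rewrite (Rmult_comm (cutoff _ _ _)), Rmult_assoc. f_equal.
      rewrite Rmult_comm, <- rsum_scal. apply rsum_ext; intros j _.
      rewrite <- rsum_scal. apply rsum_ext; intros k _.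
      destruct (Nat.eqb k j); simpl orb.
      - rewrite Rmult_0_r. symmetry; apply rsum_zero; auto.
      - rewrite <- rsum_scal. apply rsum_ext; intros l _.
        unfold rate_term. destruct (Nat.eqb l j || Nat.eqb l k); ring. }
  rewrite lint_scal.
  set (B := 12312 * vol * (sigma ^ 2 * (sigma ^ 2 * q))).
  assert (HB : 0 <= B).
  { unfold B. apply Rmult_le_pos; [lra|]. apply Rmult_le_pos; [lra|]. apply Rmult_le_pos; lra. }
  apply Rle_trans with (64 * Rabs cc / sigma ^ 2 * (INR N * (INR N * (total_strength N gamma * B)))).
  - apply Rmult_le_compat_l; [apply Rdiv_le_0_compat; lra|].
    rewrite <- !rsum_const. apply lint_rsum_le; auto. intros j Hj.
    apply lint_rsum_le; auto. intros k Hk.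
    rewrite (Rmult_comm (total_strength N gamma)). unfold total_strength. rewrite <- rsum_scal.
    apply lint_rsum_le; auto. intros l Hl.
    destruct (Nat.eqb_spec k j); simpl orb.
    { rewrite (lint_ext L M HL HM (2 * N) _ (fun _ => 0)), lint_const, Rmult_0_r by auto.
      apply Rmult_le_pos; auto; apply Rabs_pos. }
    destruct (Nat.eqb_spec l j); simpl orb.
    { rewrite (lint_ext L M HL HM (2 * N) _ (fun _ => 0)), lint_const, Rmult_0_r by auto.
      apply Rmult_le_pos; auto; apply Rabs_pos. }
    destruct (Nat.eqb_spec l k).
    { rewrite lint_const, Rmult_0_r by auto.
      apply Rmult_le_pos; auto; apply Rabs_pos. }
    rewrite lint_scal, Rmult_comm. apply Rmult_le_compat_r; [apply Rabs_pos|].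
    apply lint_rate_term; auto.
  - right. unfold B. field. lra.
Qed.

End Integrals.

End Densities.

(** * Approach of close pairs *)

Definition sqdist (x : nat -> R) (j k : nat) : R := dx1 x j k ^ 2 + dx2 x j k ^ 2.

Section Approach.
Variables (N : nat) (gamma : nat -> R) (s cc sigma q : R).
Hypotheses (Hs : / 2 < s) (Hsigma : 0 < sigma) (Hq : 1 <= q).
Hypothesis (Hkern : forall u w,
  Rabs (kern (sigma ^ 4) s u w) <= q + 3 * q ^ 2 * (bump sigma u * bump sigma w)).

Let a := sigma ^ 4.
Let v := field N gamma s cc a.

Lemma a_pos : 0 < a.
Proof. apply pow_lt; auto. Qed.

(** Squaring the positive part makes it differentiable. It vanishes for pairs at squared distance
    [4 * a] or more and is at least 9 at a near collision. *)
Definition closeness (x : nat -> R) (j k : nat) : R := Rmax 0 (4 - sqdist x j k / a) ^ 2.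

Definition half_dsqdist (x : nat -> R) (j k : nat) : R :=
  dx1 x j k * (v (2 * j) x - v (2 * k) x) + dx2 x j k * (v (2 * j + 1) x - v (2 * k + 1) x).

Lemma is_derive_closeness X j k t : trajectory (2 * N) v X -> (j < N)%nat -> (k < N)%nat ->
  is_derive (fun t => closeness (X t) j k) t
    (- (2 * half_dsqdist (X t) j k / a) * (2 * Rmax 0 (4 - sqdist (X t) j k / a))).
Proof.
  intros HX Hj Hk. pose proof a_pos as Ha.
  assert (H1 := HX (2 * j)%nat t ltac:(lia)). assert (H2 := HX (2 * k)%nat t ltac:(lia)).
  assert (H3 := HX (2 * j + 1)%nat t ltac:(lia)). assert (H4 := HX (2 * k + 1)%nat t ltac:(lia)).
  unfold closeness.
  apply (is_derive_comp (fun y => Rmax 0 y ^ 2) (fun t => 4 - sqdist (X t) j k / a));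
    [apply is_derive_pos_part_sq|].
  assert (Hsq : is_derive (fun t => sqdist (X t) j k) t (2 * half_dsqdist (X t) j k)).
  { unfold sqdist, half_dsqdist, dx1, dx2.
    match goal with |- is_derive _ _ ?d => replace d with
      (2 * (X t (2 * j)%nat - X t (2 * k)%nat) * (v (2 * j) (X t) - v (2 * k) (X t)) +
       2 * (X t (2 * j + 1)%nat - X t (2 * k + 1)%nat) * (v (2 * j + 1) (X t) - v (2 * k + 1) (X t)))
      by ring end.
    apply (is_derive_plus (K := R_AbsRing) (V := R_NormedModule)
      (fun t => (X t (2 * j)%nat - X t (2 * k)%nat) ^ 2)).
    - apply (is_derive_sq_diff (fun t => X t (2 * j)%nat) (fun t => X t (2 * k)%nat)); auto.
    - apply (is_derive_sq_diff (fun t => X t (2 * j + 1)%nat) (fun t => X t (2 * k + 1)%nat)); auto. }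
  apply (is_derive_ext (fun t => 4 + -1 * / a * sqdist (X t) j k)).
  { intros r. match goal with |- @eq _ ?x ?y => change (@eq R x y) end. field. lra. }
  replace (- (2 * half_dsqdist (X t) j k / a)) with
    (0 + -1 * / a * (2 * half_dsqdist (X t) j k)) by (field; lra).
  apply (is_derive_plus (K := R_AbsRing) (V := R_NormedModule) (fun _ => 4)).
  - apply (is_derive_const (K := R_AbsRing) (V := R_NormedModule)).
  - apply (is_derive_scal (fun t => sqdist (X t) j k)). exact Hsq.
Qed.

Lemma vkern_close c x j l :
  Rabs (vkern s cc a c (dx1 x j l) (dx2 x j l))
    <= Rabs cc * (q + 3 * q ^ 2 * near_pair sigma x j l).
Proof.
  unfold vkern, near_pair. destruct c; rewrite Rabs_mult, ?Rabs_Ropp;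
    (apply Rmult_le_compat_l; [apply Rabs_pos|]).
  - rewrite (Rmult_comm (bump _ _)). apply Hkern.
  - apply Hkern.
Qed.

Lemma mutual_orthogonal x j k :
  dx1 x j k * vkern s cc a false (dx1 x j k) (dx2 x j k)
   + dx2 x j k * vkern s cc a true (dx1 x j k) (dx2 x j k) = 0.
Proof.
  unfold vkern, kern. rewrite (Rplus_comm (dx2 x j k ^ 2)). ring.
Qed.

(** The term [l = k] in the velocity of [j] and the term [l = j] in that of [k] are each orthogonal
    to the separation. *)
Lemma half_dsqdist_others x j k : (j < N)%nat -> (k < N)%nat -> j <> k ->
  half_dsqdist x j k = rsum N (fun l => if Nat.eqb l j || Nat.eqb l k then 0 else
    gamma l * ((dx1 x j k * vkern s cc a false (dx1 x j l) (dx2 x j l)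
                + dx2 x j k * vkern s cc a true (dx1 x j l) (dx2 x j l))
             - (dx1 x j k * vkern s cc a false (dx1 x k l) (dx2 x k l)
                + dx2 x j k * vkern s cc a true (dx1 x k l) (dx2 x k l)))).
Proof.
  intros Hj Hk Hjk. unfold half_dsqdist, v.
  assert (E1 := field_index N gamma s cc a false j x Hj).
  assert (E2 := field_index N gamma s cc a true j x Hj).
  assert (E3 := field_index N gamma s cc a false k x Hk).
  assert (E4 := field_index N gamma s cc a true k x Hk).
  cbv iota in E1, E2, E3, E4. rewrite Nat.add_0_r in E1, E3. rewrite E1, E2, E3, E4.
  unfold others. rewrite <- !rsum_minus, <- !rsum_scal, <- rsum_plus.
  apply rsum_ext; intros l Hl.
  destruct (Nat.eqb_spec l j) as [->|Hlj].
  - simpl orb. cbv iota. destruct (Nat.eqb_spec j k); [congruence|].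
    pose proof (mutual_orthogonal x k j) as H. unfold dx1, dx2 in *.
    match type of H with ?e = 0 =>
      match goal with |- ?g = _ => replace g with (gamma j * e) by ring end end.
    rewrite H. ring.
  - destruct (Nat.eqb_spec l k) as [->|Hlk].
    + simpl orb. cbv iota. pose proof (mutual_orthogonal x j k) as H.
      match type of H with ?e = 0 =>
        match goal with |- ?g = _ => replace g with (gamma k * e) by ring end end.
      rewrite H. ring.
    + simpl orb. cbv iota. ring.
Qed.

Lemma closeness_rate X j k t : trajectory (2 * N) v X -> (j < N)%nat -> (k < N)%nat -> j <> k ->
  - (2 * half_dsqdist (X t) j k / a) * (2 * Rmax 0 (4 - sqdist (X t) j k / a))
    <= approach_rate N gamma cc sigma q (X t).
Proof.
  intros HX Hj Hk Hjk. set (x := X t). pose proof a_pos as Ha.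
  pose proof (approach_rate_pos N gamma cc sigma q Hsigma Hq x) as Hpos.
  assert (Hs2 : 0 < sigma ^ 2) by (apply pow_lt; auto).
  destruct (Rle_dec (4 * a) (sqdist x j k)) as [Hfar|Hnear].
  - rewrite Rmax_left; [lra|].
    assert (4 <= sqdist x j k / a); [|lra].
    apply (Rmult_le_reg_r a); auto. unfold Rdiv. rewrite Rmult_assoc, Rinv_l by lra. lra.
  - apply Rnot_le_lt in Hnear.
    assert (Hd : Rabs (dx1 x j k) <= 2 * sigma ^ 2 /\ Rabs (dx2 x j k) <= 2 * sigma ^ 2).
    { unfold sqdist in Hnear. assert (Ea : 4 * a = (2 * sigma ^ 2) ^ 2) by (unfold a; ring).
      rewrite Ea in Hnear.
      split; apply Rabs_le; split; nra. }
    assert (Hone : near_pair (2 * sigma ^ 2) x j k = 1).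
    { unfold near_pair. rewrite !bump_one by lra. ring. }
    assert (Hmax : 0 <= Rmax 0 (4 - sqdist x j k / a) <= 4).
    { split; [apply Rmax_l|]. apply Rmax_lub; [lra|].
      assert (0 <= sqdist x j k / a); [|lra].
      apply Rdiv_le_0_compat; auto. unfold sqdist. nra. }
    set (S0 := rsum N (fun l => if Nat.eqb l j || Nat.eqb l k then 0 else
      Rabs (gamma l) * (2 * q + 3 * q ^ 2 * (near_pair sigma x j l + near_pair sigma x k l)))).
    assert (HQ : Rabs (half_dsqdist x j k) <= 4 * sigma ^ 2 * Rabs cc * S0).
    { rewrite half_dsqdist_others by auto. eapply Rle_trans; [apply rsum_abs|].
      unfold S0. rewrite <- rsum_scal. apply rsum_le; intros l Hl.
      destruct (Nat.eqb l j || Nat.eqb l k); [rewrite Rabs_R0; lra|].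
      assert (B : forall i, Rabs (dx1 x j k * vkern s cc a false (dx1 x i l) (dx2 x i l)
                + dx2 x j k * vkern s cc a true (dx1 x i l) (dx2 x i l)) <=
                4 * sigma ^ 2 * (Rabs cc * (q + 3 * q ^ 2 * near_pair sigma x i l))).
      { intros i. eapply Rle_trans; [apply Rabs_triang|]. rewrite !Rabs_mult.
        pose proof (vkern_close false x i l). pose proof (vkern_close true x i l).
        pose proof (Rabs_pos (dx1 x j k)). pose proof (Rabs_pos (dx2 x j k)).
        pose proof (Rabs_pos (vkern s cc a false (dx1 x i l) (dx2 x i l))).
        pose proof (Rabs_pos (vkern s cc a true (dx1 x i l) (dx2 x i l))).
        assert (Rabs (dx1 x j k) * Rabs (vkern s cc a false (dx1 x i l) (dx2 x i l)) <=
          2 * sigma ^ 2 * (Rabs cc * (q + 3 * q ^ 2 * near_pair sigma x i l)))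
          by (apply Rmult_le_compat; tauto).
        assert (Rabs (dx2 x j k) * Rabs (vkern s cc a true (dx1 x i l) (dx2 x i l)) <=
          2 * sigma ^ 2 * (Rabs cc * (q + 3 * q ^ 2 * near_pair sigma x i l)))
          by (apply Rmult_le_compat; tauto).
        lra. }
      rewrite Rabs_mult.
      replace (4 * sigma ^ 2 * Rabs cc * (Rabs (gamma l) *
         (2 * q + 3 * q ^ 2 * (near_pair sigma x j l + near_pair sigma x k l)))) with
        (Rabs (gamma l) * (4 * sigma ^ 2 * (Rabs cc * (q + 3 * q ^ 2 * near_pair sigma x j l)) +
           4 * sigma ^ 2 * (Rabs cc * (q + 3 * q ^ 2 * near_pair sigma x k l)))) by ring.
      apply Rmult_le_compat_l; [apply Rabs_pos|].
      eapply Rle_trans; [apply Rabs_triang|]. rewrite Rabs_Ropp.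
      apply Rplus_le_compat; apply B. }
    eapply Rle_trans; [|apply (approach_rate_ge N gamma cc sigma q Hsigma Hq x j k Hj Hk Hjk)].
    rewrite (rsum_ext N (fun l => if Nat.eqb l j || Nat.eqb l k then 0 else
        rate_term gamma sigma q x j k l)
      (fun l => if Nat.eqb l j || Nat.eqb l k then 0 else
      Rabs (gamma l) * (2 * q + 3 * q ^ 2 * (near_pair sigma x j l + near_pair sigma x k l)))).
    2:{ intros l _. unfold rate_term. rewrite Hone. destruct (Nat.eqb l j || Nat.eqb l k); ring. }
    fold S0.
    apply Rabs_le_between in HQ.
    set (E := 4 * sigma ^ 2 * Rabs cc * S0) in *.
    assert (HE : 0 <= E) by lra.
    (* 64 collects [2 * 2] from the derivative of [closeness], 4 from the bound on the positive part
       and 4 from [E]. *)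
    replace (64 * Rabs cc / sigma ^ 2 * S0) with (/ a * (16 * E)).
    2:{ unfold E, a. field. lra. }
    replace (- (2 * half_dsqdist x j k / a) * (2 * Rmax 0 (4 - sqdist x j k / a))) with
      (/ a * (4 * (- half_dsqdist x j k * Rmax 0 (4 - sqdist x j k / a)))) by (field; lra).
    apply Rmult_le_compat_l; [left; apply Rinv_0_lt_compat; auto|].
    assert (- half_dsqdist x j k * Rmax 0 (4 - sqdist x j k / a) <=
       E * Rmax 0 (4 - sqdist x j k / a)) by (apply Rmult_le_compat_r; lra).
    assert (E * Rmax 0 (4 - sqdist x j k / a) <= E * 4) by (apply Rmult_le_compat_l; lra).
    lra.
Qed.

Lemma closeness_le_initial x j k : (j < N)%nat -> (k < N)%nat -> j <> k ->
  closeness x j k <= initial_closeness N sigma x.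
Proof.
  intros Hj Hk Hjk. pose proof a_pos as Ha.
  assert (Hs2 : 0 < sigma ^ 2) by (apply pow_lt; auto).
  destruct (Rle_dec (4 * a) (sqdist x j k)) as [Hfar|Hnear].
  - unfold closeness. rewrite Rmax_left.
    + rewrite pow_i by lia. apply initial_closeness_pos.
    + assert (4 <= sqdist x j k / a); [|lra].
      apply (Rmult_le_reg_r a); auto. unfold Rdiv. rewrite Rmult_assoc, Rinv_l by lra. lra.
  - apply Rnot_le_lt in Hnear.
    assert (Hd : Rabs (dx1 x j k) <= 2 * sigma ^ 2 /\ Rabs (dx2 x j k) <= 2 * sigma ^ 2).
    { unfold sqdist in Hnear. assert (Ea : 4 * a = (2 * sigma ^ 2) ^ 2) by (unfold a; ring).
      rewrite Ea in Hnear. split; apply Rabs_le; split; nra. }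
    assert (Hone : near_pair (2 * sigma ^ 2) x j k = 1).
    { unfold near_pair. rewrite !bump_one by lra. ring. }
    eapply Rle_trans; [|apply (initial_closeness_ge N sigma x j k); auto].
    rewrite Hone. unfold closeness.
    replace (16 * 1) with (4 ^ 2) by ring. apply pow_incr.
    split; [apply Rmax_l|]. apply Rmax_lub; [lra|].
    assert (0 <= sqdist x j k / a); [|lra].
    apply Rdiv_le_0_compat; auto. unfold sqdist. nra.
Qed.

Lemma closeness_of_collision x j k : sqdist x j k <= a -> 9 <= closeness x j k.
Proof.
  intros H. pose proof a_pos as Ha. unfold closeness.
  assert (sqdist x j k / a <= 1).
  { apply (Rmult_le_reg_r a); auto. unfold Rdiv. rewrite Rmult_assoc, Rinv_l by lra. lra. }
  replace 9 with (3 ^ 2) by ring. apply pow_incr. split; [lra|].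
  eapply Rle_trans; [|apply Rmax_r]. lra.
Qed.

End Approach.

(** * Riemann sums in time and Markov's inequality on the lattice *)

(** As [p >= 0], the full left Riemann sum bounds the growth up to any intermediate time; freezing
    [p] on one step costs [c * h ^ 2]. *)
Lemma increment_le_riemann_sum (Z dZ p : R -> R) (c h : R) (K : nat) :
  0 <= h ->
  (forall t, 0 <= t <= INR K * h -> is_derive Z t (dZ t)) ->
  (forall t, 0 <= t <= INR K * h -> dZ t <= p t) ->
  (forall t, 0 <= p t) ->
  (forall r t, Rabs (p r - p t) <= c * Rabs (r - t)) ->
  forall t, 0 <= t <= INR K * h ->
  Z t <= Z 0 + h * rsum K (fun k => p (INR k * h)) + INR K * (c * h ^ 2).
Proof.
  intros Hh HZ Hp Hp0 Hc.
  assert (Hc0 : 0 <= c).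
  { specialize (Hc 1 0). rewrite Rminus_0_r, Rabs_R1 in Hc. pose proof (Rabs_pos (p 1 - p 0)). lra. }
  assert (Hch : 0 <= c * h ^ 2) by (apply Rmult_le_pos; auto; apply pow2_ge_0).
  induction K as [|K IH]; intros t Ht.
  - simpl INR in *. replace t with 0 by lra. simpl. lra.
  - rewrite S_INR in *. cbn [rsum].
    pose proof (pos_INR K) as HK.
    assert (HKh : 0 <= INR K * h) by (apply Rmult_le_pos; auto).
    assert (IH' : forall t, 0 <= t <= INR K * h ->
       Z t <= Z 0 + h * rsum K (fun k => p (INR k * h)) + INR K * (c * h ^ 2)).
    { apply IH; intros; [apply HZ|apply Hp]; lra. }
    destruct (Rle_dec t (INR K * h)) as [Hle|Hgt].
    + specialize (IH' t ltac:(lra)). pose proof (Hp0 (INR K * h)). nra.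
    + specialize (IH' (INR K * h) ltac:(lra)).
      assert (Hstep : Z t - Z (INR K * h) <=
        (p (INR K * h) + c * h) * t - (p (INR K * h) + c * h) * (INR K * h)).
      { apply (increment_le Z (fun t => (p (INR K * h) + c * h) * t) dZ
           (fun _ => p (INR K * h) + c * h)); [lra| | |].
        - intros r Hr. apply HZ. lra.
        - intros r Hr. auto_derive; [trivial|ring].
        - intros r Hr. eapply Rle_trans; [apply Hp; lra|].
          specialize (Hc r (INR K * h)). rewrite (Rabs_pos_eq (r - INR K * h)) in Hc by lra.
          apply Rabs_le_between in Hc. nra. }
      pose proof (Hp0 (INR K * h)) as Hp0'.
      assert ((p (INR K * h) + c * h) * (t - INR K * h) <= (p (INR K * h) + c * h) * h).
      { apply Rmult_le_compat_l; [|lra]. apply Rplus_le_le_0_compat; auto. apply Rmult_le_pos; auto. }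
      nra.
Qed.

Definition lsum_list (l : list (nat -> R)) (F : (nat -> R) -> R) : R :=
  fold_right (fun y acc => F y + acc) 0 l.

Lemma lsum_list_app l l' F : lsum_list (l ++ l') F = lsum_list l F + lsum_list l' F.
Proof. induction l as [|y l IH]; simpl; [ring|rewrite IH; ring]. Qed.

Section Grid.
Variables (L : R) (M : nat).
Hypotheses (HL : 0 < L) (HM : (0 < M)%nat).
Let delta := 2 * L / INR M.

(** The nodes of [lint] as a list: those with a large value of [F] become the corners of the
    covering cubes. *)
Fixpoint grid (n : nat) (z : nat -> R) : list (nat -> R) :=
  match n with
  | O => z :: nil
  | S k => flat_map (fun j => grid k (upd z k (pt L M j))) (seq 0 M)
  end.

Lemma lint_grid n F z : lint L M n F z = delta ^ n * lsum_list (grid n z) F.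
Proof.
  revert z; induction n as [|n IH]; intros z; [simpl; ring|].
  cbn [lint grid]. unfold lsum. fold delta.
  rewrite (rsum_ext M _ (fun k => delta ^ n * lsum_list (grid n (upd z n (pt L M k))) F))
    by (intros; apply IH).
  rewrite rsum_scal. simpl pow. rewrite <- Rmult_assoc. f_equal.
  assert (H : forall k, rsum k (fun k => lsum_list (grid n (upd z n (pt L M k))) F) =
     lsum_list (flat_map (fun j => grid n (upd z n (pt L M j))) (seq 0 k)) F).
  { induction k as [|k IHk]; [reflexivity|]. cbn [rsum]. rewrite IHk, seq_S, flat_map_app, lsum_list_app.
    simpl. rewrite app_nil_r. reflexivity. }
  apply H.
Qed.

Lemma grid_outer n z y i : In y (grid n z) -> (n <= i)%nat -> y i = z i.
Proof.
  revert z; induction n as [|n IH]; intros z Hy Hi.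
  - destruct Hy as [<-|[]]; auto.
  - apply in_flat_map in Hy. destruct Hy as [j [_ Hy]]. rewrite (IH _ Hy) by lia.
    apply upd_neq. lia.
Qed.

Lemma pt_cell t : - L <= t <= L -> exists k, (k < M)%nat /\ pt L M k <= t <= pt L M k + delta.
Proof.
  intros Ht.
  assert (H : forall j, (0 < j)%nat -> (j <= M)%nat -> t <= pt L M j ->
     exists k, (k < j)%nat /\ pt L M k <= t <= pt L M k + delta).
  { induction j as [|j IH]; intros Hj HjM Htj; [lia|].
    rewrite pt_S in Htj. fold delta in Htj.
    destruct (Rle_dec (pt L M j) t) as [Hle|Hgt]; [exists j; split; [lia|lra]|].
    destruct j as [|j].
    - rewrite pt_0 in Hgt. lra.
    - destruct IH as [k [Hk Hkt]]; [lia|lia|lra|]. exists k; split; [lia|auto]. }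
  apply H; auto. rewrite pt_M by auto. lra.
Qed.

Lemma grid_cell n z x : (forall i, (i < n)%nat -> - L <= x i <= L) ->
  exists y, In y (grid n z) /\ forall i, (i < n)%nat -> y i <= x i <= y i + delta.
Proof.
  revert z; induction n as [|n IH]; intros z Hx.
  - exists z. split; [left; auto|]. intros; lia.
  - destruct (pt_cell (x n)) as [k [Hk Hkx]]; [apply Hx; lia|].
    destruct (IH (upd z n (pt L M k))) as [y [Hy Hyx]]; [intros; apply Hx; lia|].
    exists y. split.
    + apply in_flat_map. exists k. split; auto. apply in_seq. lia.
    + intros i Hi. destruct (Nat.eq_dec i n) as [->|Hne]; [|apply Hyx; lia].
      rewrite (grid_outer n _ y n Hy), upd_eq by lia. auto.
Qed.

Lemma markov_grid n F z : (forall y, 0 <= F y) ->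
  INR (length (filter (fun y => leb_R 1 (F y)) (grid n z))) * delta ^ n <= lint L M n F z.
Proof.
  intros H0. rewrite lint_grid, Rmult_comm. apply Rmult_le_compat_l.
  - apply pow_le. left. apply mesh_pos; auto.
  - induction (grid n z) as [|y l IH]; simpl; [lra|].
    destruct (leb_R 1 (F y)) eqn:E.
    + simpl length. rewrite S_INR. apply leb_R_true in E. lra.
    + specialize (H0 y). lra.
Qed.

End Grid.

(** Applied with [B] a sum of nonnegative constants, so that one step size meets several smallness
    conditions at once. *)
Lemma exists_nat_large (B T : R) : 0 <= B -> 0 <= T -> exists K : nat, (0 < K)%nat /\ T / INR K * B <= 1.
Proof.
  intros HB HT. destruct (nfloor_ex (T * B)) as [k [_ Hk]]; [apply Rmult_le_pos; auto|].
  exists (S k). split; [lia|]. assert (HSk : 0 < INR (S k)) by (apply lt_0_INR; lia).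
  apply (Rmult_le_reg_r (INR (S k))); auto. rewrite S_INR in *.
  replace (T / (INR k + 1) * B * (INR k + 1)) with (T * B) by (field; lra). lra.
Qed.

(** * Covering the near collisions *)

Lemma Rpower_pow_nat x n p : 0 < x -> Rpower (x ^ n) p = Rpower x (INR n * p).
Proof. intros Hx. rewrite <- Rpower_pow, Rpower_mult by auto. reflexivity. Qed.

(** Since [/ 2 - s = (m - 3) / 2], the far bound at squared distance [sigma ^ 2] is [q], and the
    global bound at [sigma ^ 4 / 3] is [q ^ 2] times [3 ^ ((3 - m) / 2) <= 3]. *)
Lemma kern_two_scale m sigma u w : 1 < m -> m < 2 -> 0 < sigma ->
  Rabs (kern (sigma ^ 4) ((4 - m) / 2) u w) <=
  Rpower sigma (m - 3) + 3 * Rpower sigma (m - 3) ^ 2 * (bump sigma u * bump sigma w).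
Proof.
  intros Hm1 Hm2 Hs. set (q := Rpower sigma (m - 3)).
  assert (Hq : 0 < q) by apply exp_pos.
  pose proof (bump_range sigma u). pose proof (bump_range sigma w).
  assert (Hs4 : 0 < sigma ^ 4) by (apply pow_lt; auto).
  assert (Hsp : / 2 < (4 - m) / 2) by lra.
  destruct (Rle_dec (sigma ^ 2) (u ^ 2 + w ^ 2)) as [Hfar|Hnear].
  - assert (B := kern_bound_far (sigma ^ 4) ((4 - m) / 2) Hs4 Hsp (sigma ^ 2) u w ltac:(nra) Hfar).
    rewrite Rpower_pow_nat in B by auto.
    replace (INR 2 * (/ 2 - (4 - m) / 2)) with (m - 3) in B by (simpl; field). fold q in B.
    assert (0 <= 3 * q ^ 2 * (bump sigma u * bump sigma w)); [|lra].
    apply Rmult_le_pos; [pose proof (pow2_ge_0 q); lra|apply Rmult_le_pos; lra].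
  - apply Rnot_le_lt in Hnear.
    assert (B := kern_bound (sigma ^ 4) ((4 - m) / 2) Hs4 Hsp u w).
    assert (Hu : Rabs u <= sigma) by (apply Rabs_le; split; nra).
    assert (Hw : Rabs w <= sigma) by (apply Rabs_le; split; nra).
    rewrite !bump_one by auto.
    replace (sigma ^ 4 / 3) with (sigma ^ 4 * / 3) in B by field.
    rewrite <- Rpower_mult_distr in B by lra.
    rewrite Rpower_pow_nat in B by auto.
    replace (INR 4 * (/ 2 - (4 - m) / 2)) with ((m - 3) + (m - 3)) in B by (simpl; field).
    rewrite Rpower_plus in B. fold q in B.
    assert (H3 : Rpower (/ 3) (/ 2 - (4 - m) / 2) <= 3).
    { rewrite <- (Rpower_1 3) at 2 by lra.
      replace (Rpower (/ 3) (/ 2 - (4 - m) / 2)) with (Rpower 3 ((3 - m) / 2)).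
      - apply Rle_Rpower; lra.
      - unfold Rpower. rewrite ln_Rinv by lra. f_equal. field. }
    nra.
Qed.

Lemma rsum_lip n (F : nat -> (nat -> R) -> R) l K x y :
  (forall k, (k < K)%nat -> forall x y, Rabs (F k x - F k y) <= l * dist n x y) ->
  Rabs (rsum K (fun k => F k x) - rsum K (fun k => F k y)) <= INR K * (l * dist n x y).
Proof.
  intros H. rewrite <- rsum_minus. eapply Rle_trans; [apply rsum_abs|].
  apply rsum_bound. intros k Hk. apply H; auto.
Qed.

Section BadSet.
Variables (m : R) (N : nat) (gamma : nat -> R) (cc g0 : R).
Hypotheses (Hm1 : 1 < m) (Hm2 : m < 2) (HN : (1 <= N)%nat) (Hg0 : 0 < g0).
Hypothesis (Hgam : forall J : nat -> bool, (exists j, (j < N)%nat /\ J j = true) ->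
     g0 <= Rabs (rsum N (fun k => if J k then gamma k else 0))).

Let s := (4 - m) / 2.

Definition reg_field (sigma : R) : nat -> (nat -> R) -> R := field N gamma s cc (sigma ^ 4).

Definition reg_flow (sigma : R) (phi : R -> (nat -> R) -> nat -> R) : Prop :=
  (forall x i, phi 0 x i = x i) /\
  (forall x, trajectory (2 * N) (reg_field sigma) (fun t => phi t x)).

Definition near_collision (sigma T : R) (phi : R -> (nat -> R) -> nat -> R) (x : nat -> R) : Prop :=
  exists t j k, 0 <= t <= T /\ (j < N)%nat /\ (k < N)%nat /\ j <> k /\
    sqdist (phi t x) j k <= sigma ^ 4.

Lemma near_collision_cover R0 T eta : 0 <= R0 -> 0 <= T -> 0 < eta ->
  exists sigma, 0 < sigma /\ sigma <= 1 /\ forall phi, reg_flow sigma phi ->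
  exists (l : list (nat -> R)) (delta : R), 0 < delta /\
    INR (length l) * delta ^ (2 * N) <= eta /\
    forall x, (forall i, (i < 2 * N)%nat -> Rabs (x i) <= R0) -> near_collision sigma T phi x ->
      exists y, In y l /\ forall i, (i < 2 * N)%nat -> y i <= x i <= y i + delta.
Proof.
  intros HR0 HT Heta.
  assert (Hs : / 2 < s) by (unfold s; lra).
  set (n := (2 * N)%nat). assert (Hn : (0 < n)%nat) by (unfold n; lia).
  destruct (flow_confined N gamma s cc Hs g0 T HT Hg0 Hgam) as [Cc [HCc Hconf]].
  (* The extra 1 is the transition zone of [cutoff]. *)
  set (L0 := R0 + Cc + 1). assert (HL0 : 1 <= L0) by (unfold L0; lra).
  set (vol := (2 * L0 + 1) ^ (2 * N)).
  assert (Hvol : 0 <= vol) by (apply pow_le; lra).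
  pose proof (total_strength_pos N gamma) as HG. pose proof (Rabs_pos cc) as Hcc.
  pose proof (pos_INR N) as HNR.
  set (A0 := INR N * (INR N * (1296 * vol))).
  set (A1 := 64 * Rabs cc * (INR N * (INR N * (total_strength N gamma * (12312 * vol))))).
  assert (HA0 : 0 <= A0) by (unfold A0; repeat first [assumption | lra | apply Rmult_le_pos]).
  assert (HA1 : 0 <= A1) by (unfold A1; repeat first [assumption | lra | apply Rmult_le_pos]).
  set (A := A0 + T * A1). assert (HA : 0 <= A) by (unfold A; pose proof (Rmult_le_pos _ _ HT HA1); lra).
  (* [sigma] is defined by [sigma ^ (m - 1) = e], which uses [m > 1]. The bound 1 gives
     [sigma <= 1]; the other leaves half of [eta] for the discretization errors. *)
  set (e := Rmin 1 (eta / (2 * (A + 1)))).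
  assert (He : 0 < e).
  { apply Rmin_glb_lt; [lra|]. apply Rdiv_lt_0_compat; lra. }
  set (sigma := Rpower e (/ (m - 1))).
  assert (Hsig : 0 < sigma) by apply exp_pos.
  assert (Hsig1 : sigma <= 1).
  { unfold sigma. apply Rle_trans with (Rpower 1 (/ (m - 1))).
    - apply Rle_Rpower_l; [left; apply Rinv_0_lt_compat; lra|].
      split; [auto|apply Rmin_l].
    - unfold Rpower. rewrite ln_1, Rmult_0_r, exp_0. lra. }
  set (q := Rpower sigma (m - 3)).
  assert (Hq : 1 <= q).
  { unfold q, Rpower. rewrite <- exp_0. apply exp_le.
    assert (ln sigma <= ln 1) by (apply ln_le; lra). rewrite ln_1 in H. nra. }
  assert (Hy : sigma ^ 2 * q = e).
  { unfold q. rewrite <- (Rpower_pow 2) by auto. rewrite <- Rpower_plus.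
    replace (INR 2 + (m - 3)) with (m - 1) by (simpl; ring).
    unfold sigma. rewrite Rpower_mult, Rinv_l, Rpower_1; auto; lra. }
  assert (HAe : A * e <= eta / 2).
  { apply Rle_trans with (A * (eta / (2 * (A + 1)))).
    - apply Rmult_le_compat_l; auto. apply Rmin_r.
    - apply (Rmult_le_reg_r (2 * (A + 1))); [lra|].
      replace (A * (eta / (2 * (A + 1))) * (2 * (A + 1))) with (A * eta) by (field; lra).
      nra. }
  exists sigma. split; auto. split; auto. intros phi [Hphi0 Hphi].
  unfold reg_field in Hphi. assert (Ha : 0 < sigma ^ 4) by (apply pow_lt; auto).
  assert (Hkern : forall u w, Rabs (kern (sigma ^ 4) s u w) <=
     q + 3 * q ^ 2 * (bump sigma u * bump sigma w)) by (intros; apply kern_two_scale; auto).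
  destruct (field_lip N gamma s cc Hs _ Ha) as [lam [Hlam Hlip]].
  destruct (field_taylor N gamma s cc Hs _ Ha) as [C2 [HC2 Htay]].
  destruct (dfield_bound N gamma s cc Hs _ Ha) as [D HD].
  assert (HV := field_bound N gamma s cc Hs _ Ha).
  set (V := field_sup N gamma s cc (sigma ^ 4)) in *.
  assert (Hdiv := dfield_div N gamma s cc (sigma ^ 4)).
  set (v := field N gamma s cc (sigma ^ 4)) in *.
  set (dv := dfield N gamma s cc (sigma ^ 4)) in *.
  assert (HV0 : 0 <= V) by (apply (V_nonneg v V HV)).
  set (rate := approach_rate N gamma cc sigma q).
  set (init := initial_closeness N sigma).
  destruct (bounded_lip_admissible n L0 rate) as [B [l [Hl Hadm]]].
  { apply approach_rate_bounded_lip; auto. }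
  destruct (bounded_lip_admissible n L0 init) as [B' [l0 [Hl0 Hadm0]]].
  { apply initial_closeness_bounded_lip; auto. }
  set (P := fun x => cutoff n L0 x * rate x) in *.
  set (F0 := fun x => cutoff n L0 x * init x) in *.
  assert (HP0 : forall x, 0 <= P x).
  { intros x. apply Rmult_le_pos; [apply cutoff_range|apply approach_rate_pos; auto]. }
  assert (HF00 : forall x, 0 <= F0 x).
  { intros x. apply Rmult_le_pos; [apply cutoff_range|apply initial_closeness_pos]. }
  set (L := L0 + V * T + 2).
  assert (HVT : 0 <= V * T) by (apply Rmult_le_pos; auto).
  assert (HL : 0 < L) by (unfold L; lra).
  set (z := fun _ : nat => 0).
  destruct (lint_flow n v dv lam V D C2 Hlam HC2 Hlip HV HD Htay Hdiv P B l L0 T L z phi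
     Hphi0 Hphi Hn HT Hadm HL ltac:(unfold L; lra)) as [C1 [HC1 Hflow]].
  set (c := l * (INR n * V)).
  pose proof (pos_INR n) as HnR.
  assert (Hc : 0 <= c) by (unfold c; repeat first [assumption | lra | apply Rmult_le_pos]).
  (* Each summand times [h] has to be at most 1; the last one makes the [h ^ 2] part of the
     accumulated flow error at most [eta / 8]. *)
  set (Bg := 1 + V + INR n * lam + T * c + 8 * (T * C1 * T) / eta).
  assert (HTCT : 0 <= 8 * (T * C1 * T) / eta).
  { apply Rdiv_le_0_compat; auto. repeat first [assumption | lra | apply Rmult_le_pos]. }
  assert (Hnlam : 0 <= INR n * lam) by (apply Rmult_le_pos; auto).
  assert (HTc : 0 <= T * c) by (apply Rmult_le_pos; auto).
  destruct (exists_nat_large Bg T) as [K [HK HKB]]; [unfold Bg; lra|auto|].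
  set (h := T / INR K) in *.
  assert (HKR : 0 < INR K) by (apply lt_0_INR; auto).
  assert (Hh : 0 <= h) by (apply Rdiv_le_0_compat; auto).
  assert (HKh : INR K * h = T) by (unfold h; field; lra).
  assert (Hhsmall : forall b, 0 <= b -> b <= Bg -> h * b <= 1).
  { intros b Hb0 Hb. apply Rle_trans with (h * Bg); auto. apply Rmult_le_compat_l; auto. }
  assert (Hh1 : h <= 1) by (rewrite <- (Rmult_1_r h); apply Hhsmall; unfold Bg; lra).
  assert (HhV : h * V <= 1) by (apply Hhsmall; unfold Bg; lra).
  assert (Hhl : h * (INR n * lam) <= 1) by (apply Hhsmall; unfold Bg; lra).
  assert (HhTc : h * (T * c) <= 1) by (apply Hhsmall; unfold Bg; lra).
  assert (HhC : h * (8 * (T * C1 * T) / eta) <= 1) by (apply Hhsmall; unfold Bg; lra).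
  (* At confined starting points [F] dominates the closeness of every pair up to time [T], within an
     error of 1. Its lattice sum is accessible, since volume preservation takes each summand back to
     time 0. *)
  set (F := fun x => F0 x + h * rsum K (fun k => P (phi (INR k * h) x))).
  set (l' := l * (INR n * exp (lam * INR n * T))).
  assert (Hl' : 0 <= l').
  { unfold l'. apply Rmult_le_pos; auto. apply Rmult_le_pos; auto. left; apply exp_pos. }
  assert (Hkh : forall k, (k <= K)%nat -> 0 <= INR k * h <= T).
  { intros k Hk. pose proof (pos_INR k). split; [apply Rmult_le_pos; auto|].
    rewrite <- HKh. apply Rmult_le_compat_r; auto. apply le_INR; auto. }
  set (lF := l0 + T * l').
  assert (HFlip : forall x y, Rabs (F x - F y) <= lF * dist n x y).
  { intros x y. unfold F, lF.
    replace (F0 x + h * rsum K (fun k => P (phi (INR k * h) x)) -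
             (F0 y + h * rsum K (fun k => P (phi (INR k * h) y)))) with
      ((F0 x - F0 y) + h * (rsum K (fun k => P (phi (INR k * h) x)) -
        rsum K (fun k => P (phi (INR k * h) y)))) by ring.
    eapply Rle_trans; [apply Rabs_triang|]. rewrite Rmult_plus_distr_r.
    apply Rplus_le_compat; [apply Hadm0|].
    rewrite Rabs_mult, (Rabs_pos_eq h) by auto.
    replace (T * l' * dist n x y) with (h * (INR K * (l' * dist n x y))) by (rewrite <- HKh; ring).
    apply Rmult_le_compat_l; auto.
    apply (rsum_lip n (fun k x => P (phi (INR k * h) x))).
    intros k Hk. apply (admissible_flow n v lam V Hlam Hlip HV P B l L0 T phi); auto.
    apply Hkh; lia. }
  assert (HlF : 0 <= lF) by (unfold lF; pose proof (Rmult_le_pos _ _ HT Hl'); lra).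
  assert (HF0 : forall x, 0 <= F x).
  { intros x. unfold F. apply Rplus_le_le_0_compat; auto. apply Rmult_le_pos; auto.
    apply rsum_pos; auto. }
  (* [K] is fixed by now, so the mesh part of the flow error, which grows with the number of steps,
     can still be made small. *)
  set (Bg2 := 1 + / sigma ^ 2 + 8 * (T * C1 * INR K) / eta + lF * INR n).
  assert (Hs2 : 0 < sigma ^ 2) by (apply pow_lt; auto).
  assert (His2 : 0 < / sigma ^ 2) by (apply Rinv_0_lt_compat; auto).
  assert (HTCK : 0 <= 8 * (T * C1 * INR K) / eta).
  { apply Rdiv_le_0_compat; auto. repeat first [assumption | lra | apply Rmult_le_pos]. }
  assert (HlFn : 0 <= lF * INR n) by (apply Rmult_le_pos; auto).
  destruct (exists_nat_large Bg2 (2 * L)) as [M [HM HMB]]; [unfold Bg2; lra|lra|].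
  assert (Hd0 := mesh_pos L M HL HM).
  set (delta := 2 * L / INR M) in *.
  assert (Hdsmall : forall b, 0 <= b -> b <= Bg2 -> delta * b <= 1).
  { intros b Hb0 Hb. apply Rle_trans with (delta * Bg2); auto. apply Rmult_le_compat_l; auto; lra. }
  assert (Hd1 : delta * / sigma ^ 2 <= 1) by (apply Hdsmall; unfold Bg2; lra).
  assert (Hd2 : delta * (8 * (T * C1 * INR K) / eta) <= 1) by (apply Hdsmall; unfold Bg2; lra).
  assert (Hd3 : delta * (lF * INR n) <= 1) by (apply Hdsmall; unfold Bg2; lra).
  assert (Hdsig : delta <= sigma ^ 2).
  { apply (Rmult_le_reg_r (/ sigma ^ 2)); auto. rewrite Rinv_r by lra. auto. }
  assert (HL0L : L0 <= L) by (unfold L; lra).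
  assert (He1 : sigma ^ 2 * q <= 1) by (rewrite Hy; apply Rmin_l).
  assert (I0 : lint L M n F0 z <= A0 * e).
  { rewrite <- Hy. apply (lint_initial_closeness N sigma q); auto. }
  assert (I1 : lint L M n P z <= A1 * e).
  { rewrite <- Hy. apply (lint_approach_rate N gamma cc sigma q); auto. }
  assert (IF : lint L M n F z <= eta).
  { unfold F. rewrite lint_plus, lint_scal, lint_rsum by auto.
    apply Rle_trans with (A0 * e + h * (INR K * (A1 * e + C1 * INR K * (h ^ 2 + delta)))).
    - apply Rplus_le_compat; auto. apply Rmult_le_compat_l; auto. apply rsum_bound. intros k Hk.
      assert (Hf := Hflow h M k Hh Hh1 HhV Hhl HM (proj2 (Hkh k ltac:(lia)))).
      fold delta in Hf. apply Rabs_le_between in Hf.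
      assert (C1 * INR k * (h ^ 2 + delta) <= C1 * INR K * (h ^ 2 + delta)).
      { apply Rmult_le_compat_r; [pose proof (pow2_ge_0 h); lra|].
        apply Rmult_le_compat_l; auto. apply le_INR; lia. }
      lra.
    - replace (h * (INR K * (A1 * e + C1 * INR K * (h ^ 2 + delta)))) with
        ((INR K * h) * (A1 * e) + (INR K * h) * C1 * (INR K * h) * h + (INR K * h) * C1 * INR K * delta)
        by ring.
      rewrite HKh.
      assert (T * C1 * T * h <= eta / 8).
      { apply (Rmult_le_reg_r (8 / eta)); [apply Rdiv_lt_0_compat; lra|].
        replace (eta / 8 * (8 / eta)) with 1 by (field; lra).
        replace (T * C1 * T * h * (8 / eta)) with (h * (8 * (T * C1 * T) / eta)) by (field; lra). auto. }
      assert (T * C1 * INR K * delta <= eta / 8).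
      { apply (Rmult_le_reg_r (8 / eta)); [apply Rdiv_lt_0_compat; lra|].
        replace (eta / 8 * (8 / eta)) with 1 by (field; lra).
        replace (T * C1 * INR K * delta * (8 / eta)) with (delta * (8 * (T * C1 * INR K) / eta))
          by (field; lra). auto. }
      unfold A in HAe. lra. }
  exists (filter (fun y => leb_R 1 (F y)) (grid L M n z)), delta.
  split; auto. split.
  { eapply Rle_trans; [|apply IF]. apply markov_grid; auto. }
  intros x Hx [t [j [k [Ht [Hj [Hk [Hjk Hcol]]]]]]].
  assert (Hcut : forall r, 0 <= r <= T -> cutoff n L0 (phi r x) = 1).
  { intros r Hr. apply cutoff_one. intros i Hi.
    assert (H1 := Hconf (sigma ^ 4) (fun t => phi t x) Ha (Hphi x) i r Hi Hr). cbv beta in H1.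
    rewrite Hphi0 in H1. specialize (Hx i Hi).
    replace (phi r x i) with (x i + (phi r x i - x i)) by ring.
    eapply Rle_trans; [apply Rabs_triang|]. unfold L0. lra. }
  (* A near collision means closeness at least 9, and discretizing time loses [T * c * h <= 1]. *)
  assert (HF8 : 8 <= F x).
  { assert (H9 := closeness_of_collision sigma Hsig (phi t x) j k Hcol).
    assert (Hplip : forall r1 r2, Rabs (P (phi r1 x) - P (phi r2 x)) <= c * Rabs (r1 - r2)).
    { intros r1 r2. eapply Rle_trans; [apply Hadm|]. unfold c.
      replace (l * (INR n * V) * Rabs (r1 - r2)) with (l * (INR n * (V * Rabs (r1 - r2)))) by ring.
      apply Rmult_le_compat_l; auto. apply dist_le. intros i Hi.
      apply (lip_of_derive (fun r => phi r x i) (fun r => v i (phi r x)) V r2 r1); auto.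
      intros r _. apply Hphi; auto. }
    assert (Hinc := increment_le_riemann_sum (fun t => closeness sigma (phi t x) j k) _
      (fun t => P (phi t x)) c h K Hh
      (fun t _ => is_derive_closeness N gamma s cc sigma Hsig (fun t => phi t x) j k t (Hphi x) Hj Hk)).
    cbv beta in Hinc. rewrite HKh in Hinc.
    specialize (fun H1 => Hinc H1 (fun _ => HP0 _) Hplip t Ht).
    assert (Hz : closeness sigma (phi 0 x) j k <= F0 x).
    { assert (E0 : closeness sigma (phi 0 x) j k = closeness sigma x j k).
      { unfold closeness, sqdist, dx1, dx2. rewrite !Hphi0. reflexivity. }
      rewrite E0. unfold F0.
      assert (E1 : cutoff n L0 x = 1).
      { apply cutoff_one. intros i Hi. specialize (Hx i Hi). unfold L0. lra. }
      rewrite E1, Rmult_1_l. apply closeness_le_initial; auto. }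
    replace (INR K * (c * h ^ 2)) with ((INR K * h) * c * h) in Hinc by ring.
    rewrite HKh in Hinc. unfold F.
    assert (Hrate : closeness sigma (phi t x) j k <=
      closeness sigma (phi 0 x) j k + h * rsum K (fun k => P (phi (INR k * h) x)) + T * c * h).
    { apply Hinc. intros r Hr. unfold P. rewrite Hcut, Rmult_1_l by auto.
      apply (closeness_rate N gamma s cc sigma q Hsig Hq Hkern (fun t => phi t x) j k r); auto. }
    lra. }
  (* Moving from [x] to the corner of its cell changes [F] by at most 1, so the corner still passes
     the threshold 1. *)
  destruct (grid_cell L M HM n z x) as [y [Hy1 Hy2]].
  { intros i Hi. specialize (Hx i Hi). apply Rabs_le_between in Hx. unfold L, L0. lra. }
  exists y. split; auto. apply filter_In. split; auto. apply leb_R_true.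
  assert (Hyx : dist n x y <= INR n * delta).
  { apply dist_le. intros i Hi. specialize (Hy2 i Hi). fold delta in Hy2. apply Rabs_le; lra. }
  specialize (HFlip x y). apply Rabs_le_between in HFlip.
  assert (lF * dist n x y <= lF * (INR n * delta)) by (apply Rmult_le_compat_l; auto).
  lra.
Qed.

End BadSet.

(** * The singular velocity field *)

Definition flat (x : nat -> R * R) (i : nat) : R :=
  if Nat.odd i then snd (x (Nat.div2 i)) else fst (x (Nat.div2 i)).

Lemma flat_even x j : flat x (2 * j) = fst (x j).
Proof. unfold flat. rewrite odd_even, div2_even. reflexivity. Qed.

Lemma flat_odd x j : flat x (2 * j + 1) = snd (x j).
Proof. unfold flat. rewrite odd_odd, div2_odd. reflexivity. Qed.

Definition pairs (x : nat -> R) (j : nat) : R * R := (x (2 * j)%nat, x (2 * j + 1)%nat).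

Definition green_const (m : R) : R :=
  Gamma ((2 - m) / 2) / (Rpower 2 (m / 2) * PI * Rabs (Gamma (m / 2))).

Lemma is_derive_green m (f : R -> R) df y :
  is_derive f y df -> 0 < f y ->
  is_derive (fun y => green_const m * Rpower (sqrt (f y)) (m - 2)) y
    (green_const m * (m - 2) * (df / 2 * Rpower (f y) (- ((4 - m) / 2)))).
Proof.
  intros Hf Hpos. set (r := f y) in *.
  replace (green_const m * (m - 2) * (df / 2 * Rpower r (- ((4 - m) / 2)))) with
    (green_const m * (df * ((m - 2) * (/ (2 * sqrt r)) / sqrt r * Rpower (sqrt r) (m - 2)))).
  - apply (is_derive_scal (fun y => Rpower (sqrt (f y)) (m - 2))).
    apply (is_derive_comp (fun z => Rpower (sqrt z) (m - 2)) f); auto.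
    assert (Hsq : 0 < sqrt r) by (apply sqrt_lt_R0; auto).
    unfold Rpower. fold r. auto_derive; [split; auto|]. field. lra.
  - assert (Hsq : 0 < sqrt r) by (apply sqrt_lt_R0; auto).
    replace (Rpower r (- ((4 - m) / 2))) with (Rpower (sqrt r) (m - 2) / r).
    + replace (Rpower (sqrt r) (m - 2) / r) with (Rpower (sqrt r) (m - 2) / (sqrt r * sqrt r))
        by (rewrite sqrt_sqrt; lra).
      field. lra.
    + rewrite <- Rpower_sqrt, Rpower_mult by auto.
      replace (- ((4 - m) / 2)) with (/ 2 * (m - 2) + - (1)) by field.
      rewrite Rpower_plus, Rpower_Ropp, Rpower_1 by auto. reflexivity.
Qed.

(** The squares in the second component stand in the order of [kern w u], to match [vkern]. *)
Lemma nabla_perp_green m u w : 0 < u ^ 2 + w ^ 2 ->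
  nabla_perp (G m) (u, w) =
   (- (green_const m * (m - 2)) * (w * Rpower (u ^ 2 + w ^ 2) (- ((4 - m) / 2))),
    green_const m * (m - 2) * (u * Rpower (w ^ 2 + u ^ 2) (- ((4 - m) / 2)))).
Proof.
  intros Hpos.
  change (nabla_perp (G m) (u, w)) with
    (- Derive (fun y => G m (u, y)) w, Derive (fun y => G m (y, w)) u).
  f_equal.
  - assert (H := is_derive_green m (fun y => u ^ 2 + y ^ 2) (2 * w) w
       ltac:(auto_derive; [trivial|ring]) Hpos).
    assert (E : Derive (fun y : R => G m (u, y)) w = green_const m * (m - 2) *
      (2 * w / 2 * Rpower (u ^ 2 + w ^ 2) (- ((4 - m) / 2))))
      by (apply is_derive_unique; exact H).
    rewrite E.
    replace (2 * w / 2) with w by field. ring.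
  - assert (H := is_derive_green m (fun y => y ^ 2 + w ^ 2) (2 * u) u
       ltac:(auto_derive; [trivial|ring]) Hpos).
    assert (E : Derive (fun y : R => G m (y, w)) u = green_const m * (m - 2) *
      (2 * u / 2 * Rpower (u ^ 2 + w ^ 2) (- ((4 - m) / 2))))
      by (apply is_derive_unique; exact H).
    rewrite E, (Rplus_comm (w ^ 2)).
    replace (2 * u / 2) with u by field. ring.
Qed.

Lemma velocity_field m N gamma a (x : nat -> R) j c :
  (1 <= N)%nat -> 0 < a -> (j < N)%nat ->
  (forall k, (k < N)%nat -> k <> j -> a <= sqdist x j k) ->
  field N gamma ((4 - m) / 2) (green_const m * (m - 2)) a (2 * j + (if c : bool then 1 else 0)) x
   = (if c then snd else fst) (velocity N gamma m (pairs x) j).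
Proof.
  intros HN Ha Hj Hfar. rewrite field_index by auto. unfold others, velocity.
  assert (H : forall k, (k < N)%nat -> k <> j ->
    vkern ((4 - m) / 2) (green_const m * (m - 2)) a c (dx1 x j k) (dx2 x j k) =
    (if c then snd else fst) (nabla_perp (G m) (dx1 x j k, dx2 x j k))).
  { intros k Hk Hkj. specialize (Hfar k Hk Hkj). unfold sqdist in Hfar.
    rewrite nabla_perp_green by lra. unfold vkern. destruct c; simpl; rewrite kern_exact; auto; lra. }
  destruct c; cbv iota; cbn [fst snd]; rewrite <- rsum_sum_f_R0 by auto; apply rsum_ext; intros k Hk;
    destruct (Nat.eqb_spec k j), (Nat.eq_dec k j); try congruence; auto; rewrite H by auto;
    reflexivity.
Qed.

(** * Smoothness *)

(** Derivatives are asked for at positive times only. The class is closed under the operations that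
    build the velocity, so the equation of motion raises the order by one. *)
Fixpoint diff_n (n : nat) (f : R -> R) : Prop :=
  match n with
  | O => True
  | S n => exists f', (forall t, 0 < t -> is_derive f t (f' t)) /\ diff_n n f'
  end.

Lemma diff_n_down n : forall f, diff_n (S n) f -> diff_n n f.
Proof.
  induction n as [|n IH]; intros f [f' [H1 H2]]; [exact I|]. exists f'. split; auto.
Qed.

Lemma diff_n_const n c : diff_n n (fun _ => c).
Proof.
  revert c; induction n as [|n IH]; intros c; [exact I|]. exists (fun _ => 0). split; auto.
  intros. apply (is_derive_const (K := R_AbsRing) (V := R_NormedModule)).
Qed.

Lemma diff_n_plus n : forall f g, diff_n n f -> diff_n n g -> diff_n n (fun t => f t + g t).
Proof.
  induction n as [|n IH]; intros f g; [auto|]. intros [f' [Hf Hf']] [g' [Hg Hg']].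
  exists (fun t => f' t + g' t). split; auto.
  intros t Ht. apply (is_derive_plus (K := R_AbsRing) (V := R_NormedModule)); auto.
Qed.

Lemma diff_n_mult n : forall f g, diff_n n f -> diff_n n g -> diff_n n (fun t => f t * g t).
Proof.
  induction n as [|n IH]; intros f g Hf0 Hg0; [exact I|].
  pose proof (diff_n_down n f Hf0). pose proof (diff_n_down n g Hg0).
  destruct Hf0 as [f' [Hf Hf']]. destruct Hg0 as [g' [Hg Hg']].
  exists (fun t => f' t * g t + f t * g' t). split.
  - intros t Ht. apply (is_derive_mult (K := R_AbsRing) f g); auto. apply Rmult_comm.
  - apply diff_n_plus; apply IH; auto.
Qed.

Lemma diff_n_minus n f g : diff_n n f -> diff_n n g -> diff_n n (fun t => f t - g t).
Proof.
  intros Hf Hg. assert (H := diff_n_mult n (fun _ => -1) g (diff_n_const n (-1)) Hg).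
  assert (H1 := diff_n_plus n _ _ Hf H). cbv beta in H1.
  replace (fun t => f t - g t) with (fun t => f t + -1 * g t); auto.
  apply functional_extensionality; intros; ring.
Qed.

Lemma diff_n_rsum n k (f : nat -> R -> R) :
  (forall i, (i < k)%nat -> diff_n n (f i)) -> diff_n n (fun t => rsum k (fun i => f i t)).
Proof.
  intros H; induction k as [|k IH]; simpl; [apply diff_n_const|]. apply diff_n_plus; auto.
Qed.

Lemma diff_n_Rpower n : forall p f, (forall t, 0 < t -> 0 < f t) -> diff_n n f ->
  diff_n n (fun t => Rpower (f t) p).
Proof.
  induction n as [|n IH]; intros p f Hpos Hf0; [exact I|].
  pose proof (diff_n_down n f Hf0) as Hf1. destruct Hf0 as [f' [Hf Hf']].
  exists (fun t => f' t * (p * Rpower (f t) (p - 1))). split.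
  - intros t Ht. specialize (Hpos t Ht).
    apply (is_derive_comp (fun y => Rpower y p) f); auto.
    replace (Rpower (f t) (p - 1)) with (Rpower (f t) p / f t).
    + unfold Rpower. auto_derive; auto. field. lra.
    + unfold Rminus. rewrite Rpower_plus, Rpower_Ropp, Rpower_1 by auto. reflexivity.
  - apply diff_n_mult; auto. apply diff_n_mult; [apply diff_n_const|]. apply IH; auto.
Qed.

Lemma locally_pos t : 0 < t -> locally t (fun s => 0 < s).
Proof.
  intros Ht. exists (mkposreal t Ht). intros s Hs.
  change (Rabs (s - t) < t) in Hs. apply Rabs_lt_between in Hs. lra.
Qed.

Lemma ex_derive_n_of_diff_n n f t : diff_n n f -> 0 < t -> ex_derive_n f n t.
Proof.
  destruct n as [|n]; [intros; exact I|]. revert f t.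
  induction n as [|n IH]; intros f t [f' [H1 H2]] Ht; [exists (f' t); apply H1; auto|].
  apply (ex_derive_ext_loc (Derive_n f' n)); [|apply IH; auto].
  generalize (locally_pos t Ht). apply filter_imp. intros r Hr.
  change (Derive_n f (S n) r) with (Derive_n f (S n) r).
  replace (S n) with (n + 1)%nat by lia. rewrite <- (Derive_n_comp f n 1).
  apply Derive_n_ext_loc. generalize (locally_pos r Hr). apply filter_imp.
  intros u Hu. symmetry. apply is_derive_unique. apply H1; auto.
Qed.

(** * Null sets *)

Section NullSet.
Variable (N : nat).
Hypothesis (HN : (1 <= N)%nat).

Definition cube := ((nat -> R) * R)%type.

Definition in_cube (b : cube) (x : nat -> R) : Prop :=
  forall i, (i < 2 * N)%nat -> fst b i <= x i <= fst b i + snd b.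

Definition cube_vol (b : cube) : R := snd b ^ (2 * N).

Definition total_vol (l : list cube) : R := fold_right (fun b acc => cube_vol b + acc) 0 l.

Lemma total_vol_app l l' : total_vol (l ++ l') = total_vol l + total_vol l'.
Proof. induction l as [|b l IH]; simpl; [ring|rewrite IH; ring]. Qed.

(** A filler of volume 0, as [N >= 1]; it is also the default of [nth]. *)
Definition point_cube : cube := (fun _ => 0, 0).

Lemma cube_vol_point : cube_vol point_cube = 0.
Proof. unfold cube_vol. simpl snd. apply pow_i. lia. Qed.

Lemma cube_vol_pos b : 0 <= snd b -> 0 <= cube_vol b.
Proof. intros; apply pow_le; auto. Qed.

Lemma prefix_vol_le l K : (forall b, In b l -> 0 <= snd b) ->
  rsum K (fun k => cube_vol (nth k l point_cube)) <= total_vol l.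
Proof.
  revert l; induction K as [|K IH]; intros l Hl.
  - simpl. induction l as [|b l IHl]; simpl; [lra|].
    pose proof (cube_vol_pos b (Hl b (or_introl eq_refl))).
    assert (0 <= total_vol l) by (apply IHl; intros; apply Hl; right; auto).
    lra.
  - assert (E : forall k f, rsum (S k) f = f 0%nat + rsum k (fun i => f (S i))).
    { induction k as [|k IHk]; intros f; [simpl; ring|].
      change (rsum (S (S k)) f) with (rsum (S k) f + f (S k)). rewrite IHk. simpl. ring. }
    rewrite E. destruct l as [|b l].
    + simpl. rewrite rsum_zero; [rewrite cube_vol_point; lra|]. intros; apply cube_vol_point.
    + simpl. apply Rplus_le_compat_l. apply IH. intros; apply Hl; right; auto.
Qed.

Section Concat.
Variable (cov : nat -> list cube).
Hypothesis (Hpos : forall k b, In b (cov k) -> 0 <= snd b).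

(** The extra [point_cube] in each block makes the list longer than [k] even when the covers are
    empty. Its entry [k] is thus a genuine one and the same in all later prefixes, which enumerates
    all cubes. *)
Fixpoint covers (k : nat) : list cube :=
  match k with
  | O => point_cube :: cov 0
  | S k' => covers k' ++ point_cube :: cov (S k')
  end.

Lemma covers_length k : (k < length (covers k))%nat.
Proof.
  induction k as [|k IH]; simpl; [lia|]. rewrite length_app. simpl. lia.
Qed.

Lemma covers_nonneg k b : In b (covers k) -> 0 <= snd b.
Proof.
  induction k as [|k IH].
  - intros [<-|H]; [simpl; lra|eauto].
  - simpl. intros H. apply in_app_or in H. destruct H as [H|[<-|H]]; eauto. simpl; lra.
Qed.

Lemma covers_nth i k k' : (k <= k')%nat -> (i < length (covers k))%nat ->
  nth i (covers k') point_cube = nth i (covers k) point_cube.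
Proof.
  intros Hk Hi. induction Hk as [|k' Hk IH]; auto.
  simpl. rewrite app_nth1; auto.
  clear IH. induction Hk as [|k' Hk IH]; auto.
  simpl. rewrite length_app. lia.
Qed.

Lemma covers_vol e k : (forall k, total_vol (cov k) <= e / 2 ^ (S k)) ->
  total_vol (covers k) <= e - e / 2 ^ (S k).
Proof.
  intros H. induction k as [|k IH].
  - specialize (H 0%nat). simpl in *. rewrite cube_vol_point. lra.
  - cbn [covers]. rewrite total_vol_app.
    change (total_vol (point_cube :: cov (S k))) with (cube_vol point_cube + total_vol (cov (S k))).
    rewrite cube_vol_point. specialize (H (S k)).
    replace (e / 2 ^ S k) with (2 * (e / 2 ^ S (S k))) in IH; [lra|].
    simpl. field. apply pow_nonzero. lra.
Qed.

End Concat.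

Lemma null_set_of_covers (P : nat -> (nat -> R) -> Prop) :
  (forall k e, 0 < e -> exists l : list cube,
     (forall b, In b l -> 0 <= snd b) /\ total_vol l <= e /\
     forall x, P k x -> exists b, In b l /\ in_cube b x) ->
  null_set N (fun x => exists k, P k (flat x)).
Proof.
  intros H eps Heps.
  assert (H' : forall k, exists l : list cube,
     (forall b, In b l -> 0 <= snd b) /\ total_vol l <= eps / 2 ^ (S k) /\
     forall x, P k x -> exists b, In b l /\ in_cube b x).
  { intros k. apply H. apply Rdiv_lt_0_compat; auto. apply pow_lt; lra. }
  apply choice in H'. destruct H' as [cov Hcov].
  assert (Hpos : forall k b, In b (cov k) -> 0 <= snd b) by (intros k; apply (Hcov k)).
  set (B := fun k => nth k (covers cov k) point_cube).
  assert (HB : forall k, 0 <= snd (B k)).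
  { intros k. apply (covers_nonneg cov Hpos k). apply nth_In. apply covers_length. }
  exists (fun k j => (fst (B k) (2 * j)%nat, fst (B k) (2 * j + 1)%nat)),
         (fun k j => (fst (B k) (2 * j)%nat + snd (B k), fst (B k) (2 * j + 1)%nat + snd (B k))).
  simpl fst. simpl snd. split; [|split].
  - intros k j. specialize (HB k). lra.
  - intros M.
    replace (sum_f_R0 _ M) with (rsum (S M) (fun k => cube_vol (B k))).
    + rewrite (rsum_ext (S M) _ (fun k => cube_vol (nth k (covers cov M) point_cube))).
      * eapply Rle_trans; [apply prefix_vol_le; apply covers_nonneg; auto|].
        eapply Rle_trans; [apply (covers_vol cov eps M); intros; apply Hcov|].
        assert (0 <= eps / 2 ^ S M); [|lra].
        apply Rdiv_le_0_compat; [lra|apply pow_lt; lra].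
      * intros k Hk. unfold B. f_equal. symmetry. apply covers_nth; [lia|apply covers_length].
    + rewrite rsum_sum_f_R0 by lia. replace (S M - 1)%nat with M by lia.
      apply sum_eq. intros k _. unfold cube_vol.
      rewrite (prodR_ext N _ (fun _ => snd (B k) ^ 2)) by (intros; ring).
      rewrite pow_mult. generalize (snd (B k) ^ 2). intros c. clear.
      induction N as [|p IH]; simpl; [reflexivity|]. rewrite <- IH. ring.
  - intros x [k Hk]. destruct (proj2 (proj2 (Hcov k)) (flat x) Hk) as [b [Hb Hx]].
    assert (Hin : In b (covers cov k)).
    { destruct k; simpl; [right; auto|]. apply in_or_app. right; right; auto. }
    apply (In_nth _ _ point_cube) in Hin. destruct Hin as [i [Hi Hbi]].
    exists i. intros j Hj.
    assert (E : B i = b).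
    { unfold B. destruct (Nat.le_gt_cases k i) as [Hki|Hki].
      - rewrite (covers_nth cov i k i); auto.
      - rewrite <- (covers_nth cov i i k); [auto|lia|apply covers_length]. }
    rewrite E, <- flat_even, <- flat_odd. split; apply Hx; lia.
Qed.

End NullSet.

(** * Global solutions *)

Section Gluing.
Variables (m : R) (N : nat) (gamma : nat -> R).
Hypotheses (Hm1 : 1 < m) (Hm2 : m < 2) (HN : (1 <= N)%nat).

Let cc := green_const m * (m - 2).

Lemma reg_flow_exists sigma : 0 < sigma -> exists phi, reg_flow m N gamma cc sigma phi.
Proof.
  intros Hsig. assert (Ha : 0 < sigma ^ 4) by (apply pow_lt; auto).
  destruct (field_lip N gamma ((4 - m) / 2) cc ltac:(lra) _ Ha) as [lam [Hlam Hlip]].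
  destruct (flow_exists (2 * N) _ lam Hlam Hlip) as [phi Hphi]. exists phi. exact Hphi.
Qed.

Lemma not_near_collision sigma T phi x :
  ~ near_collision N sigma T phi x ->
  forall t j k, 0 <= t <= T -> (j < N)%nat -> (k < N)%nat -> k <> j ->
    sigma ^ 4 < sqdist (phi t x) j k.
Proof.
  intros H t j k Ht Hj Hk Hkj. apply Rnot_le_lt. intros Hle. apply H.
  exists t, j, k. repeat split; auto; lra.
Qed.

Lemma reg_field_velocity sigma x j c : 0 < sigma -> (j < N)%nat ->
  (forall k, (k < N)%nat -> k <> j -> sigma ^ 4 <= sqdist x j k) ->
  reg_field m N gamma cc sigma (2 * j + (if c : bool then 1 else 0)) x =
    (if c then snd else fst) (velocity N gamma m (pairs x) j).
Proof.
  intros Hsig Hj H. apply velocity_field; auto. apply pow_lt; auto.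
Qed.

(** Along the coarser trajectory all distances exceed both scales, where the two fields equal the
    singular velocity. It therefore also solves the finer system, and uniqueness applies. *)
Lemma reg_flow_agree_aux sigma sigma' T phi phi' x :
  0 <= T -> 0 < sigma <= sigma' -> reg_flow m N gamma cc sigma phi -> reg_flow m N gamma cc sigma' phi' ->
  ~ near_collision N sigma' T phi' x ->
  forall t i, 0 <= t <= T -> (i < 2 * N)%nat -> phi t x i = phi' t x i.
Proof.
  intros HT Hsig [H0 Hphi] [H0' Hphi'] Hnc t i Ht Hi.
  assert (Ha : 0 < sigma ^ 4) by (apply pow_lt; lra).
  assert (Hpow : sigma ^ 4 <= sigma' ^ 4) by (apply pow_incr; lra).
  destruct (field_lip N gamma ((4 - m) / 2) cc ltac:(lra) _ Ha) as [lam [Hlam Hlip]].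
  apply (trajectory_unique (2 * N) (reg_field m N gamma cc sigma) lam Hlam Hlip
    (fun t => phi t x) (fun t => phi' t x) T); auto.
  - intros p r Hp _. apply Hphi; auto.
  - intros p r Hp Hr.
    assert (E : reg_field m N gamma cc sigma p (phi' r x) = reg_field m N gamma cc sigma' p (phi' r x)).
    { destruct (index_cases N p Hp) as [j [c [Hj ->]]].
      assert (Hfar := fun k => not_near_collision _ _ _ _ Hnc r j k Hr Hj).
      rewrite !reg_field_velocity; auto; try lra.
      - intros k Hk Hkj. specialize (Hfar k Hk Hkj). lra.
      - intros k Hk Hkj. specialize (Hfar k Hk Hkj). lra. }
    rewrite E. apply Hphi'; auto.
  - intros p Hp. rewrite H0, H0'. reflexivity.
Qed.

Lemma reg_flow_agree sigma sigma' T phi phi' x :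
  0 <= T -> 0 < sigma -> 0 < sigma' ->
  reg_flow m N gamma cc sigma phi -> reg_flow m N gamma cc sigma' phi' ->
  ~ near_collision N sigma T phi x -> ~ near_collision N sigma' T phi' x ->
  forall t i, 0 <= t <= T -> (i < 2 * N)%nat -> phi t x i = phi' t x i.
Proof.
  intros HT Hs Hs' Hf Hf' Hn Hn' t i Ht Hi. destruct (Rle_dec sigma sigma') as [Hle|Hgt].
  - apply (reg_flow_agree_aux sigma sigma' T); auto.
  - symmetry. apply (reg_flow_agree_aux sigma' sigma T); auto. lra.
Qed.

Lemma near_collision_mono sigma T T' phi x : T <= T' ->
  near_collision N sigma T phi x -> near_collision N sigma T' phi x.
Proof. intros HT [t [j [k [Ht H]]]]. exists t, j, k. split; auto; lra. Qed.

Lemma diff_n_velocity n (X : R -> nat -> R) j c :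
  (j < N)%nat -> (forall i, (i < 2 * N)%nat -> diff_n n (fun t => X t i)) ->
  (forall t k, 0 < t -> (k < N)%nat -> k <> j -> 0 < sqdist (X t) j k) ->
  diff_n n (fun t => (if c : bool then snd else fst) (velocity N gamma m (pairs (X t)) j)).
Proof.
  intros Hj HX Hfar.
  assert (E : forall t, (if c then snd else fst) (velocity N gamma m (pairs (X t)) j) =
    rsum N (fun k => if Nat.eqb k j then 0 else gamma k *
      (if c then snd else fst) (nabla_perp (G m) (dx1 (X t) j k, dx2 (X t) j k)))).
  { intros t. destruct c; unfold velocity; cbv iota; cbn [fst snd];
      rewrite <- rsum_sum_f_R0 by auto; apply rsum_ext; intros k Hk;
      destruct (Nat.eqb_spec k j), (Nat.eq_dec k j); try congruence; reflexivity. }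
  replace (fun t => (if c then snd else fst) (velocity N gamma m (pairs (X t)) j)) with
    (fun t => rsum N (fun k => if Nat.eqb k j then 0 else gamma k *
      (if c then snd else fst) (nabla_perp (G m) (dx1 (X t) j k, dx2 (X t) j k))))
    by (apply functional_extensionality; intros; symmetry; apply E).
  apply diff_n_rsum. intros k Hk. destruct (Nat.eqb_spec k j) as [|Hkj]; [apply diff_n_const|].
  apply diff_n_mult; [apply diff_n_const|].
  assert (H1 : diff_n n (fun t => dx1 (X t) j k)).
  { apply (diff_n_minus n (fun t => X t (2 * j)%nat)); apply HX; lia. }
  assert (H2 : diff_n n (fun t => dx2 (X t) j k)).
  { apply (diff_n_minus n (fun t => X t (2 * j + 1)%nat)); apply HX; lia. }
  assert (Hsq : forall f g, diff_n n f -> diff_n n g -> diff_n n (fun t => f t ^ 2 + g t ^ 2)).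
  { intros f g Hf Hg. replace (fun t => f t ^ 2 + g t ^ 2) with (fun t => f t * f t + g t * g t).
    - apply diff_n_plus; apply diff_n_mult; auto.
    - apply functional_extensionality; intros; ring. }
  set (p := - ((4 - m) / 2)).
  (* The formula for [nabla_perp] requires distinct points, so the functions to be exchanged agree
     only for [t > 0]. *)
  assert (Hex : forall f g, diff_n n f ->
     (forall t, 0 < t -> f t = g t) -> diff_n n g).
  { destruct n as [|n0]; [intros; exact I|]. intros f g [f' [Hf Hf']] Hfg.
    exists f'. split; auto. intros t Ht. apply (is_derive_ext_loc f); auto.
    generalize (locally_pos t Ht). apply filter_imp; auto. }
  destruct c.
  - apply (Hex (fun t => green_const m * (m - 2) *
      (dx1 (X t) j k * Rpower (dx2 (X t) j k ^ 2 + dx1 (X t) j k ^ 2) p))).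
    + apply diff_n_mult; [apply diff_n_const|]. apply diff_n_mult; auto.
      apply diff_n_Rpower; auto. intros t Ht. specialize (Hfar t k Ht Hk Hkj). unfold sqdist in Hfar. lra.
    + intros t Ht. specialize (Hfar t k Ht Hk Hkj). rewrite nabla_perp_green; auto.
  - apply (Hex (fun t => - (green_const m * (m - 2)) *
      (dx2 (X t) j k * Rpower (dx1 (X t) j k ^ 2 + dx2 (X t) j k ^ 2) p))).
    + apply diff_n_mult; [apply diff_n_const|]. apply diff_n_mult; auto.
      apply diff_n_Rpower; auto. intros t Ht. specialize (Hfar t k Ht Hk Hkj). exact Hfar.
    + intros t Ht. specialize (Hfar t k Ht Hk Hkj). rewrite nabla_perp_green; auto.
Qed.

(** The good regularized trajectories for different [K] agree on common time intervals and glue to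
    one curve; its smoothness follows by inserting it into its own equation. *)
Lemma global_of_no_collision (Phi : R -> R -> (nat -> R) -> nat -> R) (x : nat -> R * R) :
  (forall sigma, 0 < sigma -> reg_flow m N gamma cc sigma (Phi sigma)) ->
  (forall K : nat, exists sigma, 0 < sigma /\ ~ near_collision N sigma (INR K) (Phi sigma) (flat x)) ->
  exists X, global_smooth_solution N gamma m x X.
Proof.
  intros HPhi Hgood. apply choice in Hgood. destruct Hgood as [sg Hsg].
  assert (HK : forall t, exists K : nat, t < INR K).
  { intros t. destruct (INR_unbounded t) as [K HK]. exists K. lra. }
  apply choice in HK. destruct HK as [kf Hkf].
  set (Y := fun k t => Phi (sg k) t (flat x)).
  (* As [t < INR (kf t)] strictly, [Z] coincides near [t > 0] with the single trajectory
     [Y (kf t)]. *)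
  set (Z := fun t => Y (kf t) t).
  assert (HYY : forall k k' t i, 0 <= t -> t <= INR k -> t <= INR k' -> (i < 2 * N)%nat ->
             Y k t i = Y k' t i).
  { intros k k' t i Ht Hk Hk' Hi. destruct (Hsg k) as [Hs Hn]. destruct (Hsg k') as [Hs' Hn'].
    apply (reg_flow_agree (sg k) (sg k') t); auto; try lra.
    - intros H; apply Hn; revert H; apply near_collision_mono; auto.
    - intros H; apply Hn'; revert H; apply near_collision_mono; auto. }
  assert (HZ : forall k t i, 0 <= t -> t <= INR k -> (i < 2 * N)%nat -> Z t i = Y k t i).
  { intros k t i Ht Hk Hi. apply HYY; auto. specialize (Hkf t). lra. }
  assert (Hfar : forall t j k, 0 <= t -> (j < N)%nat -> (k < N)%nat -> k <> j ->
             sg (kf t) ^ 4 < sqdist (Z t) j k).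
  { intros t j k Ht Hj Hk Hkj. destruct (Hsg (kf t)) as [Hs Hn].
    apply (not_near_collision _ _ _ _ Hn t j k); auto. specialize (Hkf t). lra. }
  assert (Hfar0 : forall t j k, 0 <= t -> (j < N)%nat -> (k < N)%nat -> k <> j ->
             0 < sqdist (Z t) j k).
  { intros t j k Ht Hj Hk Hkj. eapply Rlt_trans; [|apply Hfar; auto].
    apply pow_lt. apply (Hsg (kf t)). }
  assert (HdZ : forall t j c, 0 < t -> (j < N)%nat ->
     is_derive (fun r => Z r (2 * j + (if c : bool then 1 else 0))%nat) t
       ((if c then snd else fst) (velocity N gamma m (pairs (Z t)) j))).
  { intros t j c Ht Hj.
    assert (Hi : (2 * j + (if c then 1 else 0) < 2 * N)%nat) by (destruct c; lia).
    destruct (Hsg (kf t)) as [Hs Hn].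
    rewrite <- (reg_field_velocity (sg (kf t)) (Z t) j c Hs Hj).
    2:{ intros k Hk Hkj. left. apply Hfar; auto. lra. }
    apply (is_derive_ext_loc (fun r => Y (kf t) r (2 * j + (if c then 1 else 0))%nat)).
    - assert (Hlt : locally t (fun r => r < INR (kf t))).
      { exists (mkposreal (INR (kf t) - t) ltac:(specialize (Hkf t); lra)). intros r Hr.
        change (Rabs (r - t) < INR (kf t) - t) in Hr. apply Rabs_lt_between in Hr. lra. }
      generalize (filter_and _ _ (locally_pos t Ht) Hlt). apply filter_imp.
      intros r [Hr0 Hr1]. symmetry. apply HZ; auto; lra.
    - apply (proj2 (HPhi _ Hs) (flat x)); auto. }
  assert (Hsmooth : forall n i, (i < 2 * N)%nat -> diff_n n (fun t => Z t i)).
  { induction n as [|n IH]; intros i Hi; [exact I|].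
    destruct (index_cases N i Hi) as [j [c [Hj ->]]].
    exists (fun t => (if c then snd else fst) (velocity N gamma m (pairs (Z t)) j)).
    split; [intros; apply HdZ; auto|].
    apply diff_n_velocity; auto. intros t k Ht Hk Hkj. apply Hfar0; auto. lra. }
  assert (Hright : forall i, (i < 2 * N)%nat ->
     filterlim (fun t => Z t i) (at_right 0) (locally (flat x i))).
  { intros i Hi.
    assert (Hs1 := proj1 (Hsg 1%nat)).
    assert (Hc : continuous (fun t => Y 1%nat t i) 0).
    { apply (ex_derive_continuous (K := R_AbsRing) (V := R_NormedModule)).
      eexists. apply (proj2 (HPhi _ Hs1) (flat x)); auto. }
    assert (E0 : Y 1%nat 0 i = flat x i) by apply (proj1 (HPhi _ Hs1)).
    unfold continuous in Hc. rewrite E0 in Hc.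
    apply (filterlim_ext_loc (fun t => Y 1%nat t i)).
    - exists (mkposreal 1 Rlt_0_1). intros r Hr Hr0.
      change (Rabs (r - 0) < 1) in Hr. rewrite Rminus_0_r, Rabs_pos_eq in Hr by lra.
      symmetry. apply HZ; auto; simpl; lra.
    - eapply filterlim_filter_le_1; [|exact Hc]. apply filter_le_within. }
  exists (fun t => pairs (Z t)). split; [|split; [|split; [|split]]].
  - intros j Hj. unfold pairs. rewrite (surjective_pairing (x j)), <- flat_even, <- flat_odd.
    assert (Hs1 := proj1 (Hsg 1%nat)).
    rewrite !(HZ 1%nat 0) by (try lia; simpl; lra). unfold Y.
    rewrite !(proj1 (HPhi _ Hs1)). reflexivity.
  - intros t j k Ht Hj Hk Hjk E. assert (H := Hfar0 t j k Ht Hj Hk (not_eq_sym Hjk)).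
    assert (E1 : Z t (2 * j)%nat = Z t (2 * k)%nat) by exact (f_equal fst E).
    assert (E2 : Z t (2 * j + 1)%nat = Z t (2 * k + 1)%nat) by exact (f_equal snd E).
    unfold sqdist, dx1, dx2 in H. rewrite E1, E2 in H. lra.
  - intros j Hj. rewrite <- flat_even, <- flat_odd.
    split; [apply (Hright (2 * j)%nat)|apply (Hright (2 * j + 1)%nat)]; lia.
  - intros j n t Hj Ht.
    split; apply ex_derive_n_of_diff_n; auto;
      [apply (Hsmooth n (2 * j)%nat)|apply (Hsmooth n (2 * j + 1)%nat)]; lia.
  - intros j t Hj Ht. split; [|exact (HdZ t j true Ht Hj)].
    assert (H1 := HdZ t j false Ht Hj). cbv iota in H1. rewrite Nat.add_0_r in H1. exact H1.
Qed.

End Gluing.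

Theorem theorem3p1 (m : R) (N : nat) (gamma : nat -> R) :
  1 < m -> m < 2 -> (1 <= N)%nat ->
  (forall J : nat -> bool, (exists j, (j < N)%nat /\ J j = true) ->
     sum_f_R0 (fun k => if J k then gamma k else 0) (N - 1) <> 0) ->
  exists Nset : (nat -> R * R) -> Prop,
    null_set N Nset /\
    forall x : nat -> R * R, ~ Nset x ->
      exists X : R -> nat -> R * R, global_smooth_solution N gamma m x X.
Proof.
  intros Hm1 Hm2 HN Hgam.
  destruct (subset_sums_gap N gamma) as [g0 [Hg0 Hgap]].
  { intros J HJ. rewrite rsum_sum_f_R0 by auto. apply Hgam; auto. }
  (* One flow is fixed for each [sigma], before any initial datum, so that the bad set can be
     defined from it; for [sigma <= 0] the value is a dummy. *)
  assert (HPhi : forall sigma, exists phi, 0 < sigma ->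
            reg_flow m N gamma (green_const m * (m - 2)) sigma phi).
  { intros sigma. destruct (Rlt_dec 0 sigma) as [H|H].
    - destruct (reg_flow_exists m N gamma Hm2 sigma H) as [phi Hphi]. exists phi; auto.
    - exists (fun _ x => x). intros; lra. }
  apply choice in HPhi. destruct HPhi as [Phi HPhi].
  (* A near collision is demanded at every [sigma], so the cover may use whichever [sigma] suits the
     target volume, while a point outside the set has a good [sigma] for each time. *)
  set (P := fun (K : nat) (x : nat -> R) => (forall i, (i < 2 * N)%nat -> Rabs (x i) <= INR K) /\
     forall sigma, 0 < sigma -> near_collision N sigma (INR K) (Phi sigma) x).
  exists (fun x => exists K, P K (flat x)). split.
  - apply null_set_of_covers; auto. intros K e He.
    destruct (near_collision_cover m N gamma (green_const m * (m - 2)) g0 Hm1 Hm2 HN Hg0 Hgap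
      (INR K) (INR K) e (pos_INR K) (pos_INR K) He) as [sigma [Hs [Hs1 Hcov]]].
    destruct (Hcov (Phi sigma) (HPhi sigma Hs)) as [l [delta [Hd [Hvol Hin]]]].
    exists (map (fun y => (y, delta)) l). split; [|split].
    + intros b Hb. apply in_map_iff in Hb. destruct Hb as [y [<- _]]. simpl; lra.
    + eapply Rle_trans; [|apply Hvol]. right. clear.
      induction l as [|y l IH]; [simpl; ring|].
      cbn [map total_vol fold_right]. fold (total_vol N (map (fun y => (y, delta)) l)).
      change (length (y :: l)) with (S (length l)). rewrite S_INR, IH. unfold cube_vol. simpl snd. ring.
    + intros x [Hx Hcol]. destruct (Hin x Hx (Hcol sigma Hs)) as [y [Hy Hyx]].
      exists (y, delta). split; [apply (in_map (fun y => (y, delta))); auto|exact Hyx].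
  - intros x Hx.
    assert (HB : exists B : nat, forall i, (i < 2 * N)%nat -> Rabs (flat x i) <= INR B).
    { destruct (INR_unbounded (rsum (2 * N) (fun i => Rabs (flat x i)))) as [B HB]. exists B.
      intros i Hi. assert (H := rsum_term_le (2 * N) (fun i => Rabs (flat x i)) i
         (fun _ _ => Rabs_pos _) Hi). cbv beta in H. lra. }
    destruct HB as [B HB].
    apply (global_of_no_collision m N gamma Hm2 HN Phi); auto. intros K.
    (* One index bounds both the box and the time, so the maximum is taken; near collisions up to
       [K] are also near collisions up to the larger time. *)
    apply NNPP. intros Hno. apply Hx. exists (Nat.max B K). split.
    + intros i Hi. eapply Rle_trans; [apply HB; auto|]. apply le_INR, Nat.le_max_l.
    + intros sigma Hs. apply NNPP. intros Hn. apply Hno. exists sigma. split; auto.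
      intros Hc. apply Hn. revert Hc. apply near_collision_mono. apply le_INR, Nat.le_max_r.
Qed.
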